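(* Let $n\ge0$ be an integer and let $p\in\left[\frac{2(N-1)}{N+2\nu+4n+4},\frac{N}{\mu-\nu}\right)$ with $1\le p<\infty$. Let $x=r\omega$, with $r>0$ and $\omega\in\mathbb S^{N-1}$. Assume that $u_0$ admits the spherical harmonic expansion $$u_0(r,\omega)=\sum_{\ell=0}^{\infty}\sum_{m=1}^{d_\ell}u_{0,\ell,m}(r)\,Y_{\ell,m}(\omega).$$ For each $(\ell,m)$, assume that $$\|u_{0,\ell,m}\|_{L^1_{\nu_\ell,n+1}}:=\int_{\mathbb R^N}|x|^{\nu_\ell-\mu}\bigl(1+|x|^{2n+2}\bigr)|u_{0,\ell,m}(|x|)|\,dx<\infty .$$ Assume moreover that $$\sum_{\ell=0}^{\infty}\sum_{m=1}^{d_\ell}\|Y_{\ell,m}\|_{L^p(\mathbb S^{N-1})}\,C_{\ell,n,p}\,\|u_{0,\ell,m}\|_{L^1_{\nu_\ell,n+1}}<\infty ,$$ with the constants $C_{\ell,n,p}$ described in the context. Let $u(\cdot,t)=S_\lambda(t)u_0$ be the mild solution defined by the non-radial Hardy heat kernel $K$, that is, $u(x,t)=\int_{\mathbb R^N}K(x,y,t)u_0(y)\,dy$. Then $$\lim_{t\to\infty}t^{\gamma_p+n}\,\bigl\|u(\cdot,t)-A_n^\infty(\cdot,t)\bigr\|_{L^p(\mathbb R^N)}=0 ,$$ where $$A_n^\infty(x,t)=\sum_{\ell=0}^{\infty}\sum_{m=1}^{d_\ell}\sum_{j=0}^{n}\mathcal P_{\ell,m,j}(x,t)\,Y_{\ell,m}(\omega),$$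 with $$\mathcal P_{\ell,m,j}(x,t)=M^{\ell,m}_{\nu_\ell,j}\,t^{-1-\nu_\ell-j}|x|^{\nu_\ell-\mu}e^{-\frac{|x|^2}{4t}}P_j^{(\nu_\ell)}\Bigl(\frac{|x|^2}{t}\Bigr),\qquad M^{\ell,m}_{\nu_\ell,j}=\int_{\mathbb R^N}|x|^{\nu_\ell-\mu+2j}\,u_{0,\ell,m}(|x|)\,dx ,$$ and $$P_j^{(\alpha)}(s)=\sum_{q=0}^{j}\frac{(-1)^{j-q}}{2^{2(\alpha+j+q)+1}\,q!\,(j-q)!\,\Gamma(q+\alpha+1)}\,s^q .$$
   Context: Standing notation: $N\ge3$ is an integer, $0\le\lambda\le\frac{(N-2)^2}{4}$, $\mu=\frac{N-2}{2}$, $\nu=\sqrt{\mu^2-\lambda}$, $\nu_\ell=\sqrt{(\mu+\ell)^2-\lambda}$ for $\ell\in\mathbb N_0$ (so $\nu_0=\nu$), and $\frac{N}{\mu-\nu}$ is read as $+\infty$ if $\mu=\nu$. For $1\le p<\infty$, $\gamma_p=\frac N2\bigl(1-\frac1p\bigr)-\frac{\mu-\nu}{2}$. For each $\ell\in\mathbb N_0$, $\{Y_{\ell,m}\}_{m=1}^{d_\ell}$ is an orthonormal basis of the spherical harmonics of degree $\ell$ on $\mathbb S^{N-1}$, so that $-\Delta_{\mathbb S^{N-1}}Y_{\ell,m}=\ell(\ell+N-2)Y_{\ell,m}$, and $d_\ell$ is the dimension of this eigenspace. $I_\alpha$ denotes the modified Bessel function of the first kind. The equation is the heat equation with Hardy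 potential $u_t=\Delta u+\lambda|x|^{-2}u$ on $\mathbb R^N\times(0,\infty)$, $u(\cdot,0)=u_0$. Its non-radial Hardy heat kernel is, for $x=r\omega$, $y=\rho\eta$ with $r,\rho>0$ and $\omega,\eta\in\mathbb S^{N-1}$, $$K(x,y,t)=\frac1{2t}(r\rho)^{-\mu}\exp\Bigl(-\frac{r^2+\rho^2}{4t}\Bigr)\sum_{\ell=0}^{\infty}I_{\nu_\ell}\Bigl(\frac{r\rho}{2t}\Bigr)\sum_{m=1}^{d_\ell}Y_{\ell,m}(\omega)Y_{\ell,m}(\eta).$$ Constants $C_{\ell,n,p}$: these are the constants, independent of $t$, of the radial remainder estimate with Bessel parameter $\nu_\ell$. That is, for every radial $f$ with $\|f\|_{L^1_{\nu_\ell,n+1}}=\int_{\mathbb R^N}|x|^{\nu_\ell-\mu}(1+|x|^{2n+2})|f(|x|)|\,dx<\infty$ and every $t\ge1$, $$t^{\gamma_p+n}\,\Bigl\|\int_{\mathbb R^N}k_\ell(x,y,t)f(|y|)\,dy-\sum_{j=0}^n\Bigl(\int_{\mathbb R^N}|y|^{\nu_\ell-\mu+2j}f(|y|)\,dy\Bigr)t^{-1-\nu_\ell-j}|x|^{\nu_\ell-\mu}e^{-\frac{|x|^2}{4t}}P_j^{(\nu_\ell)}\Bigl(\frac{|x|^2}{t}\Bigr)\Bigr\|_{L^p_x(\mathbb R^N)}\le C_{\ell,n,p}\,\|f\|_{L^1_{\nu_\ell,n+1}},$$ where $k_\ell(x,y,t)=\frac1{2t}(|x||y|)^{-\mu}\exp\bigl(-\frac{|x|^2+|y|^2}{4t}\bigr)I_{\nu_\ell}\bigl(\frac{|x||y|}{2t}\bigr)$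 is the radial Hardy heat kernel with parameter $\nu_\ell$.
   Formalization: Orthonormality and the L^p norms on the sphere use surface measure normalised to total mass 1 (else the limit fails by a factor |S^{N-1}|); the integral defining u is assumed absolutely convergent for x≠0, t>0; the expansion of u_0 is meant in L^2 of the sphere for a.e. r. *)

(* Defs.v *)
From HB Require Import structures.
From mathcomp Require Import all_boot all_order all_algebra.
From mathcomp Require Import all_classical all_reals all_analysis.
From mathcomp Require Import measurable_realfun.
(* A plain Import of mpoly clashes with the notations of MathComp-Analysis. *)
From mathcomp Require mpoly.
Import (canonicals, coercions) mpoly.
Set Implicit Arguments.
Unset Strict Implicit.
Unset Printing Implicit Defensive.
Import Order.TTheory GRing.Theory Num.Theory.
Import numFieldNormedType.Exports.
Local Open Scope classical_set_scope.
Local Open Scope ring_scope.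

(* Points of R^n are n-tuples, with the product (Borel) sigma-algebra of the
   library.  Lebesgue measure on R^(n+1) is built as the image of
   lebesgue_measure \x (Lebesgue measure on R^n) under (x, v) |-> x :: v. *)

Section cons_measure.
Context (R : realType) (n : nat).
Variable m : {sigma_finite_measure set (n.-tuple R) -> \bar R}.

Definition cons_point (z : measurableTypeR R * n.-tuple R) : n.+1.-tuple R :=
  [the n.+1.-tuple R of z.1 :: z.2].

Lemma measurable_cons_point : measurable_fun [set: _] cons_point.
Proof. exact: (measurable_cons measurable_fst measurable_snd). Qed.

Definition cons_measure : set (n.+1.-tuple R) -> \bar R :=
  pushforward (lebesgue_measure \x m)%E cons_point.

Let cons_measure0 : cons_measure set0 = 0%E.
Proof. by rewrite /cons_measure /pushforward preimage_set0 measure0. Qed.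

Let cons_measure_ge0 A : (0 <= cons_measure A)%E.
Proof. by rewrite /cons_measure /pushforward; exact: measure_ge0. Qed.

Let cons_measure_sigma_additive : semi_sigma_additive cons_measure.
Proof.
move=> F mF tF mUF; rewrite /cons_measure /pushforward preimage_bigcup.
have mpre B : measurable B -> measurable (cons_point @^-1` B).
  by move=> mB; rewrite -[X in measurable X]setTI; exact: measurable_cons_point.
apply: measure_semi_sigma_additive.
- by move=> k; exact: mpre.
- apply/trivIsetP => /= i j _ _ ij; rewrite -preimage_setI.
  by move/trivIsetP : tF => /(_ _ _ _ _ ij) ->//; rewrite preimage_set0.
- by rewrite -preimage_bigcup; exact: mpre.
Qed.

HB.instance Definition _ := isMeasure.Build _ _ _ cons_measure
  cons_measure0 cons_measure_ge0 cons_measure_sigma_additive.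

Let cons_measure_sigma_finite : sigma_finite setT cons_measure.
Proof.
have /sigma_finiteP[F [TF ndF Foo]] :=
  sigma_finiteT (lebesgue_measure : {sigma_finite_measure set _ -> \bar R}).
have /sigma_finiteP[G [TG ndG Goo]] := sigma_finiteT m.
pose uncons (v : n.+1.-tuple R) : measurableTypeR R * n.-tuple R :=
  (thead v, [tuple of behead v]).
have unconsK z : uncons (cons_point z) = z.
  by case: z => x v; congr pair; apply/val_inj.
have muncons : measurable_fun setT uncons.
  apply: measurable_fun_pair; first exact: measurable_tnth.
  exact: measurable_behead.
exists (fun k => uncons @^-1` (F k `*` G k)).
  rewrite -preimage_bigcup (_ : \bigcup_k _ = setT) ?preimage_setT//.
  apply/seteqP; split=> // -[x v] _.
  have [i _ Fix] : (\bigcup_i F i) x by rewrite -TF.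
  have [j _ Gjv] : (\bigcup_j G j) v by rewrite -TG.
  exists (maxn i j) => //; split.
    by move: x Fix; exact/subsetPset/ndF/leq_maxl.
  by move: v Gjv; exact/subsetPset/ndG/leq_maxr.
move=> k; have [mF Fk] := Foo k; have [mG Gk] := Goo k; split.
  by rewrite -[X in measurable X]setTI; apply: muncons => //; exact: measurableX.
rewrite /cons_measure /pushforward.
rewrite (_ : _ @^-1` _ = F k `*` G k); last first.
  by apply/funext => z; exact: (congr1 (F k `*` G k) (unconsK z)).
by rewrite product_measure1E// lte_mul_pinfty// ge0_fin_numE.
Qed.

HB.instance Definition _ := Measure_isSigmaFinite.Build _ _ _ cons_measure
  cons_measure_sigma_finite.

End cons_measure.

Fixpoint lebesgueN (R : realType) (n : nat) :
    {sigma_finite_measure set (n.-tuple R) -> \bar R} :=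
  match n with
  | 0 => [the {sigma_finite_measure set (0.-tuple R) -> \bar R} of
           dirac (@nil_tuple R)]
  | k.+1 => [the {sigma_finite_measure set (k.+1.-tuple R) -> \bar R} of
              cons_measure (lebesgueN R k)]
  end.

Section sphere.
Context (R : realType) (N : nat).
Implicit Type x : N.-tuple R.

Definition enorm x : R := Num.sqrt (\sum_(i < N) tnth x i ^+ 2).

Definition scalev (a : R) x : N.-tuple R := [tuple a * tnth x i | i < N].

(* dir 0 = 0 and, below, 0 `^ a = 0 for a != 0: the origin is Lebesgue-null, so
   these conventions play no role. *)
Definition dir x : N.-tuple R := scalev (enorm x)^-1 x.

Definition sphere : set (N.-tuple R) := [set w | enorm w = 1].

Definition unit_ball : set (N.-tuple R) := [set x | enorm x <= 1].

Lemma measurable_enorm : measurable_fun [set: N.-tuple R] enorm.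
Proof.
apply: (@measurableT_comp _ _ _ _ _ _ (@Num.sqrt R) _
    (fun x => \sum_(i < N) tnth x i ^+ 2)).
  by apply: continuous_measurable_fun; exact: sqrt_continuous.
apply: measurable_sum => i; apply: measurable_funX.
exact: measurable_tnth.
Qed.

Lemma measurable_dir : measurable_fun [set: N.-tuple R] dir.
Proof.
apply/measurable_fun_tnthP => i.
rewrite (_ : _ \o _ = fun x => enorm x `^ (-1) * tnth x i); last first.
  by apply/funext => x /=; rewrite tnth_mktuple powR_inv1// sqrtr_ge0.
apply: measurable_funM; last exact: measurable_tnth.
apply: (measurableT_comp (f := @powR R ^~ (-1)) _ measurable_enorm).
exact: measurable_powR.
Qed.

Lemma measurable_unit_ball : measurable unit_ball.
Proof.
rewrite -[unit_ball]setTI (_ : unit_ball = enorm @^-1` `]-oo, 1]); last first.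
  by apply/seteqP; split => x /=; rewrite in_itv.
by apply: measurable_enorm => //; exact: measurable_itv.
Qed.

(* A |-> |{x in the unit ball : x/|x| \in A}|, that is 1/N times the surface
   measure of A for A included in the sphere. *)
Definition cone_measure : set (N.-tuple R) -> \bar R :=
  pushforward (mrestr (lebesgueN R N) measurable_unit_ball) dir.

Let mpre_dir B : measurable B -> measurable (dir @^-1` B).
Proof. by move=> mB; rewrite -[X in measurable X]setTI; exact: measurable_dir. Qed.

Let cone_measure0 : cone_measure set0 = 0%E.
Proof. by rewrite /cone_measure /pushforward preimage_set0 measure0. Qed.

Let cone_measure_ge0 A : (0 <= cone_measure A)%E.
Proof. by rewrite /cone_measure /pushforward; exact: measure_ge0. Qed.

Let cone_measure_sigma_additive : semi_sigma_additive cone_measure.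
Proof.
move=> F mF tF mUF; rewrite /cone_measure /pushforward preimage_bigcup.
apply: measure_semi_sigma_additive.
- by move=> k; exact: mpre_dir.
- apply/trivIsetP => /= i j _ _ ij; rewrite -preimage_setI.
  by move/trivIsetP : tF => /(_ _ _ _ _ ij) ->//; rewrite preimage_set0.
- by rewrite -preimage_bigcup; exact: mpre_dir.
Qed.

HB.instance Definition _ := isMeasure.Build _ _ _ cone_measure
  cone_measure0 cone_measure_ge0 cone_measure_sigma_additive.

Lemma inv_ball_ge0 : 0 <= (fine (lebesgueN R N unit_ball))^-1.
Proof. by rewrite invr_ge0 fine_ge0. Qed.

(* Surface measure normalised to total mass 1; "orthonormal" refers to it.
   With this normalisation the (l, m) component of
   \int_(R^N) K(x, y, t) u0(y) dy is \int_(R^N) k_l(x, y, t) u0lm(|y|) dy, both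
   for the Lebesgue measure dy of R^N.  With the unnormalised surface measure
   a factor 1/|S^(N-1)| would appear and u and A_n^oo would have different
   leading terms. *)
Definition sphere_measure : {measure set (N.-tuple R) -> \bar R} :=
  [the {measure set (N.-tuple R) -> \bar R} of
    mscale (NngNum inv_ball_ge0) cone_measure].

Definition sphere_Lnorm (p : R) (g : N.-tuple R -> R) : \bar R :=
  'N[sphere_measure]_p%:E[(EFin \o g) \_ sphere].

Definition sphere_dot (g h : N.-tuple R -> R) : R :=
  \int[sphere_measure]_(w in sphere) (g w * h w).

Definition laplacian (q : mpoly.mpoly N R) : mpoly.mpoly N R :=
  \sum_(i < N) mpoly.mderiv i (mpoly.mderiv i q).

Definition spherical_harmonic (l : nat) (g : N.-tuple R -> R) : Prop :=
  exists2 q : mpoly.mpoly N R,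
    q \is mpoly.ishomog1 l (@mpoly.mdeg N) /\ laplacian q = 0 &
    forall w, sphere w -> g w = mpoly.meval (tnth w) q.

Definition harmonic_onbasis (l d : nat) (Y : 'I_d -> N.-tuple R -> R) : Prop :=
  [/\ forall m, spherical_harmonic l (Y m),
      forall m m', sphere_dot (Y m) (Y m') = (m == m')%:R &
      forall g, spherical_harmonic l g ->
        exists c : 'I_d -> R,
          forall w, sphere w -> g w = \sum_(m < d) c m * Y m w].

End sphere.

Section special_functions.
Context (R : realType).

Definition Gamma (s : R) : R :=
  \int[lebesgue_measure]_(x in `]0, +oo[) (x `^ (s - 1) * expR (- x)).

Definition besselI (a z : R) : R :=
  limn (series (fun k : nat =>
    (z / 2) `^ (2 * k%:R + a) / (k`!%:R * Gamma (k%:R + a + 1)))).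

Definition Ppoly (j : nat) (a s : R) : R :=
  \sum_(q < j.+1)
    (-1) ^+ (j - q) /
      (2 `^ (2 * (a + j%:R + q%:R) + 1) * q`!%:R * (j - q)`!%:R
       * Gamma (q%:R + a + 1))
    * s ^+ q.

End special_functions.

Section hardy.
Context (R : realType) (N : nat) (lam : R).
Local Notation point := (N.-tuple R).
Local Notation leb := (lebesgueN R N).

Definition mu : R := (N%:R - 2) / 2.

Definition nu : R := Num.sqrt (mu ^+ 2 - lam).

Definition nul (l : nat) : R := Num.sqrt ((mu + l%:R) ^+ 2 - lam).

(* N / (mu - nu), read as +oo when mu = nu *)
Definition p_upper : \bar R :=
  if mu == nu then +oo%E else (N%:R / (mu - nu))%:E.

Definition gammap (p : R) : R := N%:R / 2 * (1 - p^-1) - (mu - nu) / 2.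

Definition kl (l : nat) (x y : point) (t : R) : R :=
  (2 * t)^-1 * (enorm x * enorm y) `^ (- mu)
  * expR (- ((enorm x ^+ 2 + enorm y ^+ 2) / (4 * t)))
  * besselI (nul l) (enorm x * enorm y / (2 * t)).

Definition wnorm (l n : nat) (f : R -> R) : \bar R :=
  (\int[leb]_x (enorm x `^ (nul l - mu) * (1 + enorm x ^+ (2 * n + 2))
                * `|f (enorm x)|)%:E)%E.

Definition wL1 (l n : nat) (f : R -> R) : Prop :=
  measurable_fun (`]0, +oo[%classic : set R) f /\ (wnorm l n f < +oo)%E.

Definition moment (l j : nat) (f : R -> R) : R :=
  \int[leb]_x (enorm x `^ (nul l - mu + 2 * j%:R) * f (enorm x)).

Definition profile (l j : nat) (f : R -> R) (x : point) (t : R) : R :=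
  moment l j f * t `^ (- 1 - nul l - j%:R) * enorm x `^ (nul l - mu)
  * expR (- (enorm x ^+ 2 / (4 * t))) * Ppoly j (nul l) (enorm x ^+ 2 / t).

(* c is an admissible value of the constant C_{l,n,p}. *)
Definition radial_remainder_bound (l n : nat) (p c : R) : Prop :=
  forall f : R -> R, wL1 l n f -> forall t : R, 1 <= t ->
    ((t `^ (gammap p + n%:R))%:E *
     'N[leb]_p%:E[EFin \o (fun x : point =>
        \int[leb]_y (kl l x y t * f (enorm y))
        - \sum_(j < n.+1) profile l j f x t)%R]
     <= c%:E * wnorm l n f)%E.

Section nonradial.
Variables (d : nat -> nat) (Y : forall l, 'I_(d l) -> point -> R).

Definition hardy_kernel (x y : point) (t : R) : R :=
  (2 * t)^-1 * (enorm x * enorm y) `^ (- mu)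
  * expR (- ((enorm x ^+ 2 + enorm y ^+ 2) / (4 * t)))
  * limn (series (fun l : nat =>
      besselI (nul l) (enorm x * enorm y / (2 * t))
      * \sum_(m < d l) Y m (dir x) * Y m (dir y))).

Definition mild_solution (u0 : point -> R) (x : point) (t : R) : R :=
  \int[leb]_y (hardy_kernel x y t * u0 y).

(* The integral defining the mild solution converges absolutely. *)
Definition mild_solution_defined (u0 : point -> R) : Prop :=
  forall (x : point) (t : R), 0 < enorm x -> 0 < t ->
    leb.-integrable setT (fun y => (hardy_kernel x y t * u0 y)%:E).

Variable u0lm : forall l, 'I_(d l) -> R -> R.

(* The expansion is meant in L^2(S^(N-1)), for almost every radius r. *)
Definition harmonic_expansion (u0 : point -> R) : Prop :=
  {ae lebesgue_measure, forall r : R, 0 < r ->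
    (fun L : nat => sphere_Lnorm 2 (fun w : point =>
       u0 (scalev r w) - \sum_(l < L) \sum_(m < d l) u0lm m r * Y m w))
    @ \oo --> 0%E}.

Definition A_infty (n : nat) (x : point) (t : R) : R :=
  limn (series (fun l : nat =>
    \sum_(m < d l) \sum_(j < n.+1) profile l j (u0lm m) x t * Y m (dir x))).

End nonradial.

End hardy.

(* Main.v *)
From HB Require Import structures.
Require Import Defs.
From mathcomp Require Import all_boot all_order all_algebra.
From mathcomp Require Import all_classical all_reals all_analysis.
From mathcomp Require Import measurable_realfun.
From mathcomp Require Import ring lra zify.
From mathcomp Require mpoly.
Import (canonicals, coercions) mpoly.
Set Implicit Arguments.
Unset Strict Implicit.
Unset Printing Implicit Defensive.
Import Order.TTheory GRing.Theory Num.Theory.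
Import numFieldNormedType.Exports.
Local Open Scope classical_set_scope.
Local Open Scope ring_scope.

(** The error splits into modes. Off the origin and for [t >= 1],
      [u(x, t) - A(x, t) = sum_l sum_m Y_lm(x / |x|) * rem_lm(|x|, t)],
    where [rem_lm] is the error of the radial expansion, with Bessel index
    [nu_l], for the datum [u0_lm] ([error_series_cvg]). Radius and direction are
    independent under Lebesgue measure, so the [L^p] norm of one term is
    [|Y_lm|_p * |rem_lm|_p] ([Lnorm_radial_angular]); Minkowski's inequality on
    the partial sums and Fatou's lemma then bound the scaled norm of the error by
    [sum_lm |Y_lm|_p * t ^ (gamma + n) * |rem_lm|_p]. By the definition of [C_l],
    the terms are dominated by the summable family of the hypothesis, uniformly
    in [t >= 1]; each of them tends to [0] ([mode_cvg]); Tannery's theorem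
    ([nneseries_cvg0]) concludes.

    One mode decays because its datum can be cut at a large radius [M]. The outer
    part has small weighted norm, and the constant [C_l] controls it for all
    [t >= 1]. For the inner part, with [e = |y|^2 / 4t] and [z = |x|^2 / 4t], the
    kernel is, up to a prefactor, [exp (- z) * exp (- e)] times a power series in
    [e z]. Collecting the powers of [e] produces the profiles, and the remainder is a series of
    Taylor tails of [exp (- e)], hence of order [e ^ (n + 1)] with a Gaussian
    factor left over ([series_remainder_le]). This gains a factor [1 / t] over the
    normalisation, and the condition on [p] makes the [L^p] norm of
    [|x| ^ (nu_l - mu)] finite at the origin ([mode_decay]).

    The pointwise splitting is where the work lies: the hypotheses bound the
    modes only through the constants [C_l], which are merely assumed to be
    admissible, and only in [L^p]. Two estimates turn this into absolute
    convergence at each point ([mode_mass_summable]). First, [C_l] cannot be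
    small: testing the remainder estimate at [t = 1] on the indicator of the
    shell [1 <= |y| <= 2], and looking at radii in [[A, 2 A]], gives
    [C_l >= c * (A / 8) ^ nu_l / Gamma (nu_l + 1)] for every [A >= 1] and all large [l]
    ([radial_constant_ge]). The lower bound holds because for a large Bessel index
    only the first Taylor tail survives, and Taylor tails of [exp (- e)] alternate
    in sign. Second, a homogeneous polynomial of degree [l] satisfies
    [sup |q| <= B ^ (l + 1) * |q|_1] on the sphere, by finite differences along
    lines ([pfun_sup_sphere]); applied to the zonal function of degree [l] it also
    gives a geometric bound for that function ([zonal_bound]).

    Finally [u] is expanded by integrating the kernel first over directions, where
    orthogonality of spherical harmonics selects the modes of [u0]
    ([zonal_reproducing]), then over radii, with dominated convergence in both
    steps ([solution_series_cvg]). Orthogonality between different degrees comes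
    from integration by parts against a Gaussian weight ([gint_orthogonal]),
    transferred to the sphere by polar coordinates. *)

(** * The fundamental theorem of calculus on exhausted sets *)

Section FTC_exhaustion.
Context {R : realType}.
Notation leb1 := (@lebesgue_measure R).

Lemma FTC2_segment (f F : R -> R) (a b : R) : a < b ->
  (forall x, a <= x <= b -> {for x, continuous f}) ->
  (forall x, a <= x <= b -> is_derive x (1 : R) F (f x)) ->
  (\int[leb1]_(x in `[a, b]) (f x)%:E)%E = (F b - F a)%:E.
Proof.
move=> ab cf dF.
rewrite EFinB; apply: continuous_FTC2 => //.
- apply: continuous_in_subspaceT => x xab.
  by apply: cf; move: xab => /set_mem /=; rewrite in_itv.
- have cF x : a <= x <= b -> {for x, continuous F}.
    move=> /dF dFx; apply: differentiable_continuous.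
    exact/derivable1_diffP/ex_derive.
  split.
  + move=> x; rewrite in_itv/= => /andP[ax xb].
    by apply: ex_derive; apply: dF; rewrite !ltW.
  + by apply: cvg_at_right_filter; apply: cF; rewrite lexx ltW.
  + by apply: cvg_at_left_filter; apply: cF; rewrite lexx ltW.
- move=> x; rewrite in_itv/= => /andP[ax xb].
  have := dF x; rewrite !ltW// => /(_ isT) dFx.
  by rewrite derive1E derive_val.
Qed.

(** The second fundamental theorem on an arbitrary measurable set exhausted by
    segments: integrability on [D] replaces any sign condition, through
    dominated convergence of the integrals over the segments. *)
Lemma FTC2_exhaust (D : set R) (f F : R -> R) (a b : nat -> R) (la lb : R) :
  measurable D -> leb1.-integrable D (EFin \o f) ->
  (forall k, a k < b k) -> (forall k, `[a k, b k]%classic `<=` D) ->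
  (forall x, D x -> \forall k \near \oo, a k <= x <= b k) ->
  (forall x, D x -> {for x, continuous f}) ->
  (forall x, D x -> is_derive x (1 : R) F (f x)) ->
  F (a k) @[k --> \oo] --> la -> F (b k) @[k --> \oo] --> lb ->
  (\int[leb1]_(x in D) (f x)%:E)%E = (lb - la)%:E.
Proof.
move=> mD fint ab sD nearD cf dF Fa Fb.
have mf : measurable_fun D (EFin \o f) by apply: measurable_int fint.
pose f_ (k : nat) : R -> \bar R := (EFin \o f) \_ `[a k, b k].
have mf_ k : measurable_fun D (f_ k).
  apply: measurable_funTS; apply/(measurable_restrictT _ _).1 => //.
  exact: measurable_funS mf.
have f_f x : D x -> f_ ^~ x @ \oo --> (EFin \o f) x.
  move=> Dx; apply: cvg_near_cst; apply: filterS (nearD _ Dx) => k akb.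
  by rewrite /f_ patchE mem_set//= in_itv.
have f_g k x : D x -> (`|f_ k x| <= (abse \o (EFin \o f)) x)%E.
  by move=> Dx; rewrite /f_ patchE; case: ifPn => // _; rewrite abse0 abse_ge0.
have [|||_ _ cvgI] := @dominated_convergence _ _ R leb1 D mD f_ (EFin \o f)
    (abse \o (EFin \o f)) mf_ mf.
- exact: aeW.
- exact: integrable_abse.
- by apply: aeW => x k; exact: f_g.
have E k : (\int[leb1]_(x in D) f_ k x)%E = (F (b k) - F (a k))%:E.
  rewrite /f_ -integral_mkcondr.
  rewrite (setIidr (@sD k)); apply: FTC2_segment => // x xab.
    by apply: cf; apply: (sD k); rewrite /= in_itv.
  by apply: dF; apply: (sD k); rewrite /= in_itv.
have : (F (b k) - F (a k))%:E @[k --> \oo] --> (lb - la)%:E.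
  by apply: cvg_EFin; [exact: nearW|exact: cvgB].
under eq_fun do rewrite -E.
by move=> /(cvg_unique _ cvgI); exact.
Qed.

End FTC_exhaustion.

(** * The Gamma function *)

Section Gamma_theory.
Context {R : realType}.
Notation leb1 := (@lebesgue_measure R).

Lemma exprn_le_fact_expR (x : R) (n : nat) : 0 <= x -> x ^+ n <= n`!%:R * expR x.
Proof.
move=> x0; case: n => [|n]; first by rewrite expr0 fact0 mul1r -expR0 ler_expR.
have n0 : 0 < (n.+1)`!%:R :> R by rewrite ltr0n fact_gt0.
have := expR_ge1Dxn n x0; rewrite -(ler_pM2l n0) mulrDr mulr1 => h.
have e : n.+1`!%:R * (x ^+ n.+1 / n.+1`!%:R) = x ^+ n.+1 by field; rewrite gt_eqF.
by rewrite e in h; lra.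
Qed.

(** For negative [s] the power is unbounded near [0], hence the alternative
    [x < 1]. *)
Lemma powR_le_expR (s c : R) : 0 < c ->
  exists2 K : R, 0 < K & forall x, 0 <= x -> x `^ s <= K * expR (c * x) \/ x < 1.
Proof.
move=> c0; pose m := Num.truncn `|s|; pose n := m.+1.
have sn : s <= n%:R.
  by rewrite (le_trans (ler_norm _))// ltW// truncnS_gt.
exists (n`!%:R / c ^+ n) => [|x x0].
  by rewrite divr_gt0 ?exprn_gt0// ltr0n fact_gt0.
case: (ltP x 1) => x1; [by right|left].
rewrite (le_trans (ler_powR x1 sn))// powR_mulrn// mulrAC ler_pdivlMr ?exprn_gt0//.
by rewrite -exprMn mulrC exprn_le_fact_expR// mulr_ge0// ltW.
Qed.

Lemma integrable_expRN (c : R) : 0 < c ->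
  leb1.-integrable `]0, +oo[%classic (EFin \o (fun x : R => expR (- (c * x)))).
Proof.
move=> c0; apply: (@integrableS _ _ R leb1 [set` `[0, +oo[]) => //.
  by move=> x /=; rewrite !in_itv/= !andbT => /ltW.
have cf : continuous (fun x : R => expR (- (c * x))).
  move=> x; apply: continuous_comp; last exact: continuous_expR.
  by apply: cvgN; apply: cvgM; [exact: cvg_cst|exact: cvg_id].
apply/integrableP; split.
  apply/measurable_EFinP; apply: measurable_funTS.
  exact: continuous_measurable_fun.
under eq_integral do rewrite gee0_abs ?lee_fin ?expR_ge0//.
pose F := fun x : R => - c^-1 * expR (- (c * x)).
have dF (x : R) : is_derive x (1:R) F (expR (- (c * x))).
  apply: is_derive_eq; rewrite /GRing.scale/= mulr1.
  by field; rewrite gt_eqF.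
rewrite (@ge0_continuous_FTC2y _ _ F 0 0) ?ltry//.
- exact: continuous_subspaceT.
- rewrite /F -[X in _ --> X](mulr0 (- c^-1)).
  apply: cvgM; first exact: cvg_cst.
  apply: (@cvg_comp _ _ _ (fun x : R => c * x) (fun y => expR (- y)) _ +oo%R).
    by apply: gt0_cvgMry => //.
  exact: cvgr_expR.
- apply: cvg_at_right_filter; apply: differentiable_continuous.
  exact/derivable1_diffP/ex_derive.
- by move=> x _; rewrite derive1E derive_val.
Qed.

Lemma measurable_Gamma_fun (s : R) :
  measurable_fun setT (fun x : R => x `^ s * expR (- x)).
Proof.
apply: measurable_funM; first exact: measurable_powR.
by apply: measurableT_comp => //; exact: measurable_expR.
Qed.

Lemma integrable_Gamma (s : R) : 1 <= s ->
  leb1.-integrable `]0, +oo[%classic (EFin \o (fun x => x `^ (s - 1) * expR (- x))).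
Proof.
move=> s1; have h0 : 0 < 2^-1 :> R by rewrite invr_gt0.
(* Half of the exponential decay absorbs the power. *)
have [K K0 HK] := @powR_le_expR (s - 1) _ h0.
have iexp := integrable_expRN h0.
have mD : measurable ([set` `]0, +oo[] : set R) by exact: measurable_itv.
have iK := @integrableZl _ _ R leb1 _ mD (K + 1) _ iexp.
apply: le_integrable iK => //.
- by apply/measurable_EFinP/measurable_funTS; exact: measurable_Gamma_fun.
- move=> x; rewrite /= in_itv/= andbT => x0.
  rewrite lee_fin ger0_norm ?mulr_ge0 ?powR_ge0 ?expR_ge0//.
  rewrite ger0_norm ?mulr_ge0 ?expR_ge0 ?addr_ge0// ?(ltW K0)//.
  have -> : expR (- x) = expR (- (2^-1 * x)) * expR (- (2^-1 * x)).
    by rewrite -expRD; congr expR; field.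
  rewrite mulrA ler_wpM2r ?expR_ge0//.
  rewrite expRN ler_pdivrMr ?expR_gt0//.
  have e1 : 1 <= expR (2^-1 * x).
    by rewrite -expR0 ler_expR mulr_ge0 ?invr_ge0 ?(ltW x0).
  have := HK x (ltW x0) => -[h|xlt].
    by rewrite (le_trans h)// ler_wpM2r ?expR_ge0// lerDl.
  apply: (@le_trans _ _ 1); last first.
    by rewrite -[leLHS]mulr1 ler_pM// lerDr ltW.
  rewrite [leRHS](_ : _ = 1 `^ (s - 1)); last by rewrite powR1.
  rewrite ge0_ler_powR// ?nnegrE ?(ltW xlt) ?(ltW x0)//.
  by rewrite subr_ge0.
Qed.

(** The mass of the Gamma integral on [[B, B + 1]]. As [B] is arbitrary, [Gamma]
    grows faster than any exponential. *)
Lemma Gamma_ge (B s : R) : 0 < B -> 1 <= s ->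
  B `^ (s - 1) * expR (- (B + 1)) <= Gamma s.
Proof.
move=> B0 s1; have iG := integrable_Gamma s1.
rewrite -lee_fin /Gamma /Rintegral fineK; last exact: integrable_fin_num.
have sub : ([set` `[B, B + 1]] : set R) `<=` [set` `]0, +oo[].
  by move=> x /=; rewrite !in_itv/= andbT => /andP[Bx _]; exact: lt_le_trans Bx.
apply: (@le_trans _ _ (\int[leb1]_(x in `[B, (B + 1)%R])
    (x `^ (s - 1) * expR (- x))%:E)%E); last apply: ge0_subset_integral => //.
- rewrite [leLHS](_ : _ =
    (\int[leb1]_(x in `[B, (B + 1)%R]) (cst (B `^ (s - 1) * expR (- (B + 1)))%:E x))%E); last first.
    rewrite integral_cst//= lebesgue_measure_itv/= lte_fin ltrDl ltr01.
    by rewrite -EFinD -EFinM addrAC subrr add0r mulr1.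
  apply: ge0_le_integral => //=.
  + by move=> x _; rewrite lee_fin mulr_ge0 ?powR_ge0 ?expR_ge0.
  + apply/measurable_EFinP; apply: measurable_funTS; exact: measurable_Gamma_fun.
  + move=> x; rewrite in_itv/= => /andP[Bx xB].
    rewrite lee_fin ler_pM ?powR_ge0 ?expR_ge0//; last by rewrite ler_expR lerN2.
    by rewrite ge0_ler_powR// ?nnegrE ?subr_ge0// ?(ltW B0)// (le_trans (ltW B0)).
- exact: measurable_int iG.
- by move=> x _; rewrite lee_fin mulr_ge0 ?powR_ge0 ?expR_ge0.
Qed.

Lemma Gamma_gt0 (s : R) : 1 <= s -> 0 < Gamma s.
Proof.
move=> s1; apply: lt_le_trans (@Gamma_ge 1 s ltr01 s1).
by rewrite mulr_gt0 ?powR_gt0 ?expR_gt0.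
Qed.

Lemma GammaS (s : R) : 1 <= s -> Gamma (s + 1) = s * Gamma s.
Proof.
move=> s1.
have s10 : 1 <= s + 1 by rewrite (le_trans s1)// lerDl.
have i1 := integrable_Gamma s1.
have i2 := integrable_Gamma s10.
pose F := fun x : R => x `^ s * expR (- x).
pose f := fun x : R => s * (x `^ (s - 1) * expR (- x)) - (x `^ (s + 1 - 1) * expR (- x)).
have fint : leb1.-integrable `]0, +oo[%classic (EFin \o f).
  rewrite (_ : EFin \o f = (fun x => s%:E * (EFin \o (fun x => (x `^ (s - 1) * expR (- x))%R)) x) \-
    (EFin \o (fun x : R => (x `^ (s + 1 - 1) * expR (- x))%R)))%E; last by apply/funext.
  by apply: integrableB => //; exact: integrableZl.
have pow_cont (x a : R) : 0 < x -> {for x, continuous (@powR R ^~ a)}.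
  move=> x0; apply: differentiable_continuous; apply/derivable1_diffP.
  by apply: derivable_powR; rewrite in_itv/= andbT.
have expN_cont : continuous (fun x : R => expR (- x)).
  move=> x; apply: continuous_comp; last exact: continuous_expR.
  exact: opp_continuous.
have := @FTC2_exhaust R `]0, +oo[%classic f F (fun k => k.+2%:R^-1)
  (fun k => k.+2%:R) 0 0.
rewrite subrr => FTC.
have : (\int[leb1]_(x in `]0%R, +oo[) (f x)%:E = 0)%E.
  apply: FTC => //.
  - move=> k; apply: (@lt_trans _ _ 1); last by rewrite ltr1n.
    by rewrite invf_lt1// ltr1n.
  - move=> k x /=; rewrite !in_itv/= andbT => /andP[+ _].
    by apply: lt_le_trans; rewrite invr_gt0.
  - move=> x; rewrite /= in_itv/= andbT => x0; near=> k.
    apply/andP; split.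
    + rewrite -(invrK x) lef_pV2 ?posrE ?invr_gt0//.
      rewrite (le_trans (ltW (truncnS_gt _)))// ler_nat.
      by rewrite ltnS; apply: leqW; near: k; exact: nbhs_infty_ge.
    + rewrite (le_trans (ltW (truncnS_gt _)))// ler_nat.
      by rewrite ltnS; apply: leqW; near: k; exact: nbhs_infty_ge.
  - move=> x; rewrite /= in_itv/= andbT => x0.
    apply: cvgB; first apply: cvgM; first exact: cvg_cst.
      by apply: cvgM; [exact: pow_cont|exact: expN_cont].
    by apply: cvgM; [exact: pow_cont|exact: expN_cont].
  - move=> x; rewrite /= in_itv/= andbT => x0.
    have := is_derive1_powR s x0 => dp.
    apply: is_derive_eq; rewrite /f /GRing.scale/= addrK; ring.
  - apply: (@squeeze_cvgr _ _ _ _ (fun=> 0) (fun k : nat => k.+2%:R^-1)).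
    + near=> k; rewrite mulr_ge0 ?powR_ge0 ?expR_ge0//=.
      rewrite -[leRHS]mulr1 ler_pM ?powR_ge0 ?expR_ge0//.
      rewrite ge1r_powR// invr_gt0 ltr0n/= invf_le1// ler1n//.
    + exact: cvg_cst.
    + by move: (@cvg_harmonic R); rewrite -cvg_shiftS.
  - have h0 : 0 < 2^-1 :> R by rewrite invr_gt0.
    have [K K0 HK] := @powR_le_expR s _ h0.
    apply: (@squeeze_cvgr _ _ _ _ (fun=> 0) (fun k : nat => K * (expR (- (2^-1 * k.+2%:R))))).
    + near=> k; rewrite /F mulr_ge0 ?powR_ge0 ?expR_ge0//=.
      have -> : expR (- k.+2%:R) = expR (- (2^-1 * k.+2%:R)) * expR (- (2^-1 * k.+2%:R)) :> R.
        by rewrite -expRD; congr expR; field.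
      rewrite mulrA ler_wpM2r ?expR_ge0// expRN ler_pdivrMr ?expR_gt0//.
      have [//|] := HK k.+2%:R (ler0n _ _).
      by rewrite ltrn1.
    + exact: cvg_cst.
    + rewrite -[X in _ --> X](mulr0 K); apply: cvgM; first exact: cvg_cst.
      apply: (@cvg_comp _ _ _ (fun k : nat => 2^-1 * k.+2%:R) (fun y => expR (- y)) _ +oo%R).
        apply/cvgryPge => A; near=> k.
        rewrite ler_pdivlMl// (le_trans (ltW (truncnS_gt _)))// ler_nat ltnS.
        by apply: leqW; near: k; exact: nbhs_infty_ge.
      exact: cvgr_expR.
rewrite /f; under eq_integral do rewrite EFinB EFinM.
rewrite integralB//; last exact: integrableZl.
rewrite integralZl// => /eqP; rewrite sube_eq ?add0e; last 2 first.
- by rewrite fin_numM// integrable_fin_num.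
- by rewrite fin_num_adde_defl// integrable_fin_num.
move=> /eqP e; rewrite /Gamma /Rintegral -e fineM// integrable_fin_num//.
Unshelve. all: by end_near. Qed.

End Gamma_theory.

(** * Taylor tails of the exponential and Bessel series *)

Section exponential_tail.
Context {R : realType}.
Implicit Types e x z : R.

Definition exp_tail (m : nat) (e : R) : R :=
  expR (- e) - \sum_(i < m) (- e) ^+ i / i`!%:R.

Lemma exp_tailS m e : exp_tail m.+1 e = exp_tail m e - (- e) ^+ m / m`!%:R.
Proof. by rewrite /exp_tail big_ord_recr /= opprD addrA. Qed.

Lemma is_derive_exp_tail m e : is_derive e (1 : R) (exp_tail m.+1) (- exp_tail m e).
Proof.
have dt i : is_derive e (1:R) (fun x : R => (- x) ^+ i.+1 / i.+1`!%:R) (- ((- e) ^+ i / i`!%:R)).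
  have d1 : is_derive e (1:R) (fun x : R => (- x) ^+ i.+1) (- (i.+1%:R * (- e) ^+ i)).
    have -> : (fun x : R => (- x) ^+ i.+1) = (fun x : R => - x) ^+ i.+1.
      by apply/funext => x; rewrite exprfctE.
    by apply: is_derive_eq; rewrite /GRing.scale/= mulrN mulr1.
  have -> : (fun x : R => (- x) ^+ i.+1 / i.+1`!%:R) =
      i.+1`!%:R^-1 \*: (fun x : R => (- x) ^+ i.+1).
    by apply/funext => x; rewrite mulrC.
  apply: is_derive_eq; rewrite /GRing.scale/= factS natrM.
  have h1 : i`!%:R != 0 :> R by rewrite pnatr_eq0 -lt0n fact_gt0.
  have h2 : i.+1%:R != 0 :> R by rewrite pnatr_eq0.
  move: (i.+1%:R : R) h2 (i`!%:R : R) h1 => b hb c hc.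
  by field; rewrite hb hc.
have ds : is_derive e (1:R) (fun x : R => \sum_(i < m) (- x) ^+ i.+1 / i.+1`!%:R)
    (\sum_(i < m) - ((- e) ^+ i / i`!%:R)).
  elim: m => [|m IH].
    under eq_fun do rewrite big_ord0.
    by rewrite big_ord0; exact: is_derive_cst.
  under eq_fun do rewrite big_ord_recr /=.
  by rewrite big_ord_recr /=; apply: is_deriveD.
have -> : exp_tail m.+1 = (fun x => expR (- x) - (1 + \sum_(i < m) (- x) ^+ i.+1 / i.+1`!%:R)).
  by apply/funext => x; rewrite /exp_tail big_ord_recl /= expr0 fact0 divr1.
apply: is_derive_eq.
by rewrite /exp_tail sumrN; ring.
Qed.

(** Up to sign, the derivative of a tail is the previous tail, and every tail but
    the zeroth vanishes at [0]. *)
Lemma exp_tail_ge0 m e : 0 <= e -> 0 <= (-1) ^+ m * exp_tail m e.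
Proof.
elim: m e => [|m IH] e e0.
  by rewrite expr0 mul1r /exp_tail big_ord0 subr0 expR_ge0.
have -> : 0 = (-1) ^+ m.+1 * exp_tail m.+1 0 :> R.
  rewrite /exp_tail oppr0 expR0 big_ord_recl /= expr0 fact0 divr1 big1.
    by rewrite addr0 subrr mulr0.
  by move=> i _; rewrite /= expr0n /= mul0r.
have dF x : is_derive x (1:R) (fun y => (-1) ^+ m.+1 * exp_tail m.+1 y) ((-1) ^+ m * exp_tail m x).
  have := is_derive_exp_tail m x => dE.
  apply: is_derive_eq; rewrite /GRing.scale/= exprS; ring.
have := @ger0_derive1_ndecr R (fun y => (-1) ^+ m.+1 * exp_tail m.+1 y) 0 e.
apply => //.
- move=> x; rewrite in_itv/= => /andP[x0 _].
  by rewrite derive1E derive_val IH// ltW.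
- apply: continuous_subspaceT => x; apply: differentiable_continuous.
  exact/derivable1_diffP/ex_derive.
Qed.

Lemma exp_tail_sgnS m e : (-1) ^+ m * exp_tail m e = e ^+ m / m`!%:R - (-1) ^+ m.+1 * exp_tail m.+1 e.
Proof.
rewrite exp_tailS [(- e) ^+ m]exprNn exprS.
have : (-1) ^+ m * (-1) ^+ m = 1 :> R by rewrite -exprD addnn -mul2n exprM sqrrN !expr1n.
set s := (-1) ^+ m; move=> ss.
have -> : e ^+ m / m`!%:R = (s * s) * (e ^+ m / m`!%:R) by rewrite ss mul1r.
ring.
Qed.

(** The tails alternate in sign, so each is bounded by the first term it contains. *)
Lemma exp_tail_le m e : 0 <= e -> `|exp_tail m e| <= e ^+ m / m`!%:R.
Proof.
move=> e0.
have -> : `|exp_tail m e| = (-1) ^+ m * exp_tail m e.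
  by rewrite -[RHS]ger0_norm ?exp_tail_ge0// normrM normrX normrN1 expr1n mul1r.
by rewrite exp_tail_sgnS lerBlDr lerDl exp_tail_ge0.
Qed.

Lemma exp_tail_lb m e : 0 <= e <= 1 ->
  2^-1 * (e ^+ m.+1 / m.+1`!%:R) <= (-1) ^+ m.+1 * exp_tail m.+1 e.
Proof.
move=> /andP[e0 e1]; rewrite exp_tail_sgnS.
(* The next tail is at most half of the leading term, as [e <= 1] and [2 <= m.+2]. *)
have h : (-1) ^+ m.+2 * exp_tail m.+2 e <= 2^-1 * (e ^+ m.+1 / m.+1`!%:R).
  have := exp_tail_le m.+2 e0; move=> /(le_trans (ler_norm _)).
  move=> h2; apply: (@le_trans _ _ (e ^+ m.+2 / m.+2`!%:R)).
    apply: le_trans (exp_tail_le m.+2 e0).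
    by rewrite (le_trans (ler_norm _))// normrM normrX normrN1 expr1n mul1r.
  have f0 : 0 < m.+1`!%:R :> R by rewrite ltr0n fact_gt0.
  have -> : e ^+ m.+2 / m.+2`!%:R = e / m.+2%:R * (e ^+ m.+1 / m.+1`!%:R).
    rewrite [in LHS]exprS factS natrM; field.
    by rewrite (gt_eqF f0) -natrD pnatr_eq0.
  rewrite ler_wpM2r ?divr_ge0 ?exprn_ge0 ?(ltW f0)//.
  rewrite ler_pdivrMr// (le_trans e1)// ler_pdivlMl// mulr1 ler_nat//.
by set u := (-1) ^+ m.+2 * _ in h *; lra.
Qed.

End exponential_tail.

Section bessel_series.
Context {R : realType}.
Implicit Types a e x z : R.

(** The coefficients of the Bessel series, relative to the leading one. *)
Definition Gamma_ratio (a : R) (k : nat) : R := Gamma (a + 1) / Gamma (k%:R + a + 1).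

Lemma Gamma_ratio0 a : 0 <= a -> Gamma_ratio a 0 = 1.
Proof.
move=> a0; rewrite /Gamma_ratio add0r divff// gt_eqF// Gamma_gt0//; lra.
Qed.

Lemma Gamma_ratioS a k : 0 <= a -> Gamma_ratio a k.+1 = Gamma_ratio a k / (k.+1%:R + a).
Proof.
move=> a0; rewrite /Gamma_ratio -natr1 (_ : k%:R + 1 + a + 1 = k%:R + a + 1 + 1); last by ring.
rewrite [Gamma (_ + 1 + 1)]GammaS; last first.
  by rewrite -addrA -[leLHS]add0r lerD// -[leLHS]add0r lerD2r.
have h1 : 0 < Gamma (k%:R + a + 1).
  by rewrite Gamma_gt0// -addrA -[leLHS]add0r lerD// -[leLHS]add0r lerD2r.
have h2 : 0 < k%:R + a + 1.
  by rewrite ltr_wpDl// addr_ge0.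
have e1 : k%:R + 1 + a = k%:R + a + 1 by ring.
by rewrite e1; field; rewrite !gt_eqF.
Qed.

Lemma Gamma_ratio_gt0 a k : 0 <= a -> 0 < Gamma_ratio a k.
Proof.
move=> a0; elim: k => [|k IH]; first by rewrite Gamma_ratio0.
by rewrite Gamma_ratioS// divr_gt0// ltr_wpDr.
Qed.

Lemma Gamma_ratio_le_fact a k : 0 <= a -> Gamma_ratio a k <= k`!%:R^-1.
Proof.
move=> a0; elim: k => [|k IH]; first by rewrite Gamma_ratio0// fact0 invr1.
rewrite Gamma_ratioS// factS natrM invfM mulrC ler_pM ?invr_ge0 ?addr_ge0//.
  exact/ltW/Gamma_ratio_gt0.
by rewrite lef_pV2 ?posrE// ?lerDl// ltr_wpDr.
Qed.

Lemma Gamma_ratio_le1 a k : 0 <= a -> Gamma_ratio a k <= 1.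
Proof.
move=> a0; rewrite (le_trans (Gamma_ratio_le_fact k a0))// invf_le1 ?ltr0n ?fact_gt0//.
by rewrite ler1n fact_gt0.
Qed.

Lemma Gamma_ratioS_le a k : 0 <= a -> Gamma_ratio a k.+1 <= (a + 1)^-1.
Proof.
move=> a0; rewrite Gamma_ratioS// -[leRHS]mul1r ler_pM ?Gamma_ratio_le1 ?invr_ge0 ?addr_ge0//.
  exact/ltW/Gamma_ratio_gt0.
have h1 : 0 < a + 1 by rewrite ltr_wpDl.
have h2 : 0 < k.+1%:R + a by rewrite ltr_wpDr.
by rewrite lef_pV2 ?posrE// [leRHS]addrC lerD2l ler1n.
Qed.

Definition bessel_term (a x : R) (k : nat) : R := x ^+ k * Gamma_ratio a k / k`!%:R.
(** With this series, [besselI a z = (z / 2) ^ a / Gamma (a + 1) * bessel_sum a (z^2 / 4)]. *)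
Definition bessel_sum (a x : R) : R := limn (series (bessel_term a x)).

Lemma bessel_term_ge0 a x k : 0 <= a -> 0 <= x -> 0 <= bessel_term a x k.
Proof.
by move=> a0 x0; rewrite divr_ge0// mulr_ge0 ?exprn_ge0// ltW// Gamma_ratio_gt0.
Qed.

Lemma bessel_term_le_exp a x k : 0 <= a -> 0 <= x -> bessel_term a x k <= exp_coeff x k.
Proof.
move=> a0 x0; rewrite /bessel_term /exp_coeff /= ler_wpM2r ?invr_ge0// -[leRHS]mulr1.
by rewrite ler_wpM2l ?exprn_ge0// Gamma_ratio_le1.
Qed.

Lemma is_cvg_bessel_sum a x : 0 <= a -> 0 <= x -> cvgn (series (bessel_term a x)).
Proof.
move=> a0 x0; apply: (@series_le_cvg _ _ (exp_coeff x)).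
- by move=> k; exact: bessel_term_ge0.
- by move=> k; rewrite exp_coeff_ge0.
- by move=> k; exact: bessel_term_le_exp.
- exact: is_cvg_series_exp_coeff.
Qed.

Lemma exp_partial_le x k : 0 <= x -> series (exp_coeff x) k <= expR x.
Proof.
move=> x0; apply: nondecreasing_cvgn_le; last exact: is_cvg_series_exp_coeff.
by apply: nondecreasing_series => n _ _; rewrite exp_coeff_ge0.
Qed.

Lemma bessel_sum_ge0 a x : 0 <= a -> 0 <= x -> 0 <= bessel_sum a x.
Proof.
move=> a0 x0; apply: limr_ge; first exact: is_cvg_bessel_sum.
by apply: nearW => k; apply: sumr_ge0 => i _; exact: bessel_term_ge0.
Qed.

(** Since [Gamma_ratio a k <= 1 / k!], the terms are dominated by the even terms of
    the exponential series of [2 w], because [binomial (2 k) k <= 4 ^ k]. *)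
Lemma bessel_sum_sqr_le (a w : R) : 0 <= a -> 0 <= w -> bessel_sum a (w ^+ 2) <= expR (2 * w).
Proof.
move=> a0 w0; have w2 : 0 <= w ^+ 2 by rewrite exprn_ge0.
apply: limr_le; first exact: is_cvg_bessel_sum.
apply: nearW => K; apply: le_trans (exp_partial_le K.*2 (mulr_ge0 (ler0n _ 2) w0)).
rewrite /series /=; elim: K => [|K IH].
  by rewrite big_nil double0 big_nil.
rewrite doubleS big_nat_recr//= [leRHS]big_nat_recr//= [X in _ <= X + _]big_nat_recr//=.
rewrite -addrA lerD//.
apply: (@le_trans _ _ (exp_coeff (2 * w) K.*2)); last first.
  by rewrite lerDl exp_coeff_ge0 ?mulr_ge0.
have f0 : 0 < K`!%:R :> R by rewrite ltr0n fact_gt0.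
have f2 : 0 < (2 * K)`!%:R :> R by rewrite ltr0n fact_gt0.
rewrite /exp_coeff /bessel_term /= -mul2n.
apply: (@le_trans _ _ ((w ^+ 2) ^+ K / (K`!%:R * K`!%:R))).
  have -> : (w ^+ 2) ^+ K / (K`!%:R * K`!%:R) = (w ^+ 2) ^+ K / K`!%:R / K`!%:R.
    by rewrite invfM mulrA.
  apply: ler_wpM2r; first by rewrite invr_ge0.
  by rewrite ler_wpM2l ?Gamma_ratio_le_fact// exprn_ge0.
have -> : (2 * w) ^+ (2 * K) = 4 ^+ K * (w ^+ 2) ^+ K.
  by rewrite exprM -exprMn; congr (_ ^+ K); ring.
rewrite ler_pdivlMr// mulrAC ler_pdivrMr ?mulr_gt0//.
rewrite [leRHS]mulrC mulrA [leRHS]mulrC ler_wpM2l ?exprn_ge0//.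
rewrite -natrX -!natrM ler_nat.
have := bin_fact (leq_addr K K); rewrite addnK addnn -mul2n => <-.
rewrite [leqRHS]mulnC leq_mul2r; apply/orP; right.
rewrite (_ : 4 = (1 + 1) ^ 2)%N// -expnM expnDn.
have hK : (K < (2 * K).+1)%N by lia.
by rewrite (bigD1 (Ordinal hK))//= !exp1n !muln1 leq_addr.
Qed.

End bessel_series.

(** * The remainder of the radial kernel *)

Section kernel_remainder.
Context {R : realType}.
Implicit Types a e z r rho t : R.

Lemma triangle_sum_exchange (V : nmodType) (F : nat -> nat -> V) (N : nat) :
  \sum_(q < N) \sum_(i < N - q) F q i = \sum_(j < N) \sum_(q < j.+1) F q (j - q)%N.
Proof.
elim: N => [|N IH]; first by rewrite !big_ord0.
rewrite [RHS]big_ord_recr /= -IH.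
rewrite (eq_bigr (fun q : 'I_N.+1 => \sum_(i < N - q) F q i + F q (N - q)%N)).
  rewrite big_split /= big_ord_recr /= subnn big_ord0 addr0//.
by move=> q _; rewrite subSn ?big_ord_recr// -ltnS.
Qed.

(** [Ppoly j a], in the variable [z = |x|^2 / 4t] and stripped of the powers of [2]
    and of [Gamma (a + 1)]. *)
Definition profile_poly (a : R) (j : nat) (z : R) : R :=
  \sum_(q < j.+1) (-1) ^+ (j - q) * z ^+ q * Gamma_ratio a q / ((j - q)`!%:R * q`!%:R).

(** The remainder of the kernel without its prefactor and Gaussian factor, where
    [e = |y|^2 / 4t] and [z = |x|^2 / 4t]. *)
Definition series_remainder (a : R) (n : nat) (e z : R) : R :=
  expR (- e) * bessel_sum a (e * z) - \sum_(j < n.+1) e ^+ j * profile_poly a j z.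

(** Terms of the product of [exp (- e)] and the Bessel series are collected by their
    degree in [e]: those of degree at most [n] form the profiles, and the [q]-th term
    of the Bessel series keeps the Taylor tail of [exp (- e)] of order [n + 1 - q]. *)
Lemma series_remainder_partial a n e z K : (n.+1 <= K)%N ->
  series (fun q => bessel_term a (e * z) q * exp_tail (n.+1 - q) e) K =
  expR (- e) * series (bessel_term a (e * z)) K - \sum_(j < n.+1) e ^+ j * profile_poly a j z.
Proof.
move=> nK; pose F q i := bessel_term a (e * z) q * ((- e) ^+ i / i`!%:R).
have E1 : \sum_(j < n.+1) e ^+ j * profile_poly a j z = \sum_(q < n.+1) \sum_(i < n.+1 - q) F q i.
  rewrite triangle_sum_exchange; apply: eq_bigr => j _.
  rewrite /profile_poly mulr_sumr; apply: eq_bigr => q _.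
  have qj : (q <= j)%N by rewrite -ltnS.
  rewrite /F /bessel_term exprMn [(- e) ^+ _]exprNn -[X in e ^+ X](subnKC qj) exprD invfM.
  ring.
rewrite E1 /series /= mulr_sumr.
rewrite (big_cat_nat (n := n.+1))//= [X in _ = X - _](big_cat_nat (n := n.+1))//=.
rewrite addrAC; congr (_ + _).
  rewrite !big_mkord -sumrB; apply: eq_bigr => q _.
  by rewrite /exp_tail mulrBr mulr_sumr [expR _ * _]mulrC.
rewrite big_nat_cond [RHS]big_nat_cond; apply: eq_bigr => q /andP[/andP[nq _] _].
by rewrite (eqP (_ : n.+1 - q == 0)%N)// /exp_tail big_ord0 subr0 mulrC.
Qed.

Lemma series_remainder_cvg a n e z : 0 <= a -> 0 <= e -> 0 <= z ->
  series (fun q => bessel_term a (e * z) q * exp_tail (n.+1 - q) e) @ \oo --> series_remainder a n e z.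
Proof.
move=> a0 e0 z0.
have : (fun K => expR (- e) * series (bessel_term a (e * z)) K -
    \sum_(j < n.+1) e ^+ j * profile_poly a j z) @ \oo --> series_remainder a n e z.
  apply: cvgB; last exact: cvg_cst.
  by apply: cvgM; [exact: cvg_cst|apply: is_cvg_bessel_sum => //; rewrite mulr_ge0].
apply: cvg_trans; apply: near_eq_cvg.
near=> K; rewrite series_remainder_partial//.
by near: K; exact: nbhs_infty_ge.
Unshelve. all: by end_near. Qed.

Lemma norm_series_le (u v : nat -> R) (l b : R) :
  (forall q, `|u q| <= v q) -> (forall K, series v K <= b) ->
  series u @ \oo --> l -> `|l| <= b.
Proof.
move=> uv vb ul.
have /cvg_norm nl := ul.
rewrite -(cvg_lim (@Rhausdorff R) nl); apply: limr_le.
  by apply/cvg_ex; exists `|l|.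
apply: nearW => K; apply: le_trans (vb K).
rewrite (le_trans (ler_norm_sum _ _ _))// ler_sum// => i _; exact: uv.
Qed.

Lemma term_norm_le a n e z q : 0 <= a -> 0 <= e -> 0 <= z ->
  `|bessel_term a (e * z) q * exp_tail (n.+1 - q) e| <=
  Gamma_ratio a q * (e ^+ q * e ^+ (n.+1 - q)) * exp_coeff z q.
Proof.
move=> a0 e0 z0.
have ez0 : 0 <= e * z by rewrite mulr_ge0.
rewrite normrM ger0_norm ?bessel_term_ge0//.
apply: (@le_trans _ _ (bessel_term a (e * z) q * e ^+ (n.+1 - q))).
  rewrite ler_wpM2l ?bessel_term_ge0// (le_trans (exp_tail_le _ e0))//.
  rewrite ler_pdivrMr ?ltr0n ?fact_gt0// -[leLHS]mulr1 ler_wpM2l ?exprn_ge0//.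
  by rewrite ler1n fact_gt0.
rewrite /bessel_term /exp_coeff /= exprMn le_eqVlt; apply/orP; left; apply/eqP; ring.
Qed.

(** The inequality [2 e <= 1] pays for a factor [2 ^ q] in the [q]-th term, which
    turns [exp z] into [exp (z / 2)] and so leaves half of the Gaussian decay
    [exp (- z)] of the kernel. *)
Lemma series_remainder_le a n e z : 0 <= a -> 0 <= e <= 2^-1 -> 0 <= z ->
  `|series_remainder a n e z| <= (2 * e) ^+ n.+1 * expR (2^-1 * z).
Proof.
move=> a0 /andP[e0 e1] z0.
have z2 : 0 <= 2^-1 * z by rewrite mulr_ge0 ?invr_ge0.
apply: (@norm_series_le _ (fun q => (2 * e) ^+ n.+1 * exp_coeff (2^-1 * z) q)
  _ _ _ _ (@series_remainder_cvg a n e z a0 e0 z0)) => [q|K]; first last.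
  rewrite /series /= -mulr_sumr.
  by rewrite ler_wpM2l ?exprn_ge0 ?mulr_ge0// exp_partial_le.
apply: le_trans (term_norm_le n q a0 e0 z0) _.
have ec0 := exp_coeff_ge0 q z0.
have -> : exp_coeff (2^-1 * z) q = 2^-1 ^+ q * exp_coeff z q.
  by rewrite /exp_coeff /= exprMn mulrA.
rewrite [leRHS]mulrA ler_wpM2r// -[leRHS]mul1r.
apply: ler_pM; rewrite ?Gamma_ratio_le1//.
- exact/ltW/Gamma_ratio_gt0.
- by rewrite mulr_ge0 ?exprn_ge0.
rewrite exprVn ler_pdivlMr ?exprn_gt0// mulrC mulrA -exprMn.
have e20 : 0 <= 2 * e by rewrite mulr_ge0.
have [qn|nq] := leqP q n.+1.
  rewrite -[X in _ <= _ ^+ X](subnKC qn) exprD ler_wpM2l ?exprn_ge0//.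
  by rewrite lerXn2r ?nnegrE// ler_peMl// ler1n.
rewrite (eqP (_ : n.+1 - q == 0)%N); last by rewrite subn_eq0 ltnW.
rewrite expr0 mulr1 ler_wiXn2l ?(ltnW nq)//.
by rewrite mulrC -ler_pdivlMr// mul1r.
Qed.

(** Every term but the zeroth carries a coefficient at most [1 / (a + 1)]. *)
Lemma series_remainder_near_exp_tail a n e z : 0 <= a -> 0 <= e <= 1 -> 0 <= z ->
  `|series_remainder a n e z - exp_tail n.+1 e| <= (a + 1)^-1 * expR z.
Proof.
move=> a0 /andP[e0 e1] z0.
have a1 : 0 < a + 1 by rewrite ltr_wpDl.
have ez0 : 0 <= e * z by rewrite mulr_ge0.
have cv := @series_remainder_cvg a n e z a0 e0 z0.
pose u q := if q is 0%N then 0 else bessel_term a (e * z) q * exp_tail (n.+1 - q) e.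
have cu : series u @ \oo --> series_remainder a n e z - exp_tail n.+1 e.
  have : (fun K => series (fun q => bessel_term a (e * z) q * exp_tail (n.+1 - q) e) K -
      exp_tail n.+1 e) @ \oo --> series_remainder a n e z - exp_tail n.+1 e.
    by apply: cvgB => //; exact: cvg_cst.
  apply: cvg_trans; apply: near_eq_cvg; near=> K.
  have : (0 < K)%N by near: K; exact: nbhs_infty_gt.
  move: (K) => [//|k] _.
  rewrite /series /= !big_nat_recl//= add0r subn0.
  by rewrite /bessel_term expr0 Gamma_ratio0// fact0 mul1r divr1 mul1r addrAC subrr add0r.
apply: (@norm_series_le u (fun q => (a + 1)^-1 * exp_coeff z q) _ _ _ _ cu) => [q|K];
  first last.
  rewrite /series /= -mulr_sumr.
  by rewrite ler_wpM2l ?invr_ge0 ?(ltW a1)// exp_partial_le.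
case: q => [|q]; first by rewrite normr0 mulr_ge0 ?exp_coeff_ge0// invr_ge0 ltW.
apply: le_trans (term_norm_le n q.+1 a0 e0 z0) _.
rewrite ler_wpM2r ?exp_coeff_ge0// -[leRHS]mulr1.
apply: ler_pM; rewrite ?Gamma_ratioS_le//.
- exact/ltW/Gamma_ratio_gt0.
- by rewrite mulr_ge0 ?exprn_ge0.
by rewrite -exprD exprn_ile1.
Unshelve. all: by end_near. Qed.

Lemma profile_poly_le a j z : 0 <= a -> 0 <= z -> `|profile_poly a j z| <= expR z.
Proof.
move=> a0 z0; apply: le_trans (exp_partial_le j.+1 z0).
rewrite /series /= big_mkord (le_trans (ler_norm_sum _ _ _))// ler_sum// => q _.
have f0 k : 0 < k`!%:R :> R by rewrite ltr0n fact_gt0.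
have g0 := Gamma_ratio_gt0 q a0.
rewrite -2!mulrA normrM normrX normrN1 expr1n mul1r ger0_norm; last first.
  apply: mulr_ge0; first exact: exprn_ge0.
  by apply: divr_ge0; [exact: ltW|exact/ltW/mulr_gt0].
rewrite /exp_coeff /= invfM.
apply: ler_wpM2l; first exact: exprn_ge0.
rewrite mulrA; apply: ler_piMl; first by rewrite invr_ge0 ltW.
rewrite ler_pdivrMr// mul1r (le_trans (Gamma_ratio_le1 _ a0))// ler1n fact_gt0//.
Qed.

(** The kernel [kl] as a function of the two radii, for an arbitrary Bessel index
    [a]; [mu] is the exponent [(N - 2) / 2]. *)
Definition rkernel (mu a : R) (r rho t : R) : R :=
  (2 * t)^-1 * (r * rho) `^ (- mu) * expR (- ((r ^+ 2 + rho ^+ 2) / (4 * t)))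
  * besselI a (r * rho / (2 * t)).

Definition rprofile (mu a : R) (j : nat) (r rho t : R) : R :=
  rho `^ (a - mu + 2 * j%:R) * (t `^ (- 1 - a - j%:R) * r `^ (a - mu)
  * expR (- (r ^+ 2 / (4 * t))) * Ppoly j a (r ^+ 2 / t)).

(** The factor common to the kernel and to its profiles, apart from [exp (- z)]. *)
Definition kernel_prefactor (mu a : R) (r rho t : R) : R :=
  (2 * t)^-1 * (4 * t) `^ (- a) * (r * rho) `^ (a - mu) / Gamma (a + 1).

Section fixed_radii.
Variables (mu a r rho t : R).
Hypotheses (a0 : 0 <= a) (r0 : 0 < r) (rho0 : 0 < rho) (t0 : 0 < t).

Let z := r ^+ 2 / (4 * t).
Let e := rho ^+ 2 / (4 * t).

Let z0 : 0 <= z. Proof. by rewrite divr_ge0 ?exprn_ge0 ?mulr_ge0// ltW. Qed.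
Let e0 : 0 <= e. Proof. by rewrite divr_ge0 ?exprn_ge0 ?mulr_ge0// ltW. Qed.
Let G0 : 0 < Gamma (a + 1).
Proof. by rewrite Gamma_gt0// lerDr. Qed.
Let t4 : 0 < 4 * t. Proof. by rewrite mulr_gt0. Qed.
Let rr0 : 0 < r * rho. Proof. by rewrite mulr_gt0. Qed.

Lemma kernel_prefactor_gt0 : 0 < kernel_prefactor mu a r rho t.
Proof. by rewrite /kernel_prefactor divr_gt0// !mulr_gt0 ?invr_gt0 ?powR_gt0// mulr_gt0. Qed.

Lemma besselI_bessel_sum : besselI a (r * rho / (2 * t)) =
  (r * rho / (4 * t)) `^ a / Gamma (a + 1) * bessel_sum a (e * z).
Proof.
pose w := r * rho / (4 * t).
have w0 : 0 < w by rewrite divr_gt0.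
have -> : e * z = w ^+ 2 by rewrite /e /z /w; field; rewrite gt_eqF.
rewrite /besselI /bessel_sum.
have -> : r * rho / (2 * t) / 2 = w by rewrite /w; field; rewrite gt_eqF.
have E : (fun k : nat => w `^ (2 * k%:R + a) / (k`!%:R * Gamma (k%:R + a + 1))) =
   (fun k => w `^ a / Gamma (a + 1) * bessel_term a (w ^+ 2) k).
  apply/funext => k; rewrite powRD; last by rewrite (gt_eqF w0) implybT.
  have -> : w `^ (2 * k%:R) = (w ^+ 2) ^+ k.
    by rewrite -natrM powR_mulrn ?ltW// exprM.
  have h1 : k`!%:R != 0 :> R by rewrite pnatr_eq0 -lt0n fact_gt0.
  have h2 : Gamma (k%:R + a + 1) != 0.
    by rewrite gt_eqF// Gamma_gt0// lerDr addr_ge0.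
  by rewrite /bessel_term /Gamma_ratio; field; rewrite h1 h2 gt_eqF.
rewrite E -/w.
have -> : series (fun k => w `^ a / Gamma (a + 1) * bessel_term a (w ^+ 2) k) =
    (fun K => w `^ a / Gamma (a + 1) * series (bessel_term a (w ^+ 2)) K).
  by apply/funext => K; rewrite /series /= mulr_sumr.
apply: cvg_lim => //; apply: cvgM; first exact: cvg_cst.
by apply: is_cvg_bessel_sum => //; rewrite exprn_ge0// ltW.
Qed.

Lemma rkernelE : rkernel mu a r rho t =
  kernel_prefactor mu a r rho t * expR (- z) * (expR (- e) * bessel_sum a (e * z)).
Proof.
rewrite /rkernel besselI_bessel_sum /kernel_prefactor.
have -> : expR (- ((r ^+ 2 + rho ^+ 2) / (4 * t))) = expR (- z) * expR (- e).
  by rewrite -expRD; congr expR; rewrite /z /e; field; rewrite gt_eqF.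
have -> : (r * rho / (4 * t)) `^ a = (r * rho) `^ a * (4 * t) `^ (- a).
  rewrite powRM ?invr_ge0 ?(ltW t4) ?(ltW rr0)//.
  by rewrite -powR_inv1 ?(ltW t4)// -powRrM mulN1r.
rewrite powRD; last by rewrite (gt_eqF rr0) implybT.
by field; rewrite !gt_eqF.
Qed.

Lemma rprofileE j : rprofile mu a j r rho t =
  kernel_prefactor mu a r rho t * expR (- z) * (e ^+ j * profile_poly a j z).
Proof.
have t4j : (4 * t) ^+ j != 0 by rewrite expf_neq0// gt_eqF.
have four_pow : 2 `^ (2 * a) = 4 `^ a :> R.
  by rewrite powRrM (powR_mulrn 2 (ler0n _ 2)) -natrX.
have EP : Ppoly j a (r ^+ 2 / t) = (2 * 4 `^ a * 4 ^+ j * Gamma (a + 1))^-1 * profile_poly a j z.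
  rewrite /Ppoly /profile_poly mulr_sumr; apply: eq_bigr => q _.
  have -> : r ^+ 2 / t = 4 * z by rewrite /z; field; rewrite gt_eqF.
  have -> : 2 `^ (2 * (a + j%:R + q%:R) + 1) = 2 * 4 `^ a * 4 ^+ j * 4 ^+ q :> R.
    have -> : 2 * (a + j%:R + q%:R) + 1 = 2 * a + (2 * j)%:R + (2 * q)%:R + 1 :> R.
      by rewrite !natrM; ring.
    rewrite !powRD ?pnatr_eq0 ?implybT// four_pow !powR_mulrn// powRr1// !exprM.
    by rewrite -!natrX; ring.
  rewrite exprMn /Gamma_ratio.
  have h1 k : k`!%:R != 0 :> R by rewrite pnatr_eq0 -lt0n fact_gt0.
  have h2 : Gamma (q%:R + a + 1) != 0.
    by rewrite gt_eqF// Gamma_gt0// lerDr addr_ge0.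
  have h3 : 4 `^ a != 0 :> R by rewrite gt_eqF// powR_gt0.
  have h4 k : 4 ^+ k != 0 :> R by rewrite expf_neq0.
  by field; rewrite !h1 h2 h3 !h4 gt_eqF.
rewrite /rprofile EP /kernel_prefactor -/z.
rewrite powRD; last by rewrite (gt_eqF rho0) implybT.
have -> : rho `^ (2 * j%:R) = (4 * t) ^+ j * e ^+ j.
  rewrite -natrM powR_mulrn ?(ltW rho0)// exprM -exprMn; congr (_ ^+ _).
  by rewrite /e; field; rewrite gt_eqF.
have -> : t `^ (- 1 - a - j%:R) = t^-1 * t `^ (- a) * (t ^+ j)^-1.
  rewrite !powRD ?(gt_eqF t0) ?implybT// powR_inv1 ?(ltW t0)//.
  by rewrite [t `^ (- j%:R)]powRN powR_mulrn// ltW.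
rewrite [(4 * t) `^ _]powRM ?(ltW t0)// [4 `^ (- a)]powRN powRM ?(ltW r0) ?(ltW rho0)//.
rewrite exprMn.
have h3 : 4 `^ a != 0 :> R by rewrite gt_eqF// powR_gt0.
have h4 k : 4 ^+ k != 0 :> R by rewrite expf_neq0.
have h5 : t ^+ j != 0 by rewrite expf_neq0// gt_eqF.
by field; rewrite h3 h4 h5 !gt_eqF.
Qed.

Lemma rkernel_ge0 : 0 <= rkernel mu a r rho t.
Proof.
rewrite rkernelE; apply: mulr_ge0; last first.
  by apply: mulr_ge0; [exact: expR_ge0|apply: bessel_sum_ge0 => //; exact: mulr_ge0].
by rewrite mulr_ge0 ?expR_ge0 ?(ltW kernel_prefactor_gt0).
Qed.

Lemma rkernel_le : rkernel mu a r rho t <= kernel_prefactor mu a r rho t.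
Proof.
rewrite rkernelE -mulrA ger_pMr ?kernel_prefactor_gt0//.
pose w := r * rho / (4 * t).
have w0 : 0 < w by rewrite divr_gt0.
have -> : e * z = w ^+ 2 by rewrite /e /z /w; field; rewrite gt_eqF.
rewrite mulrA -expRD -ler_pdivlMl ?expR_gt0// -expRN mulr1.
apply: le_trans (bessel_sum_sqr_le a0 (ltW w0)) _.
rewrite ler_expR -subr_ge0.
have -> : - (- z + - e) - 2 * w = (r - rho) ^+ 2 / (4 * t).
  by rewrite /z /e /w; field; rewrite gt_eqF.
by rewrite divr_ge0 ?sqr_ge0// ltW.
Qed.

Lemma rprofile_le j : `|rprofile mu a j r rho t| <= kernel_prefactor mu a r rho t * e ^+ j.
Proof.
rewrite rprofileE; have k0 := kernel_prefactor_gt0; move: (kernel_prefactor _ _ _ _ _) k0 => k k0.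
rewrite !normrM (gtr0_norm k0) -mulrA ler_pM2l//.
rewrite gtr0_norm ?expR_gt0// (ger0_norm (exprn_ge0 _ e0)) mulrCA.
rewrite -[leRHS]mulr1 ler_wpM2l ?exprn_ge0//.
by rewrite expRN ler_pdivrMl ?expR_gt0// mulr1 profile_poly_le.
Qed.

Lemma rkernel_remainderE n :
  rkernel mu a r rho t - \sum_(j < n.+1) rprofile mu a j r rho t =
  kernel_prefactor mu a r rho t * expR (- z) * series_remainder a n e z.
Proof.
rewrite rkernelE /series_remainder mulrBr mulr_sumr; congr (_ - _).
by apply: eq_bigr => j _; exact: rprofileE.
Qed.

Lemma rkernel_remainder_le n : rho ^+ 2 <= 2 * t ->
  `|rkernel mu a r rho t - \sum_(j < n.+1) rprofile mu a j r rho t| <=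
  kernel_prefactor mu a r rho t * (2 * e) ^+ n.+1 * expR (- (2^-1 * z)).
Proof.
move=> rt; rewrite rkernel_remainderE.
have k0 := kernel_prefactor_gt0; move: (kernel_prefactor _ _ _ _ _) k0 => k k0.
rewrite 2!normrM (gtr0_norm k0).
rewrite gtr0_norm ?expR_gt0// -!mulrA ler_pM2l//.
have he : 0 <= e <= 2^-1.
  by rewrite e0 /= /e ler_pdivrMr//; lra.
apply: (@le_trans _ _ (expR (- z) * ((2 * e) ^+ n.+1 * expR (2^-1 * z)))).
  by rewrite ler_wpM2l ?expR_ge0// series_remainder_le.
rewrite mulrCA -expRD; apply: ler_wpM2l; first by rewrite exprn_ge0// mulr_ge0.
by rewrite ler_expR; lra.
Qed.

(** For Bessel index [a] large compared with [expR z], the remainder keeps the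
    sign and the size of its zeroth term, the tail of [expR (- e)]. *)
Lemma rkernel_remainder_ge n : e <= 1 ->
  4 * n.+1`!%:R * expR z <= (a + 1) * e ^+ n.+1 ->
  kernel_prefactor mu a r rho t * expR (- z) * (4^-1 * (e ^+ n.+1 / n.+1`!%:R)) <=
  (-1) ^+ n.+1 * (rkernel mu a r rho t - \sum_(j < n.+1) rprofile mu a j r rho t).
Proof.
move=> e1 ha.
rewrite rkernel_remainderE [leRHS]mulrCA.
apply: ler_wpM2l; first by rewrite mulr_ge0 ?expR_ge0 ?(ltW kernel_prefactor_gt0).
have he : 0 <= e <= 1 by rewrite e0.
have h1 := exp_tail_lb n he.
have h2 := series_remainder_near_exp_tail n a0 he z0.
have f0 : 0 < n.+1`!%:R :> R by rewrite ltr0n fact_gt0.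
have h3 : (a + 1)^-1 * expR z <= 4^-1 * (e ^+ n.+1 / n.+1`!%:R).
  rewrite ler_pdivrMl ?ltr_wpDl// -(ler_pM2l (_ : 0 < 4 * n.+1`!%:R)) ?mulr_gt0//.
  apply: le_trans ha _; rewrite le_eqVlt; apply/orP; left; apply/eqP; field.
  by rewrite gt_eqF.
have h4 : `|(-1) ^+ n.+1 * series_remainder a n e z - (-1) ^+ n.+1 * exp_tail n.+1 e| <=
   4^-1 * (e ^+ n.+1 / n.+1`!%:R).
  by rewrite -mulrBr normrM normrX normrN1 expr1n mul1r (le_trans h2).
move: h1 h4; rewrite ler_norml => h1 /andP[h4 _].
by set x := e ^+ n.+1 / _ in h1 h4 *; lra.
Qed.

End fixed_radii.
End kernel_remainder.

(** * Affine changes of variables *)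

Section lebesgue_affine.
Context {R : realType}.
Notation leb1 := (@lebesgue_measure R).
Local Open Scope ereal_scope.

Lemma lebesgue_measure_affine (a b : R) (A : set (measurableTypeR R)) :
  (0 < a)%R -> measurable A ->
  leb1 ((fun y : R => a * y + b)%R @^-1` A) = (a^-1)%:E * leb1 A.
Proof.
move=> a0 mA; have ai0 : (0 <= a)%R by exact: ltW.
have mphi : measurable_fun [set: measurableTypeR R] (fun y : R => a * y + b : measurableTypeR R)%R.
  by apply: measurable_funD => //; exact: measurable_funM.
pose phi (y : measurableTypeR R) : measurableTypeR R := (a * y + b)%R.
pose m : {measure set (measurableTypeR R) -> \bar R} :=
  mscale (NngNum ai0) (pushforward leb1 phi).
have mE : forall X, measurable X -> leb1 X = m mphi X.
  apply: lebesgue_measure_unique => _ [[u v] _ <-].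
  transitivity (a%:E * leb1 (phi @^-1` [set` `]u, v]])); last by [].
  have -> : phi @^-1` `]u, v] = [set` `]((u - b) / a)%R, ((v - b) / a)%R]].
    apply/seteqP; split=> y; rewrite /phi /= !in_itv/= ltr_pdivrMr// ler_pdivlMr// ltrBlDr lerBrDr;
      by rewrite [(y * a)%R]mulrC.
  rewrite lebesgue_measure_itv/= lebesgue_measure_itv/= !lte_fin.
  rewrite ltr_pM2r ?invr_gt0// ltrD2r; case: ifPn => uv; last by rewrite mule0.
  by rewrite -!EFinD -EFinM; congr EFin; field; rewrite gt_eqF.
have -> : leb1 A = a%:E * leb1 (phi @^-1` A) := mE A mA.
by rewrite muleA -EFinM mulVf ?gt_eqF// mul1e.
Qed.

Lemma ge0_integral_affine1 (a b : R) (f : R -> \bar R) :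
  (0 < a)%R -> measurable_fun [set: R] f -> (forall x, 0 <= f x) ->
  \int[leb1]_y f (a * y + b)%R = (a^-1)%:E * \int[leb1]_y f y.
Proof.
move=> a0 mf f0; have ai0 : (0 <= a^-1)%R by rewrite invr_ge0 ltW.
have mphi : measurable_fun [set: measurableTypeR R] (fun y : R => a * y + b : measurableTypeR R)%R.
  by apply: measurable_funD => //; exact: measurable_funM.
have := @ge0_integral_pushforward _ _ _ _ _ _ mphi leb1 setT f measurableT mf (fun x _ => f0 x).
rewrite preimage_setT /comp => <-.
rewrite -(ge0_integral_mscale leb1 measurableT (NngNum ai0) mf)//.
apply: eq_measure_integral => A mA _.
by rewrite /pushforward /mscale /=; exact: lebesgue_measure_affine.
Qed.

End lebesgue_affine.

Section lebesgueN_theory.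
Context {R : realType}.
Notation leb1 := (@lebesgue_measure R).
Local Open Scope ereal_scope.

Lemma ge0_integral_lebesgueNS n (f : n.+1.-tuple R -> \bar R) :
  measurable_fun setT f -> (forall x, 0 <= f x) ->
  \int[lebesgueN R n.+1]_x f x =
  \int[leb1]_s \int[lebesgueN R n]_v f (cons_point (s, v)).
Proof.
move=> mf f0.
rewrite (_ : \int[lebesgueN R n.+1]_x f x =
  \int[pushforward (leb1 \x lebesgueN R n)%E (@cons_point R n)]_x f x)//.
rewrite (ge0_integral_pushforward (@measurable_cons_point R n))//.
rewrite preimage_setT (@fubini_tonelli1 _ _ _ _ _ leb1 (lebesgueN R n) (f \o @cons_point R n))//.
  by apply: measurableT_comp => //; exact: measurable_cons_point.
by move=> x; exact: f0.
Qed.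

Lemma integral_lebesgueN0 (f : 0.-tuple R -> \bar R) :
  measurable_fun setT f -> \int[lebesgueN R 0]_x f x = f [tuple].
Proof.
move=> mf; rewrite /= integral_dirac// diracT mul1e.
by congr f; exact: val_inj.
Qed.

Definition affv n (a : R) (b x : n.-tuple R) : n.-tuple R :=
  [tuple a * tnth x i + tnth b i | i < n]%R.

Lemma measurable_affv n (a : R) (b : n.-tuple R) : measurable_fun setT (affv a b).
Proof.
apply/measurable_fun_tnthP => i.
rewrite (_ : _ \o _ = fun x => (a * tnth x i + tnth b i)%R); last first.
  by apply/funext => x /=; rewrite tnth_mktuple.
by apply: measurable_funD => //; apply: measurable_funM => //; exact: measurable_tnth.
Qed.

Lemma affv_cons n (a : R) (b : n.+1.-tuple R) s (v : n.-tuple R) :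
  affv a b (cons_point (s, v)) =
  cons_point ((a * s + thead b)%R, affv a [tuple of behead b] v).
Proof.
apply: eq_from_tnth => i; rewrite tnth_mktuple.
case: (unliftP ord0 i) => [j|] ->.
  rewrite !tnthS tnth_mktuple; congr (_ + _)%R.
  by rewrite [in LHS](tuple_eta b) tnthS.
by rewrite !tnth0.
Qed.

Lemma ge0_integral_affv n (a : R) (b : n.-tuple R) (f : n.-tuple R -> \bar R) :
  (0 < a)%R -> measurable_fun setT f -> (forall x, 0 <= f x) ->
  \int[lebesgueN R n]_x f (affv a b x) = ((a ^+ n)^-1)%:E * \int[lebesgueN R n]_x f x.
Proof.
move=> a0; elim: n b f => [|n IH] b f mf f0.
  have mfa : measurable_fun setT (fun x => f (affv a b x)).
    by apply: measurableT_comp => //; exact: measurable_affv.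
  rewrite !integral_lebesgueN0// expr0 invr1 mul1e; congr f.
  by rewrite tuple0.
have mfc s : measurable_fun setT (fun v => f (cons_point (s, v))).
  apply: (measurableT_comp mf); apply: (measurableT_comp (@measurable_cons_point R n)).
  exact: measurable_pair1.
have mfa : measurable_fun setT (fun x => f (affv a b x)).
  by apply: measurableT_comp => //; exact: measurable_affv.
rewrite ge0_integral_lebesgueNS//.
under eq_integral => s _.
  under eq_integral do rewrite affv_cons.
  rewrite (IH _ (fun v => f (cons_point ((a * s + thead b)%R, v))))//.
  over.
have mI : measurable_fun setT (fun s : R => \int[lebesgueN R n]_v f (cons_point (s, v))).
  apply: (@measurable_fun_fubini_tonelli_F _ _ _ _ _ (lebesgueN R n) (f \o @cons_point R n)) => //.
    by apply: measurableT_comp => //; exact: measurable_cons_point.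
  by move=> x; exact: f0.
have an0 : (0 <= (a ^+ n)^-1)%R by rewrite invr_ge0 exprn_ge0// ltW.
rewrite ge0_integralZl//; last 2 first.
- apply: (measurableT_comp mI).
  by apply: measurable_funD => //; exact: measurable_funM.
- by move=> s _; exact: integral_ge0.
rewrite (@ge0_integral_affine1 R a _ (fun s => \int[lebesgueN R n]_v f (cons_point (s, v))))//; last first.
  by move=> s; exact: integral_ge0.
rewrite -ge0_integral_lebesgueNS// muleA -EFinM; congr (_%:E * _).
by rewrite exprS invfM mulrC.
Qed.

Lemma scalev_affv n (a : R) (x : n.-tuple R) : scalev a x = affv a [tuple 0%R | _ < n] x.
Proof. by apply: eq_from_tnth => i; rewrite !tnth_mktuple addr0. Qed.

Lemma ge0_integral_scalev n (a : R) (f : n.-tuple R -> \bar R) :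
  (0 < a)%R -> measurable_fun setT f -> (forall x, 0 <= f x) ->
  \int[lebesgueN R n]_x f (scalev a x) = ((a ^+ n)^-1)%:E * \int[lebesgueN R n]_x f x.
Proof.
move=> a0 mf f0; rewrite -(@ge0_integral_affv n a [tuple 0%R | _ < n] f)//.
by apply: eq_integral => x _; rewrite scalev_affv.
Qed.

Lemma measurable_box n (c d : R) :
  measurable [set x : n.-tuple R | forall i, (c <= tnth x i <= d)%R].
Proof.
rewrite (_ : [set x | _] = \bigcap_(i in [set: 'I_n]) ((@tnth n R)^~ i @^-1` `[c, d])).
  apply: fin_bigcap_measurable => // i _.
  by rewrite -[X in measurable X]setTI; apply: measurable_tnth => //.
apply/seteqP; split=> x /=.
  by move=> h i _ /=; rewrite in_itv/=.
by move=> h i; have := h i I; rewrite /= in_itv.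
Qed.

Lemma lebesgueN_box n (c d : R) : (c <= d)%R ->
  lebesgueN R n [set x | forall i, (c <= tnth x i <= d)%R] = ((d - c) ^+ n)%:E.
Proof.
move=> cd; elim: n => [|n IH].
  rewrite /= diracE expr0 mem_set//; by case.
rewrite (_ : lebesgueN R n.+1 _ = (leb1 \x lebesgueN R n)
   (`[c, d]%classic `*` [set x : n.-tuple R | forall i, (c <= tnth x i <= d)%R])); last first.
  rewrite /= /cons_measure /pushforward; congr (_ _).
  apply/seteqP; split=> -[s v] /=.
    move=> h; split; first by have := h ord0; rewrite tnth0 in_itv.
    by move=> i; have := h (lift ord0 i); rewrite tnthS.
  rewrite in_itv/= => -[h1 h2] i.
  by case: (unliftP ord0 i) => [j|] ->; rewrite ?tnthS ?tnth0.
rewrite product_measure1E//; last exact: measurable_box.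
rewrite [X in _ * X](_ : _ = ((d - c) ^+ n)%:E)//.
transitivity (leb1 `[c, d]%classic * ((d - c) ^+ n)%:E); first by [].
rewrite lebesgue_measure_itv/= lte_fin exprS.
move: cd; rewrite le_eqVlt => /predU1P[->|cd]; first by rewrite ltxx subrr mul0r mul0e.
by rewrite cd -EFinD -EFinM.
Qed.

End lebesgueN_theory.

(** * Polar decomposition of Lebesgue measure *)

Lemma cvgn_exprn {R : realType} (u : nat -> R) (l : R) (N : nat) :
  u @ \oo --> l -> (fun k => u k ^+ N) @ \oo --> l ^+ N.
Proof.
move=> ul; elim: N => [|N IH]; first by rewrite expr0; exact: cvg_cst.
by rewrite exprS; under eq_fun do rewrite exprS; exact: cvgM.
Qed.

Section euclidean_norm.
Context {R : realType} {N : nat}.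
Implicit Types (x : N.-tuple R) (a : R).

Lemma enorm_ge0 x : 0 <= enorm x. Proof. exact: sqrtr_ge0. Qed.

Lemma sqr_enorm x : enorm x ^+ 2 = \sum_(i < N) tnth x i ^+ 2.
Proof. by rewrite sqr_sqrtr// sumr_ge0// => i _; exact: sqr_ge0. Qed.

Lemma enormZ a x : 0 <= a -> enorm (scalev a x) = a * enorm x.
Proof.
move=> a0; rewrite /enorm.
have -> : \sum_(i < N) tnth (scalev a x) i ^+ 2 = a ^+ 2 * \sum_(i < N) tnth x i ^+ 2.
  by rewrite mulr_sumr; apply: eq_bigr => i _; rewrite tnth_mktuple exprMn.
by rewrite sqrtrM ?sqr_ge0// sqrtr_sqr ger0_norm.
Qed.

Lemma scalevA a b x : scalev a (scalev b x) = scalev (a * b) x.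
Proof. by apply: eq_from_tnth => i; rewrite !tnth_mktuple mulrA. Qed.

Lemma scale1v x : scalev 1 x = x.
Proof. by apply: eq_from_tnth => i; rewrite !tnth_mktuple mul1r. Qed.

Lemma tnth_enorm_eq0 x i : enorm x = 0 -> tnth x i = 0.
Proof.
move=> x0; have := sqr_enorm x; rewrite x0 expr0n /= => /esym/eqP.
rewrite psumr_eq0 => [|j _]; last exact: sqr_ge0.
by move=> /allP/(_ i); rewrite mem_index_enum => /(_ isT); rewrite sqrf_eq0 => /eqP.
Qed.

Lemma scalev_enorm_dir x : scalev (enorm x) (dir x) = x.
Proof.
have [x0|x0] := eqVneq (enorm x) 0; last by rewrite scalevA divff// scale1v.
by apply: eq_from_tnth => i; rewrite !tnth_mktuple x0 mul0r tnth_enorm_eq0.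
Qed.

Lemma enorm_dir x : enorm x != 0 -> enorm (dir x) = 1.
Proof. by move=> x0; rewrite enormZ ?invr_ge0 ?enorm_ge0// mulVf. Qed.

Lemma dirZ a x : 0 < a -> dir (scalev a x) = dir x.
Proof.
move=> a0; rewrite /dir enormZ ?ltW// scalevA; congr scalev.
by rewrite invfM mulrAC mulVf ?gt_eqF// mul1r.
Qed.

Lemma dir_sphere x : sphere x -> dir x = x.
Proof. by rewrite /sphere /= => x1; rewrite /dir x1 invr1 scale1v. Qed.

Lemma norm_tnth_le x i : `|tnth x i| <= enorm x.
Proof.
rewrite -(@ler_pXn2r _ 2)// ?nnegrE ?enorm_ge0// sqr_enorm real_normK ?num_real//.
by rewrite (bigD1 i)//= lerDl sumr_ge0// => j _; exact: sqr_ge0.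
Qed.

Lemma measurable_scalev : measurable_fun setT (fun z : measurableTypeR R * N.-tuple R => scalev z.1 z.2).
Proof.
apply/measurable_fun_tnthP => i.
rewrite (_ : _ \o _ = fun z => z.1 * tnth z.2 i); last first.
  by apply/funext => z /=; rewrite tnth_mktuple.
apply: measurable_funM; first exact: measurable_fst.
by apply: (measurableT_comp (measurable_tnth i)); exact: measurable_snd.
Qed.

Lemma measurable_scalevl a : measurable_fun setT (fun x : N.-tuple R => scalev a x).
Proof.
apply/measurable_fun_tnthP => i.
rewrite (_ : _ \o _ = fun x => a * tnth x i); last first.
  by apply/funext => x /=; rewrite tnth_mktuple.
by apply: measurable_funM => //; exact: measurable_tnth.
Qed.

Lemma measurable_enorm_preimage (A : set (measurableTypeR R)) : measurable A ->
  measurable (@enorm R N @^-1` A).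
Proof. by move=> mA; rewrite -[X in measurable X]setTI; exact: measurable_enorm. Qed.

Lemma measurable_dir_preimage (B : set (N.-tuple R)) : measurable B ->
  measurable (@dir R N @^-1` B).
Proof. by move=> mA; rewrite -[X in measurable X]setTI; exact: measurable_dir. Qed.

Lemma measurable_sphere : measurable (@sphere R N).
Proof.
rewrite (_ : @sphere R N = @enorm R N @^-1` [set 1])//.
by apply: measurable_enorm_preimage; exact: measurable_set1.
Qed.

End euclidean_norm.

Section polar_coordinates.
Context {R : realType} {N : nat}.
Notation leb1 := (@lebesgue_measure R).
Notation leb := (lebesgueN R N).
Notation V := (fine (lebesgueN R N (@unit_ball R N))).
Local Open Scope ereal_scope.

Lemma eq_measure_rays (m1 m2 : {measure set (measurableTypeR R) -> \bar R}) :
  (forall x : R, m1 `]-oo, x[%classic = m2 `]-oo, x[%classic) ->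
  (forall x : R, m1 `]-oo, x[%classic < +oo) ->
  forall A, measurable A -> m1 A = m2 A.
Proof.
move=> m12 m1fin A mA.
apply: (@measure_unique _ R (measurableTypeR R) (@RGenInftyO.G R)
  (fun k : nat => [set` `]-oo, (k%:R : R)[])) => //.
- exact: RGenInftyO.measurableE.
- move=> _ _ [x ->] [y ->]; exists (Order.min x y).
  apply/seteqP; split => z /=; rewrite !in_itv/= lt_min; first by move=> [-> ->].
  by move=> /andP[].
- by move=> k; exists k%:R.
- apply/seteqP; split => // x _; exists (Num.truncn `|x|).+1 => //=.
  by rewrite in_itv/= (le_lt_trans (ler_norm x))// truncnS_gt.
- by move=> _ [x ->].
Qed.

Lemma unit_ball_lty : leb (@unit_ball R N) < +oo.
Proof.
apply: (@le_lt_trans _ _ (leb [set x | forall i, (-1 <= tnth x i <= 1)%R])); last first.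
  by rewrite lebesgueN_box// ?ltry// (le_trans (lerN10 _)).
apply: le_measure; rewrite ?inE.
- exact: measurable_unit_ball.
- exact: measurable_box.
- by move=> x /= x1 i; rewrite -ler_norml (le_trans (norm_tnth_le _ _)).
Qed.

Lemma unit_ball_fin : leb (@unit_ball R N) \is a fin_num.
Proof. by rewrite ge0_fin_numE ?unit_ball_lty. Qed.

Lemma unit_ball_gt0 : 0 < leb (@unit_ball R N).
Proof.
pose c : R := (N.+1%:R^-1)%R.
have c0 : (0 < c)%R by rewrite invr_gt0.
apply: (@lt_le_trans _ _ (leb [set x | forall i, (0 <= tnth x i <= c)%R])).
  by rewrite lebesgueN_box ?(ltW c0)// subr0 lte_fin exprn_gt0.
apply: le_measure; rewrite ?inE.
- exact: measurable_box.
- exact: measurable_unit_ball.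
- move=> x /= h; rewrite /unit_ball /= -(@ler_pXn2r _ 2)// ?nnegrE ?enorm_ge0//.
  rewrite sqr_enorm expr1n (@le_trans _ _ (\sum_(i < N) c)%R)//.
    apply: ler_sum => i _; have /andP[h1 h2] := h i.
    rewrite (@le_trans _ _ (c ^+ 2)%R)//; first by rewrite lerXn2r// nnegrE ?(ltW c0).
    by rewrite expr2 ler_piMl ?(ltW c0)// invf_le1// ler1n.
  rewrite sumr_const card_ord -[X in (X <= _)%R]mulr_natr mulrC /c.
  by rewrite ler_pdivrMr// mul1r ler_nat.
Qed.

Lemma V_gt0 : (0 < V)%R.
Proof. by rewrite fine_gt0// unit_ball_gt0 unit_ball_lty. Qed.

Lemma V_EFin : V%:E = leb (@unit_ball R N).
Proof. by rewrite fineK// unit_ball_fin. Qed.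

(** A cone over [B] truncated at radius [r] is the dilation by [r] of the same
    cone truncated at radius 1; [b] selects the closed or the open truncation. *)
Lemma cone_dilation (b : bool) (B : set (N.-tuple R)) (r : R) : (0 < r)%R -> measurable B ->
  leb ((@enorm R N) @^-1` [set` Interval -oo%O (BSide b r)] `&` (@dir R N) @^-1` B) =
  (r ^+ N)%:E * leb ((@enorm R N) @^-1` [set` Interval -oo%O (BSide b 1%R)] `&` (@dir R N) @^-1` B).
Proof.
move=> r0 mB.
have mS s : measurable ((@enorm R N) @^-1` [set` Interval -oo%O (BSide b s)] `&` (@dir R N) @^-1` B).
  apply: measurableI; last exact: measurable_dir_preimage.
  by apply: measurable_enorm_preimage; exact: measurable_itv.
have := @ge0_integral_scalev R N r (fun x => (\1_((@enorm R N) @^-1`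
  [set` Interval -oo%O (BSide b r)] `&` (@dir R N) @^-1` B) x)%:E) r0.
have iE S : measurable S -> \int[leb]_x (\1_S x)%:E = leb S.
  by move=> mS'; rewrite integral_indic ?setIT.
rewrite (iE _ (mS r)) => H.
rewrite -[LHS]mul1e.
have -> : 1 = (r ^+ N)%:E * ((r ^+ N)^-1)%:E.
  by rewrite -EFinM divff// expf_neq0// gt_eqF.
rewrite -muleA -H//; last by apply/measurable_EFinP; exact: measurable_indic.
congr (_ * _).
rewrite -(iE _ (mS 1%R)); apply: eq_integral => x _ /=.
congr EFin; rewrite !indicE; congr (nat_of_bool _)%:R.
apply/idP/idP; rewrite !inE/= => -[]; rewrite dirZ// enormZ ?(ltW r0)// !in_itv/=.
  by rewrite -[X in (_ < X ?<= if _)%R](mulr1 r) lteif_pM2l.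
by move=> h1 h2; split => //; rewrite -[X in (_ < X ?<= if _)%R](mulr1 r) lteif_pM2l.
Qed.

(** The closed cone lies in the open one dilated by any ratio above [1]. *)
Lemma open_cone_eq_closed (B : set (N.-tuple R)) : measurable B ->
  leb ((@enorm R N) @^-1` `]-oo, 1%R[ `&` (@dir R N) @^-1` B) =
  leb ((@enorm R N) @^-1` `]-oo, 1%R] `&` (@dir R N) @^-1` B).
Proof.
move=> mB.
have mS b s : measurable ((@enorm R N) @^-1` [set` Interval -oo%O (BSide b s)] `&` (@dir R N) @^-1` B).
  apply: measurableI; last exact: measurable_dir_preimage.
  by apply: measurable_enorm_preimage; exact: measurable_itv.
apply/eqP; rewrite eq_le; apply/andP; split.
  apply: le_measure; rewrite ?inE//.
  by move=> x [h1 h2]; split => //; move: h1; rewrite /= !in_itv/= => /ltW.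
have cfin b : leb ((@enorm R N) @^-1` [set` Interval -oo%O (BSide b 1%R)] `&` (@dir R N) @^-1` B)
    \is a fin_num.
  rewrite ge0_fin_numE//; apply: le_lt_trans unit_ball_lty.
  apply: le_measure; rewrite ?inE//; first exact: measurable_unit_ball.
  by move=> x [h1 _]; move: h1; rewrite /unit_ball /= in_itv/=; exact: lteifW.
set c1 := leb _; set c2 := leb _.
have c1f : c1 \is a fin_num by exact: cfin.
have c2f : c2 \is a fin_num by exact: cfin.
rewrite -(fineK c1f) -(fineK c2f) lee_fin.
have h (k : nat) : (fine c1 <= (1 + harmonic k) ^+ N * fine c2)%R.
  have k1 : (0 < 1 + harmonic k :> R)%R by rewrite addr_gt0// harmonic_gt0.
  rewrite -lee_fin EFinM fineK// fineK// -(@cone_dilation true)//.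
  apply: le_measure; rewrite ?inE//.
  move=> x [h1 h2]; split => //; move: h1; rewrite /= !in_itv/= => h1.
  by rewrite (le_lt_trans h1)// ltrDl harmonic_gt0.
have cv : ((1 + harmonic k) ^+ N * fine c2)%R @[k --> \oo] --> fine c2.
  rewrite -[X in _ --> X]mul1r; apply: cvgM; last exact: cvg_cst.
  rewrite -[X in _ --> X](expr1n _ N); apply: cvgn_exprn.
  rewrite -[X in _ --> X]addr0; apply: cvgD; first exact: cvg_cst.
  exact: cvg_harmonic.
rewrite -(cvg_lim (@Rhausdorff R) cv); apply: limr_ge.
  by apply/cvg_ex; exists (fine c2).
exact: nearW.
Qed.

Lemma cone_measureE (B : set (N.-tuple R)) :
  cone_measure B = leb ((@enorm R N) @^-1` `]-oo, 1%R] `&` (@dir R N) @^-1` B).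
Proof.
rewrite /cone_measure /pushforward /mrestr setIC; congr (leb (_ `&` _)).
Qed.

Lemma sphere_measureE (B : set (N.-tuple R)) :
  @sphere_measure R N B = (V^-1)%:E * cone_measure B.
Proof. by []. Qed.

Lemma cone_measureT : @cone_measure R N setT = V%:E.
Proof.
rewrite cone_measureE preimage_setT setIT V_EFin; congr (leb _).
Qed.

Lemma sphere_measureT : @sphere_measure R N setT = 1.
Proof. by rewrite sphere_measureE cone_measureT -EFinM mulVf// gt_eqF// V_gt0. Qed.

Lemma cone_open_ray (x : R) (B : set (N.-tuple R)) : measurable B ->
  leb ((@enorm R N) @^-1` `]-oo, x[ `&` (@dir R N) @^-1` B) =
  ((Num.max x 0) ^+ N *+ (0 < x)%R)%:E * cone_measure B.
Proof.
move=> mB; have [x0|x0] := ltP 0%R x; last first.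
  rewrite mulr0n mul0e (_ : _ @^-1` _ = set0) ?set0I ?measure0//.
  apply/seteqP; split => // y /=; rewrite in_itv/= ltNge.
  by rewrite (le_trans x0)// enorm_ge0.
by rewrite mulr1n cone_dilation// open_cone_eq_closed// cone_measureE.
Qed.

Lemma ball_open_ray (x : R) :
  leb ((@enorm R N) @^-1` `]-oo, x[) = ((Num.max x 0) ^+ N *+ (0 < x)%R * V)%:E.
Proof.
have := @cone_open_ray x setT measurableT.
by rewrite preimage_setT setIT cone_measureT EFinM.
Qed.

(** For fixed [B] both sides are measures in [A], and dilation invariance makes them
    agree on rays. *)
Lemma enorm_dir_indep (A : set (measurableTypeR R)) (B : set (N.-tuple R)) :
  measurable A -> measurable B ->
  leb (@enorm R N @^-1` A `&` @dir R N @^-1` B) =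
  leb (@enorm R N @^-1` A) * @sphere_measure R N B.
Proof.
move=> mA mB.
have mdB := measurable_dir_preimage mB.
have c0 : (0 <= fine (@sphere_measure R N B))%R by rewrite fine_ge0.
have sfin : @sphere_measure R N B \is a fin_num.
  rewrite ge0_fin_numE// (@le_lt_trans _ _ 1) ?ltry// -sphere_measureT.
  by apply: le_measure; rewrite ?inE.
have cfin : @cone_measure R N B \is a fin_num.
  rewrite ge0_fin_numE// (@le_lt_trans _ _ V%:E) ?ltry// -cone_measureT.
  by apply: le_measure; rewrite ?inE.
pose en (x : N.-tuple R) : measurableTypeR R := enorm x.
pose m1 : {measure set (measurableTypeR R) -> \bar R} :=
  pushforward (mrestr leb mdB) en.
pose m2 : {measure set (measurableTypeR R) -> \bar R} :=
  mscale (NngNum c0) (pushforward leb en).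
have men : measurable_fun setT en := @measurable_enorm R N.
have m2E X : m2 men X = (fine (@sphere_measure R N B))%:E * leb (@enorm R N @^-1` X) by [].
have m1E X : m1 men X = leb (@enorm R N @^-1` X `&` @dir R N @^-1` B) by [].
rewrite -m1E muleC -(fineK sfin) -m2E.
apply: eq_measure_rays => // x; rewrite m1E ?m2E cone_open_ray//; last first.
  by rewrite -(fineK cfin) -EFinM ltry.
rewrite ball_open_ray sphere_measureE -(fineK cfin) -!EFinM /=; congr EFin.
by field; rewrite gt_eqF// V_gt0.
Qed.

End polar_coordinates.

(** * Integration in polar coordinates *)

Section polar_integration.
Context {R : realType} {N : nat}.
Notation leb1 := (@lebesgue_measure R).
Notation leb := (lebesgueN R N).
Notation sigma := (@sphere_measure R N).
Local Open Scope ereal_scope.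

Definition radius (x : N.-tuple R) : measurableTypeR R := enorm x.

Lemma measurable_radius : measurable_fun setT radius.
Proof. exact: measurable_enorm. Qed.

Definition radial_measure : set (measurableTypeR R) -> \bar R :=
  pushforward leb radius.

Lemma radial_measure_semi_sigma_additive : semi_sigma_additive radial_measure.
Proof.
pose m : {measure set (measurableTypeR R) -> \bar R} := pushforward leb radius.
exact: (@measure_semi_sigma_additive _ _ _ (m measurable_radius)).
Qed.

HB.instance Definition _ := isMeasure.Build _ _ _ radial_measure
  (measure0 leb) (fun A => measure_ge0 leb (radius @^-1` A)) radial_measure_semi_sigma_additive.

Lemma radial_measure_sigma_finite : sigma_finite setT radial_measure.
Proof.
exists (fun k : nat => [set` `]-oo, (k%:R : R)[]).
  apply/esym/seteqP; split => // x _; exists (Num.truncn `|x|).+1 => //=.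
  by rewrite in_itv/= (le_lt_trans (ler_norm x))// truncnS_gt.
move=> k; split; first exact: measurable_itv.
by rewrite /radial_measure /pushforward [X in X < _](ball_open_ray (k%:R)) ltry.
Qed.

HB.instance Definition _ := Measure_isSigmaFinite.Build _ _ _ radial_measure
  radial_measure_sigma_finite.

(** A copy of [sphere_measure] that carries the sigma-finite structure required by
    product measures. *)
Definition usphere_measure : set (N.-tuple R) -> \bar R := sigma.

HB.instance Definition _ := Measure.on usphere_measure.

Lemma usphere_measure_sigma_finite : sigma_finite setT usphere_measure.
Proof.
exists (fun=> setT); first by rewrite bigcup_const.
by move=> _; split => //; rewrite [X in X < _]sphere_measureT ltry.
Qed.

HB.instance Definition _ := Measure_isSigmaFinite.Build _ _ _ usphere_measure
  usphere_measure_sigma_finite.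

Definition polar (x : N.-tuple R) : measurableTypeR R * N.-tuple R := (radius x, dir x).

Lemma measurable_polar : measurable_fun setT polar.
Proof. by apply: measurable_fun_pair; [exact: measurable_enorm|exact: measurable_dir]. Qed.

(** In polar coordinates, Lebesgue measure is a product measure: radius and
    direction are independent. *)
Lemma polar_product (D : set (measurableTypeR R * N.-tuple R)) : measurable D ->
  (radial_measure \x usphere_measure) D = leb (polar @^-1` D).
Proof.
move=> mD.
pose m : {measure set (measurableTypeR R * N.-tuple R) -> \bar R} := pushforward leb polar.
rewrite (_ : leb _ = m measurable_polar D)//.
apply: (@product_measure_unique _ _ _ _ R radial_measure usphere_measure) => // A B mA mB.
exact: (@enorm_dir_indep R N A B mA mB).
Qed.

Lemma eq_integral_polar_product (F : measurableTypeR R * N.-tuple R -> \bar R) :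
  \int[pushforward leb polar]_z F z = \int[radial_measure \x usphere_measure]_z F z.
Proof.
pose m : {measure set (measurableTypeR R * N.-tuple R) -> \bar R} := pushforward leb polar.
apply: (@eq_measure_integral _ _ R setT (radial_measure \x usphere_measure)
  (m measurable_polar) F) => A mA _.
exact (esym (polar_product mA)).
Qed.

Lemma ge0_integral_polar (F : measurableTypeR R * N.-tuple R -> \bar R) :
  measurable_fun setT F -> (forall z, 0 <= F z) ->
  \int[leb]_x F (polar x) = \int[leb]_x \int[sigma]_w F (enorm x, w).
Proof.
move=> mF F0.
transitivity (\int[pushforward leb polar]_z F z).
  by rewrite (ge0_integral_pushforward measurable_polar)// => ? ?.
rewrite eq_integral_polar_product.
rewrite fubini_tonelli1//.
transitivity (\int[pushforward leb radius]_s \int[sigma]_w F (s, w)); first by [].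
rewrite (ge0_integral_pushforward measurable_radius)//.
- exact: (@measurable_fun_fubini_tonelli_F _ _ _ _ _ usphere_measure F).
- by move=> s _; exact: integral_ge0.
Qed.

Lemma ge0_integral_radial_angular (f : R -> R) (g : N.-tuple R -> R) :
  measurable_fun setT f -> measurable_fun setT g ->
  (forall s, 0 <= f s)%R -> (forall w, 0 <= g w)%R ->
  \int[leb]_x (f (enorm x) * g (dir x))%:E =
  (\int[leb]_x (f (enorm x))%:E) * \int[sigma]_w (g w)%:E.
Proof.
move=> mf mg f0 g0.
rewrite (@ge0_integral_polar (fun z => (f z.1 * g z.2)%:E)); last 2 first.
- apply/measurable_EFinP; apply: measurable_funM.
    exact: measurableT_comp.
  exact: measurableT_comp.
- by move=> z; rewrite lee_fin mulr_ge0.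
rewrite -ge0_integralZr//; last 3 first.
- by apply/measurable_EFinP; apply: measurableT_comp => //; exact: measurable_enorm.
- by move=> x _; rewrite lee_fin.
- by apply: integral_ge0 => w _; rewrite lee_fin.
apply: eq_integral => x _.
under eq_integral do rewrite EFinM.
have mg' : measurable_fun [set: N.-tuple R] (EFin \o g) by exact/measurable_EFinP.
rewrite -(@ge0_integralZl _ _ R sigma setT measurableT (EFin \o g) mg' (f (enorm x))%:E)//.
  by move=> w _ /=; rewrite lee_fin.
by rewrite lee_fin.
Qed.

Lemma measurable_scalev_polar (f : N.-tuple R -> R) : measurable_fun setT f ->
  measurable_fun setT (fun z : measurableTypeR R * N.-tuple R => f (scalev z.1 z.2)).
Proof. by move=> mf; apply: (measurableT_comp mf); exact: measurable_scalev. Qed.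

Lemma integral_polar (f : N.-tuple R -> R) :
  measurable_fun setT f -> leb.-integrable setT (EFin \o f) ->
  \int[leb]_x (f x)%:E = \int[leb]_x \int[sigma]_w (f (scalev (enorm x) w))%:E.
Proof.
move=> mf fint.
pose F (z : measurableTypeR R * N.-tuple R) := (f (scalev z.1 z.2))%:E.
have mF : measurable_fun setT F.
  by apply/measurable_EFinP; exact: measurable_scalev_polar.
have FE : F \o polar = EFin \o f.
  by apply/funext => x; rewrite /F /polar /= scalev_enorm_dir.
have Fint : leb.-integrable (polar @^-1` setT) (F \o polar).
  by rewrite preimage_setT FE.
have Pint : (pushforward leb polar).-integrable setT F.
  exact: (integrable_pushforward measurable_polar mF Fint).
have Rint : (radial_measure \x usphere_measure).-integrable setT F.
  apply/integrableP; split => //.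
  move/integrableP : Pint => [_]; apply: le_lt_trans.
  rewrite le_eqVlt; apply/orP; left; apply/eqP.
  exact/esym/eq_integral_polar_product.
transitivity (\int[pushforward leb polar]_z F z).
  by rewrite (integral_pushforward measurable_polar mF Fint)// preimage_setT FE.
rewrite eq_integral_polar_product.
rewrite -(integral12_prod_meas1 Rint).
have iF := integrable_fubini_F Rint.
transitivity (\int[pushforward leb radius]_s \int[sigma]_w F (s, w)); first by [].
have mFF := measurable_fubini_F Rint.
rewrite (integral_pushforward measurable_radius mFF)//.
apply/integrableP; split; first by apply: measurable_funTS; apply: measurableT_comp => //; exact: measurable_radius.
move/integrableP : iF => [_]; apply: le_lt_trans.
rewrite [leRHS](_ : _ = \int[pushforward leb radius]_s `|fubini_F usphere_measure F s|)//.
rewrite (ge0_integral_pushforward measurable_radius)//; last first.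
  by apply: measurable_funTS; exact: measurableT_comp.
Qed.

Hypothesis N0 : (0 < N)%N.

(** The radial part of Lebesgue measure has a density, hence is absolutely
    continuous. *)
Lemma radial_measure_abscont (A : set (measurableTypeR R)) : measurable A ->
  leb1 A = 0 -> leb (@enorm R N @^-1` A) = 0.
Proof.
move=> mA A0.
pose V := fine (leb (@unit_ball R N)).
have V0 : (0 < V)%R := V_gt0.
pose g (s : R) : R := (if 0 <= s then V * N%:R * s ^+ N.-1 else 0)%R.
have mg : measurable_fun [set: R] g.
  apply: measurable_fun_if => //.
    by apply: measurable_fun_ler.
  apply: measurable_funTS; apply: measurable_funM => //; exact: measurable_funX.
have g0 s : (0 <= (g s)%:E).
  by rewrite lee_fin /g; case: ifPn => // s0; rewrite !mulr_ge0 ?exprn_ge0// ltW.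
pose gm : set (measurableTypeR R) -> \bar R := fun B => \int[leb1]_(s in B) (g s)%:E.
have gm0 : gm set0 = 0 by rewrite /gm integral_set0.
have gm_ge0 B : 0 <= gm B by apply: integral_ge0 => s _.
have gm_sa : semi_sigma_additive gm.
  by apply: semi_sigma_additive_nng_induced => //; exact/measurable_EFinP.
pose gM : {measure set (measurableTypeR R) -> \bar R} := HB.pack gm
  (isMeasure.Build _ _ _ gm gm0 gm_ge0 gm_sa).
have -> : leb (@enorm R N @^-1` A) = gM A.
  apply: (@eq_measure_rays R radial_measure gM) => //; last first.
    move=> x; rewrite /radial_measure /pushforward /= [X in X < _](ball_open_ray x).
    by rewrite ltry.
  move=> x; rewrite [LHS](ball_open_ray x) -/V /gM /= /gm.
  have [x0|x0] := ltP 0%R x; last first.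
    rewrite mulr0n mul0r integral0_eq// => s; rewrite /= in_itv/= => sx.
    by rewrite /g leNgt (lt_le_trans sx x0).
  rewrite mulr1n.
  have -> : `]-oo, x[%classic = `]-oo, 0%R[%classic `|` `[0%R, x[%classic :> set R.
    apply/seteqP; split => s /=; rewrite !in_itv/=.
      by move=> sx; case: (ltP s 0%R) => s0; [left|right].
    by move=> [s0|/andP[_]//]; exact: lt_trans x0.
  rewrite ge0_integral_setU//=; last 2 first.
  - by apply/measurable_EFinP; exact: measurable_funTS.
  - rewrite disj_set2E; apply/eqP/seteqP; split => // s [] /=; rewrite !in_itv/=.
    by move=> s0 /andP[]; rewrite leNgt s0.
  rewrite integral0_eq ?add0e; last first.
    by move=> s; rewrite /= in_itv/= => s0; rewrite /g leNgt s0.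
  rewrite integral_itv_bndo_bndc; last first.
    by apply/measurable_EFinP; exact: measurable_funTS.
  pose F (s : R) := (V * s ^+ N)%R.
  transitivity (\int[leb1]_(s in `[0%R, x]) (V * N%:R * s ^+ N.-1)%:E); last first.
    by apply: eq_integral => s; rewrite inE/= in_itv/= => /andP[s0 _]; rewrite /g s0.
  transitivity (F x - F 0)%:E; last first.
    apply/esym; apply: (@FTC2_segment R (fun s => V * N%:R * s ^+ N.-1)%R F) => //.
    - move=> s _; apply: cvgM; [exact: cvg_cst|exact: exprn_continuous].
    - move=> s _; rewrite /F.
      have -> : (fun s : R => V * s ^+ N)%R = V \*: (@GRing.exp R ^~ N) by [].
      have h := @is_deriveX R R id N s 1%R 1%R (is_derive_id _ _).
      have e : ((@id R) ^+ N)%R = (@GRing.exp R ^~ N).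
        by apply/funext => y; rewrite exprfctE.
      rewrite e in h; apply: is_derive_eq; rewrite /GRing.scale/=; ring.
  by rewrite /F expr0n; case: (N) N0 => // k _; rewrite mulr0 subr0 mulrC.
apply: null_set_integral => //.
  by apply/measurable_EFinP; exact: measurable_funTS.
Qed.

End polar_integration.

(** * Homogeneous polynomials on the sphere *)

Section finite_differences.
Context {R : realFieldType}.

(** A forward difference lowers the degree. *)
Lemma finite_difference_eq0 (n : nat) (p : {poly R}) (x : R) : (size p <= n)%N ->
  \sum_(i < n.+1) (-1) ^+ i * 'C(n, i)%:R * p.[x + i%:R] = 0.
Proof.
elim: n p => [|n IH] p sp.
  have -> : p = 0 by apply/eqP; rewrite -size_poly_leq0.
  by rewrite big_ord1 horner0 mulr0.
pose q : {poly R} := \sum_(i < n) p^`N(i.+1).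
have qE y : q.[y] = p.[y + 1] - p.[y].
  rewrite (nderiv_taylor_wide (n := n.+1)) //; last exact: mulrC.
  rewrite big_ord_recl /= nderivn0 expr0 mulr1 addrAC subrr add0r.
  by rewrite horner_sum; apply: eq_bigr => i _; rewrite expr1n mulr1.
have sq : (size q <= n)%N.
  apply: (leq_trans (size_sum _ _ _)); apply/bigmax_leqP => i _.
  apply: (leq_trans (size_poly _ _)).
  by rewrite leq_subLR (leq_trans sp)// addSn ltnS leq_addl.
rewrite big_ord_recl /= bin0 expr0 !mul1r addr0.
have E : \sum_(i < n.+1) (-1) ^+ i.+1 * 'C(n.+1, i.+1)%:R * p.[x + i.+1%:R] =
   \sum_(i < n.+1) (-1) ^+ i.+1 * 'C(n, i.+1)%:R * p.[x + i.+1%:R] -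
   \sum_(i < n.+1) (-1) ^+ i * 'C(n, i)%:R * p.[x + i%:R + 1].
  rewrite -sumrB; apply: eq_bigr => i _; rewrite binS natrD -addrA natr1 exprS.
  ring.
rewrite /bump /= E.
rewrite big_ord_recr /= bin_small// mulr0 mul0r addr0 addrA.
have -> : p.[x] + \sum_(i < n) (-1) ^+ i.+1 * 'C(n, i.+1)%:R * p.[x + i.+1%:R] =
   \sum_(i < n.+1) (-1) ^+ i * 'C(n, i)%:R * p.[x + i%:R].
  by rewrite big_ord_recl /= bin0 expr0 !mul1r addr0.
transitivity (- \sum_(i < n.+1) (-1) ^+ i * 'C(n, i)%:R * q.[x + i%:R]).
  by rewrite -sumrB -sumrN; apply: eq_bigr => i _; rewrite qE; ring.
by rewrite (IH q sq) oppr0.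
Qed.

(** A vanishing difference of order [n] is solved for its value at [0]. *)
Lemma norm_horner_le_finite_difference (n : nat) (p : {poly R}) : (size p <= n)%N ->
  `|p.[0]| <= 2 ^+ n * \sum_(i < n) `|p.[i.+1%:R]|.
Proof.
move=> sp; have := finite_difference_eq0 0 sp.
rewrite big_ord_recl /= bin0 expr0 !mul1r add0r => /eqP; rewrite addr_eq0 => /eqP ->.
rewrite normrN (le_trans (ler_norm_sum _ _ _))// mulr_sumr ler_sum// => i _.
rewrite add0r !normrM normrX normrN1 expr1n mul1r ger0_norm// ler_wpM2r//.
rewrite -natrX ler_nat -[X in (_ <= X ^ _)%N]/(1 + 1)%N expnDn.
have hi : (i.+1 < n.+1)%N by rewrite ltnS.
by rewrite (bigD1 (Ordinal hi))//= !exp1n !muln1 leq_addr.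
Qed.

End finite_differences.

Section polynomial_functions.
Context {R : realType} {N : nat}.
Implicit Types (q : mpoly.mpoly N R) (x h : N.-tuple R).
Notation leb := (lebesgueN R N).
Notation sigma := (@sphere_measure R N).

Definition pfun q x : R := mpoly.meval (tnth x) q.

Lemma pfunE q x : pfun q x =
  \sum_(m <- mpoly.msupp q) mpoly.mcoeff m q * \prod_(i < N) tnth x i ^+ m i.
Proof. exact: mpoly.mevalE. Qed.

Lemma pfunM q q' x : pfun (q * q') x = pfun q x * pfun q' x.
Proof. exact: mpoly.mevalM. Qed.

Lemma measurable_pfun q : measurable_fun setT (pfun q).
Proof.
rewrite (_ : pfun q = fun x => \sum_(m <- mpoly.msupp q)
   mpoly.mcoeff m q * \prod_(i < N) tnth x i ^+ m i); last exact/funext/pfunE.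
apply: measurable_sum => m; apply: measurable_funM => //.
apply: measurable_prod => i _; apply: measurable_funX.
exact: measurable_tnth.
Qed.

Lemma pfun_line q x h : exists2 p : {poly R},
  (size p <= (\max_(m <- mpoly.msupp q) mpoly.mdeg m).+1)%N &
  forall s, p.[s] = pfun q (affv s x h).
Proof.
exists (\sum_(m <- mpoly.msupp q) mpoly.mcoeff m q *:
    \prod_(i < N) ((tnth x i)%:P + tnth h i *: 'X) ^+ m i).
  apply: (leq_trans (size_sum _ _ _)); apply/bigmax_leqP_seq => m mq _.
  apply: (leq_trans (size_scale_leq _ _)).
  apply: (@leq_trans (mpoly.mdeg m).+1); last first.
    by rewrite ltnS (leq_bigmax_seq _ mq).
  rewrite mpoly.mdegE; elim/big_ind2: _ => [|p1 k1 p2 k2 h1 h2|i _].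
  - by rewrite size_poly1.
  - apply: (leq_trans (size_polyMleq _ _)).
    by rewrite -subn1 leq_subLR add1n (leq_trans (leq_add h1 h2))// addSn addnS.
  - apply: (leq_trans (size_poly_exp_leq _ _)).
    rewrite ltnS -[leqRHS]mul1n leq_mul2r; apply/orP; right.
    rewrite -subn1 leq_subLR addn1.
    apply: (leq_trans (size_polyD _ _)); rewrite geq_max (leq_trans (size_polyC_leq1 _))//=.
    by rewrite (leq_trans (size_scale_leq _ _))// size_polyX.
move=> s; rewrite pfunE horner_sum; apply: eq_bigr => m _.
rewrite hornerZ horner_prod; congr (_ * _); apply: eq_bigr => i _.
by rewrite horner_exp hornerD hornerC hornerZ hornerX tnth_mktuple addrC mulrC.
Qed.

Definition homog l q := q \is mpoly.ishomog1 l (@mpoly.mdeg N).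

Lemma homog_mdeg l q m : homog l q -> m \in mpoly.msupp q -> mpoly.mdeg m = l.
Proof. by move=> /allP h /h /eqP. Qed.

Lemma pfun_homog l q (a : R) x : homog l q -> pfun q (scalev a x) = a ^+ l * pfun q x.
Proof.
move=> hq; rewrite !pfunE mulr_sumr !big_seq; apply: eq_bigr => m mq.
rewrite mulrCA; congr (_ * _).
under eq_bigr do rewrite tnth_mktuple exprMn.
rewrite big_split /= -(homog_mdeg hq mq) mpoly.mdegE expr_sum//.
Qed.

Lemma norm_pfun_le_line l q x h : homog l q ->
  `|pfun q x| <= 2 ^+ l.+1 * \sum_(i < l.+1) `|pfun q (affv i.+1%:R x h)|.
Proof.
move=> hq; have [p sp pE] := pfun_line q x h.
have sp' : (size p <= l.+1)%N.
  apply: (leq_trans sp); rewrite ltnS; apply/bigmax_leqP_seq => m mq _.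
  by rewrite (homog_mdeg hq mq).
have -> : pfun q x = p.[0].
  rewrite pE; congr pfun; apply: eq_from_tnth => i.
  by rewrite tnth_mktuple mul0r add0r.
rewrite (le_trans (norm_horner_le_finite_difference sp'))// ler_wpM2l ?exprn_ge0//.
by apply: ler_sum => i _; rewrite pE.
Qed.

Local Open Scope ereal_scope.

(** A homogeneous polynomial cannot peak too sharply: averaging the
    vanishing finite differences of order [l.+1] over a small cube of directions
    bounds a value at the sphere by the mean over a ball. *)
Lemma pfun_le_ball l q x : homog l q -> sphere x -> (0 < N)%N ->
  (`|pfun q x|)%:E <= (2 ^+ l.+1 * l.+1%:R ^+ N.+1)%:E *
    \int[leb]_y (`|pfun q y| * \1_[set y | (enorm y <= (2 * N)%:R)%R] y)%:E.
Proof.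
move=> hq x1 N0; set J := \int[leb]_y _.
pose g (y : N.-tuple R) : R := (`|pfun q y| * \1_[set y | (enorm y <= (2 * N)%:R)%R] y)%R.
have mball : measurable [set y : N.-tuple R | (enorm y <= (2 * N)%:R)%R].
  rewrite (_ : [set _ | _] = @enorm R N @^-1` `]-oo, ((2 * N)%:R : R)%R]).
    by apply: measurable_enorm_preimage; exact: measurable_itv.
  by apply/seteqP; split => y /=; rewrite in_itv.
have mg : measurable_fun setT g.
  apply: measurable_funM; first by apply: measurableT_comp => //; exact: measurable_pfun.
  exact: measurable_indic.
have g0 y : (0 <= g y)%R by rewrite mulr_ge0.
(* With the entries of [h] at most [1 / l.+1], the points [x + i h] for [i <= l.+1]
   have entries at most [2], hence norm at most [2 N]. *)
pose d : R := (l.+1%:R^-1)%R.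
have d0 : (0 < d)%R by rewrite invr_gt0.
pose H := [set h : N.-tuple R | forall i, (- d <= tnth h i <= d)%R].
have mH : measurable H by exact: measurable_box.
have HE : leb H = ((2 * d) ^+ N)%:E.
  rewrite lebesgueN_box; last by rewrite (@le_trans _ _ 0%R)// ?oppr_le0 ltW.
  by congr (_ ^+ _)%:E; ring.
have J0 : 0 <= J by apply: integral_ge0 => y _; rewrite lee_fin g0.
have bnd h : H h -> (`|pfun q x| <= 2 ^+ l.+1 * \sum_(i < l.+1) g (affv i.+1%:R x h))%R.
  move=> Hh; apply: le_trans (norm_pfun_le_line x h hq) _.
  rewrite ler_wpM2l ?exprn_ge0//; apply: ler_sum => i _.
  rewrite /g indicE mem_set ?mulr1//=.
  rewrite -(@ler_pXn2r _ 2)// ?nnegrE ?enorm_ge0// sqr_enorm.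
  apply: (@le_trans _ _ (\sum_(j < N) 2 ^+ 2)%R).
    apply: ler_sum => j _; rewrite -real_normK ?num_real// lerXn2r ?nnegrE//.
    rewrite tnth_mktuple (le_trans (ler_normD _ _))//.
    have h2 : (`|tnth h j| <= d)%R by rewrite ler_norml.
    have h3 : (`|tnth x j| <= 1)%R.
      by rewrite -x1; exact: norm_tnth_le.
    have h4 : (i.+1%:R * d <= 1 :> R)%R by rewrite /d ler_pdivrMr// mul1r ler_nat.
    have h5 : (`|i.+1%:R * tnth h j| <= 1 :> R)%R.
      by rewrite normrM ger0_norm// (le_trans _ h4)// ler_wpM2l.
    by lra.
  have -> : (\sum_(j < N) 2 ^+ 2 = (2 ^ 2 * N)%:R :> R)%R.
    by rewrite sumr_const card_ord natrM natrX mulr_natr.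
  rewrite -natrX ler_nat.
  by rewrite expnMn leq_mul2l /=; nia.
have step1 : (`|pfun q x| * (2 * d) ^+ N)%:E <= (2 ^+ l.+1)%:E * (l.+1%:R%:E * J).
  rewrite EFinM -HE -integral_cst//.
  apply: (@le_trans _ _ (\int[leb]_(h in H) ((2 ^+ l.+1)%:E * \sum_(i < l.+1) (g (affv i.+1%:R x h))%:E))).
    apply: ge0_le_integral => //.
    - by move=> h _; rewrite lee_fin.
    - apply: measurable_funTS; apply: measurable_funeM.
      apply: emeasurable_sum => i; apply/measurable_EFinP.
      by apply: (measurableT_comp mg); exact: measurable_affv.
    - by move=> h Hh; rewrite sumEFin -EFinM lee_fin bnd.
  apply: (@le_trans _ _ (\int[leb]_h ((2 ^+ l.+1)%:E * \sum_(i < l.+1) (g (affv i.+1%:R x h))%:E))).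
    apply: ge0_subset_integral => //.
    - apply: measurable_funeM.
      apply: emeasurable_sum => i; apply/measurable_EFinP.
      by apply: (measurableT_comp mg); exact: measurable_affv.
    - by move=> h _; rewrite mule_ge0 ?lee_fin ?exprn_ge0// sume_ge0// => i _; rewrite lee_fin.
  have mga i : measurable_fun setT (fun h => (g (affv i.+1%:R x h))%:E).
    by apply/measurable_EFinP; apply: (measurableT_comp mg); exact: measurable_affv.
  rewrite ge0_integralZl//; last 2 first.
  - by apply: emeasurable_sum => i; exact: mga.
  - by move=> h _; rewrite sume_ge0// => i _; rewrite lee_fin.
  rewrite lee_wpmul2l ?lee_fin ?exprn_ge0//.
  rewrite ge0_integral_sum//; last first.
    by move=> i h _; rewrite lee_fin.
  apply: (@le_trans _ _ (\sum_(i < l.+1) J)); last first.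
    by rewrite sumr_const card_ord -[X in X <= _]mule_natl.
  apply: lee_sum => i _.
  rewrite (@ge0_integral_affv R N i.+1%:R x (fun y => (g y)%:E))//; last first.
    exact/measurable_EFinP.
  rewrite -[leRHS]mul1e lee_wpmul2r// lee_fin invf_le1 ?exprn_gt0//.
  by rewrite exprn_ege1// ler1n.
have c0 : (0 < (2 * d) ^+ N)%R by rewrite exprn_gt0 ?mulr_gt0.
rewrite -(@lee_pmul2r _ ((2 * d) ^+ N)%:E)// ?lte_fin// -EFinM.
apply: le_trans step1 _.
rewrite muleA -EFinM [leRHS]muleAC -EFinM lee_wpmul2r// lee_fin.
rewrite -!mulrA ler_wpM2l ?exprn_ge0// exprMn mulrCA exprS -mulrA -exprMn.
rewrite divff// expr1n mulr1 ler_peMl// -natrX ler1n expn_gt0//.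
Qed.

(** Homogeneity factors the integrand into a radial and an angular part. *)
Lemma pfun_ball_le_sphere l q (r : R) : homog l q -> (0 < r)%R ->
  \int[leb]_y (`|pfun q y| * \1_[set y | (enorm y <= r)%R] y)%:E <=
  (r ^+ (N + l) * fine (leb (@unit_ball R N)))%:E * \int[sigma]_w (`|pfun q w|)%:E.
Proof.
move=> hq r0.
pose f (s : R) : R := (`|s| ^+ l * \1_`]-oo, r]%classic s)%R.
have fE y : (`|pfun q y| * \1_[set y | (enorm y <= r)%R] y = f (enorm y) * `|pfun q (dir y)|)%R.
  rewrite /f (ger0_norm (enorm_ge0 y)) -{1}(scalev_enorm_dir y) (pfun_homog _ _ hq).
  rewrite normrM normrX (ger0_norm (enorm_ge0 y)) !indicE mulrAC.
  have -> : (y \in [set y0 | (enorm y0 <= r)%R]) = (enorm y \in `]-oo, r]%classic).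
    by apply/idP/idP => /set_mem h; apply/mem_set; move: h; rewrite /= in_itv.
  by [].
under eq_integral do rewrite fE.
have mf : measurable_fun setT f.
  apply: measurable_funM; last exact: measurable_indic.
  by apply: measurable_funX; exact: normr_measurable.
rewrite (@ge0_integral_radial_angular R N f (fun w => `|pfun q w|%R))//; last 2 first.
- by apply: measurableT_comp => //; exact: measurable_pfun.
- by move=> s; rewrite mulr_ge0 ?exprn_ge0.
rewrite lee_wpmul2r//; first by apply: integral_ge0 => w _; rewrite lee_fin.
have mS : measurable (@enorm R N @^-1` `]-oo, r]).
  by apply: measurable_enorm_preimage; exact: measurable_itv.
have -> : (r ^+ (N + l) * fine (leb (@unit_ball R N)))%:E =
    \int[leb]_y ((r ^+ l)%:E * (\1_(@enorm R N @^-1` `]-oo, r]) y)%:E).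
  rewrite ge0_integralZl//; last 2 first.
  - by apply/measurable_EFinP; exact: measurable_indic.
  - by rewrite lee_fin exprn_ge0// ltW.
  rewrite integral_indic// setIT.
  have H1 : leb (@enorm R N @^-1` `]-oo, r]) = (r ^+ N * fine (leb (@unit_ball R N)))%:E.
    have := @cone_dilation R N false setT r r0 measurableT.
    rewrite preimage_setT !setIT => H2; apply: (etrans H2).
    by rewrite EFinM V_EFin; congr (_ * leb _).
  transitivity ((r ^+ l)%:E * (r ^+ N * fine (leb (@unit_ball R N)))%:E).
    by rewrite -EFinM exprD; congr EFin; ring.
  by congr (_ * _); exact/esym/H1.
apply: ge0_le_integral => //.
- by move=> y _; rewrite lee_fin mulr_ge0 ?exprn_ge0.
- apply/measurable_EFinP; apply: (measurableT_comp mf); exact: measurable_enorm.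
- apply: measurable_funeM; apply/measurable_EFinP; exact: measurable_indic.
- move=> y _; rewrite -EFinM lee_fin /f !indicE.
  rewrite (_ : (enorm y \in `]-oo, r]%classic) = (y \in (@enorm R N @^-1` `]-oo, r]))); last first.
    by apply/idP/idP; rewrite !inE.
  case: (boolP (y \in _)) => [|_]; last by rewrite !mulr0.
  rewrite inE /= in_itv /= => yr; rewrite !mulr1 ger0_norm ?enorm_ge0//.
  by rewrite lerXn2r// ?nnegrE ?enorm_ge0// ltW.
Qed.

(** The constant must be geometric in the degree: it competes with
    [1 / Gamma (nu_l + 1)] and with the freedom of [A] in [radial_constant_ge]. *)
Lemma pfun_sup_sphere : (0 < N)%N -> exists2 B : R, (1 <= B)%R &
  forall l q w, homog l q -> sphere w ->
  (`|pfun q w|)%:E <= (B ^+ l.+1)%:E * \int[sigma]_w (`|pfun q w|)%:E.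
Proof.
move=> N0; pose V := fine (leb (@unit_ball R N)).
have V0 : (0 <= V)%R by rewrite fine_ge0.
pose M : R := ((2 * N)%:R)%R.
have M1 : (1 <= M)%R by rewrite ler1n muln_gt0.
(* [2 ^+ N.+1] absorbs [l.+1 ^+ N.+1], because [l.+1 <= 2 ^ l.+1]. *)
exists (2 * 2 ^+ N.+1 * M ^+ N * (1 + V))%R.
  rewrite -[X in (X <= _)%R]mulr1 ler_pM ?lerDl//.
  rewrite -[X in (X <= _)%R]mulr1 ler_pM ?exprn_ege1//.
  by rewrite -exprS exprn_ege1// ler1n.
move=> l q w hq w1; apply: (le_trans (pfun_le_ball hq w1 N0)).
have M0 : (0 < M)%R by exact: lt_le_trans M1.
apply: (@le_trans _ _ ((2 ^+ l.+1 * l.+1%:R ^+ N.+1)%:E *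
  ((M ^+ (N + l) * V)%:E * \int[sigma]_w (`|pfun q w|)%:E))).
  rewrite lee_wpmul2l ?lee_fin ?mulr_ge0 ?exprn_ge0//.
  exact: pfun_ball_le_sphere.
rewrite muleA -EFinM lee_wpmul2r//; first by apply: integral_ge0 => y _; rewrite lee_fin.
rewrite lee_fin !exprMn -!mulrA ler_wpM2l ?exprn_ge0//.
apply: ler_pM; rewrite ?mulr_ge0 ?exprn_ge0 ?(ltW M0)//.
  rewrite -exprM mulnC exprM lerXn2r ?nnegrE ?exprn_ge0//.
  by rewrite -natrX ler_nat ltnW// ltn_expl.
apply: ler_pM; rewrite ?exprn_ge0 ?(ltW M0)//.
  rewrite -exprM ler_weXn2l//.
  rewrite mulnS leq_add2l -[X in (X <= _)%N]mul1n leq_mul2r N0 orbT//.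
apply: (@le_trans _ _ (1 + V)%R); first by rewrite lerDr.
by rewrite ler_eXnr// lerDl.
Qed.

End polynomial_functions.

(** * Gaussian moments and the sphere measure *)

Section gaussian_moments.
Context {R : realType}.
Notation leb1 := (@lebesgue_measure R).

(** The exponent [2 x^2] leaves a factor [exp (- x^2)] after absorbing the power. *)
Definition gmono (k : nat) (x : R) : R := x ^+ k * expR (- (2 * x ^+ 2)).

Lemma gmono_le (k : nat) (x c : R) : `|x| - 2 * x ^+ 2 <= c ->
  `|gmono k x| <= k`!%:R * expR c.
Proof.
move=> h; rewrite normrM (ger0_norm (expR_ge0 _)) normrX.
apply: (@le_trans _ _ (k`!%:R * expR `|x| * expR (- (2 * x ^+ 2)))).
  by rewrite ler_wpM2r ?expR_ge0// exprn_le_fact_expR.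
by rewrite -mulrA -expRD ler_wpM2l// ler_expR.
Qed.

Lemma continuous_gmono k : continuous (gmono k).
Proof.
move=> x; apply: cvgM; first exact: exprn_continuous.
apply: continuous_comp; last exact: continuous_expR.
by apply: cvgN; apply: cvgM; [exact: cvg_cst|exact: exprn_continuous].
Qed.

Lemma integrable_gmono k : leb1.-integrable setT (EFin \o gmono k).
Proof.
have ig := @integrableZl _ _ R leb1 setT measurableT (k`!%:R * expR 4^-1) _ (@integrableT_gauss R).
apply: le_integrable ig => //.
  by apply/measurable_EFinP; apply: continuous_measurable_fun; exact: continuous_gmono.
move=> x _ /=; rewrite lee_fin [leRHS]ger0_norm ?mulr_ge0 ?expR_ge0 ?gauss_fun_ge0//.
rewrite /gauss_fun -mulrA -expRD; apply: gmono_le.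
have : 0 <= (`|x| - 2^-1) ^+ 2 by rewrite sqr_ge0.
have : `|x| ^+ 2 = x ^+ 2 by rewrite real_normK// num_real.
by move: (`|x|) (x ^+ 2) => y z <-; nra.
Qed.

Definition gmoment (k : nat) : R := \int[leb1]_x gmono k x.

Lemma gmoment_EFin k : (\int[leb1]_x (gmono k x)%:E)%E = (gmoment k)%:E.
Proof. by rewrite /gmoment /Rintegral fineK// integrable_fin_num//; exact: integrable_gmono. Qed.

Lemma gmono_tail k (u : nat -> R) : (forall j, `|u j| = j.+1%:R) ->
  gmono k (u j) @[j --> \oo] --> (0 : R).
Proof.
move=> uE; apply/norm_cvg0P.
apply: (@squeeze_cvgr _ _ _ _ (fun=> 0) (fun j : nat => k`!%:R * expR 1 * expR (- j.+1%:R))).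
- near=> j; rewrite normr_ge0 /= -mulrA -expRD; apply: gmono_le.
  have := real_normK (num_real (u j)); rewrite uE => <-.
  have : 0 <= (j.+1%:R - 1 : R) ^+ 2 by rewrite sqr_ge0.
  have : 0 <= (j.+1%:R : R) ^+ 2 by rewrite sqr_ge0.
  by move: (j.+1%:R : R) => y; nra.
- exact: cvg_cst.
- rewrite -[X in _ --> X](mulr0 (k`!%:R * expR 1)); apply: cvgM; first exact: cvg_cst.
  by have := @cvgn_expR R; rewrite -cvg_shiftS.
Unshelve. all: by end_near. Qed.

Lemma is_derive_gmono k (x : R) :
  is_derive x (1 : R) (gmono k) (k%:R * gmono k.-1 x - 4 * gmono k.+1 x).
Proof.
have h := @is_deriveX R R id k x 1 1 (is_derive_id _ _).
have e : (@id R) ^+ k = (@GRing.exp R ^~ k) by apply/funext => y; rewrite exprfctE.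
rewrite e in h.
have h2 := @is_deriveX R R id 2 x 1 1 (is_derive_id _ _).
have e2 : (@id R) ^+ 2 = (@GRing.exp R ^~ 2%N) by apply/funext => y; rewrite exprfctE.
rewrite e2 in h2.
rewrite /gmono; apply: is_derive_eq.
set E := expR _.
transitivity (x ^+ k * (E * - (2 * (2 * x * 1))) + E * (k%:R * x ^+ k.-1 * 1)); first by [].
by rewrite [x ^+ k.+1]exprS; ring.
Qed.

(** Integrating the derivative of [x ^+ k * exp (- 2 x^2)] over the line. *)
Lemma gmoment_rec k : k%:R * gmoment k.-1 = 4 * gmoment k.+1.
Proof.
pose f x := k%:R * gmono k.-1 x - 4 * gmono k.+1 x.
have i1 := @integrableZl _ _ R leb1 setT measurableT k%:R _ (integrable_gmono k.-1).
have i2 := @integrableZl _ _ R leb1 setT measurableT 4 _ (integrable_gmono k.+1).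
have fint : leb1.-integrable setT (EFin \o f).
  rewrite (_ : EFin \o f = (fun x => k%:R%:E * (EFin \o gmono k.-1) x) \-
     (fun x => 4%:E * (EFin \o gmono k.+1) x))%E; last by apply/funext.
  exact: integrableB.
have : (\int[leb1]_(x in setT) (f x)%:E)%E = (0 - 0)%:E.
  apply: (@FTC2_exhaust R setT f (gmono k) (fun j => - j.+1%:R) (fun j => j.+1%:R)) => //.
  - by move=> j; rewrite (@lt_trans _ _ 0)// oppr_lt0.
  - move=> x _; near=> j; rewrite -ler_norml (le_trans (ltW (truncnS_gt _)))// ler_nat.
    by rewrite ltnS; near: j; exact: nbhs_infty_ge.
  - move=> x _; apply: cvgB; (apply: cvgM; first exact: cvg_cst); exact: continuous_gmono.
  - by move=> x _; exact: is_derive_gmono.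
  - by apply: gmono_tail => j; rewrite normrN ger0_norm.
  - by apply: gmono_tail => j; rewrite ger0_norm.
rewrite /f subrr; under eq_integral do rewrite EFinB !EFinM.
rewrite integralB// !integralZl//; try exact: integrable_gmono.
rewrite !gmoment_EFin -!EFinM -EFinB => -[] /eqP; rewrite subr_eq0 => /eqP.
by [].
Unshelve. all: by end_near. Qed.

End gaussian_moments.

Section product_integrals.
Context {R : realType}.
Notation leb1 := (@lebesgue_measure R).
Local Open Scope ereal_scope.

Lemma integrable_prod n (f : 'I_n -> R -> R) :
  (forall i, leb1.-integrable setT (EFin \o f i)) ->
  (lebesgueN R n).-integrable setT (fun x => (\prod_(i < n) f i (tnth x i))%:E) /\
  \int[lebesgueN R n]_x (\prod_(i < n) f i (tnth x i))%:E =
  (\prod_(i < n) \int[leb1]_s f i s)%:E.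
Proof.
elim: n f => [|n IH] f fint.
  have e : (fun x : 0.-tuple R => (\prod_(i < 0) f i (tnth x i))%:E) = cst 1.
    by apply/funext => x; rewrite big_ord0.
  rewrite e big_ord0; split; last by rewrite integral_lebesgueN0.
  by apply/integrableP; split => //; rewrite integral_lebesgueN0//= normr1 ltry.
have [IH1 IH2] := IH (fun i => f (lift ord0 i)) (fun i => fint (lift ord0 i)).
pose G (x : n.-tuple R) := (\prod_(i < n) f (lift ord0 i) (tnth x i))%:E.
rewrite -/G in IH1; set c := (\prod_(i < n) _)%R in IH2.
have {}IH2 : \int[lebesgueN R n]_x G x = c%:E by exact: IH2.
have mf0 := measurable_int _ (fint ord0).
have mG := measurable_int _ IH1.
pose F (z : measurableTypeR R * n.-tuple R) : \bar R := (f ord0 z.1)%:E * G z.2.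
have mF : measurable_fun setT F.
  by apply: emeasurable_funM; [exact: (measurableT_comp mf0)|exact: (measurableT_comp mG)].
have cE : (fun x : n.+1.-tuple R => (\prod_(i < n.+1) f i (tnth x i))%:E) \o @cons_point R n = F.
  apply/funext => -[s v]; rewrite /F /G /= -EFinM; congr EFin.
  rewrite big_ord_recl tnth0; congr (_ * _)%R; apply: eq_bigr => i _.
  by rewrite tnthS.
have FE s v : F (s, v) = (f ord0 s)%:E * G v by [].
clearbody G; clearbody F.
have Fint : (leb1 \x lebesgueN R n).-integrable setT F.
  apply/integrable12ltyP => //.
  under eq_integral => s _.
    under eq_integral do rewrite FE abseM.
    rewrite ge0_integralZl//; last exact: measurableT_comp.
    over.
  rewrite /= ge0_integralZr//; last 2 first.
  - apply/measurable_EFinP; apply: measurableT_comp => //; exact/measurable_EFinP.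
  - exact: integral_ge0.
  apply: lte_mul_pinfty.
  - exact: integral_ge0.
  - have /integrableP[_ h] := fint ord0.
    by rewrite ge0_fin_numE//; exact: integral_ge0.
  - by have /integrableP[_ h] := IH1.
have mP : measurable_fun setT (fun x : n.+1.-tuple R => (\prod_(i < n.+1) f i (tnth x i))%:E).
  apply/measurable_EFinP; apply: measurable_prod => i _.
  apply: (measurableT_comp _ (measurable_tnth i)).
  by have := measurable_int _ (fint i); move/measurable_EFinP.
have Fint' : (leb1 \x lebesgueN R n).-integrable (@cons_point R n @^-1` setT)
    ((fun x : n.+1.-tuple R => (\prod_(i < n.+1) f i (tnth x i))%:E) \o @cons_point R n).
  by rewrite preimage_setT cE.
split.
  exact: (integrable_pushforward (@measurable_cons_point R n) mP Fint').
transitivity (\int[pushforward (leb1 \x lebesgueN R n) (@cons_point R n)]_x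
   (\prod_(i < n.+1) f i (tnth x i))%:E); first by [].
rewrite (integral_pushforward (@measurable_cons_point R n) mP Fint')// preimage_setT cE.
rewrite -(integral12_prod_meas1 Fint) /fubini_F.
under eq_integral => s _.
  under eq_integral do rewrite FE.
  rewrite integralZl// IH2.
  over.
transitivity (\int[leb1]_s ((EFin \o f ord0) s * c%:E)); first by [].
rewrite (integralZr measurableT (fint ord0)).
transitivity ((\int[leb1]_s f ord0 s)%:E * c%:E).
  congr (_ * _); rewrite /Rintegral fineK//.
  exact: (integrable_fin_num measurableT (fint ord0)).
by rewrite -EFinM big_ord_recl.
Qed.

End product_integrals.

Section sphere_integrals.
Context {R : realType} {N : nat}.
Notation leb := (lebesgueN R N).
Notation sigma := (@sphere_measure R N).
Local Open Scope ereal_scope.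
Hypothesis N0 : (0 < N)%N.

Lemma enorm_eq0_null : leb [set x | enorm x = 0%R] = 0.
Proof.
rewrite (_ : [set x | _] = @enorm R N @^-1` [set 0%R])//.
by apply: radial_measure_abscont => //; rewrite lebesgue_measure_set1.
Qed.

Lemma ae_enorm_neq0 : {ae leb, forall x : N.-tuple R, (enorm x != 0)%R}.
Proof.
exists [set x : N.-tuple R | enorm x = 0%R]; split.
- rewrite (_ : [set x | _] = @enorm R N @^-1` [set 0%R])//.
  by apply: measurable_enorm_preimage.
- exact: enorm_eq0_null.
- by move=> x /= /negP; rewrite negbK => /eqP.
Qed.

Lemma sphere_measureC : sigma (~` @sphere R N) = 0.
Proof.
rewrite sphere_measureE cone_measureE [X in _ * X](_ : _ = 0) ?mule0//.
apply/eqP; rewrite eq_le measure_ge0 andbT -enorm_eq0_null.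
apply: le_measure; rewrite ?inE.
- apply: measurableI; first by apply: measurable_enorm_preimage; exact: measurable_itv.
  by apply: measurable_dir_preimage; apply: measurableC; exact: measurable_sphere.
- rewrite (_ : [set x | _] = @enorm R N @^-1` [set 0%R])//.
  by apply: measurable_enorm_preimage.
- move=> x [_ /=]; rewrite /sphere /= => h.
  by apply: contra_notP h => /eqP; exact: enorm_dir.
Qed.

Lemma ae_sphere : {ae sigma, forall w, sphere w}.
Proof.
exists (~` @sphere R N); split => //.
  by apply: measurableC; exact: measurable_sphere.
exact: sphere_measureC.
Qed.

Lemma eq_integral_sphere (f g : N.-tuple R -> \bar R) :
  measurable_fun setT f -> measurable_fun setT g ->
  (forall w, sphere w -> f w = g w) ->
  \int[sigma]_w f w = \int[sigma]_w g w.
Proof.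
move=> mf mg fg; apply: ae_eq_integral => //.
by apply: filterS ae_sphere => w /fg h _.
Qed.

Lemma integral_in_sphere (f : N.-tuple R -> \bar R) : measurable_fun setT f ->
  \int[sigma]_(w in @sphere R N) f w = \int[sigma]_w f w.
Proof.
move=> mf; rewrite integral_mkcond; apply: eq_integral_sphere => //.
  apply/(measurable_restrictT _ _).1; first exact: measurable_sphere.
  exact: measurable_funTS.
by move=> w hw; rewrite patchE mem_set.
Qed.

Lemma integrable_sphere (f : N.-tuple R -> R) (K : R) : measurable_fun setT f ->
  (forall w, sphere w -> (`|f w| <= K)%R) -> sigma.-integrable setT (EFin \o f).
Proof.
move=> mf fK; apply/integrableP; split; first exact/measurable_EFinP.
rewrite -integral_in_sphere; last first.
  by apply: measurableT_comp => //; exact/measurable_EFinP.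
apply: (@le_lt_trans _ _ (\int[sigma]_(w in @sphere R N) (cst K%:E w))).
  apply: ge0_le_integral => //=.
  - exact: measurable_sphere.
  - by apply/measurable_EFinP; apply: measurableT_comp => //; exact: measurable_funTS.
rewrite integral_cst//=; last exact: measurable_sphere.
have s1 : (sigma (@sphere R N) < +oo).
  apply: (@le_lt_trans _ _ (sigma setT)); last by rewrite [X in X < _]sphere_measureT ltry.
  by apply: le_measure; rewrite ?inE//; exact: measurable_sphere.
have sf : sigma (@sphere R N) \is a fin_num by rewrite ge0_fin_numE.
by rewrite -(fineK sf) -EFinM ltry.
Qed.

End sphere_integrals.

(** * Orthogonality of spherical harmonics of different degrees *)

Section gaussian_functional.
Context {R : realType} {N : nat}.
Implicit Types (q p : mpoly.mpoly N R) (x : N.-tuple R).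
Notation leb := (lebesgueN R N).
Notation sigma := (@sphere_measure R N).
Notation X_ m := (mpoly.mpolyX R m).

Definition gweight x : R := expR (- (2 * enorm x ^+ 2)).

Lemma measurable_gweight : measurable_fun setT gweight.
Proof.
apply: measurableT_comp; first exact: measurable_expR.
apply: measurableT_comp => //; apply: measurable_funM => //.
by apply: measurable_funX; exact: measurable_enorm.
Qed.

Lemma pfunX_gweight (m : mpoly.multinom N) x :
  pfun (X_ m) x * gweight x = \prod_(i < N) gmono (m i) (tnth x i).
Proof.
rewrite /pfun mpoly.mevalX /gweight sqr_enorm mulr_sumr -sumrN expR_sum.
by rewrite -big_split.
Qed.

Lemma pfunZD (c : R) p q x : pfun (c *: p + q) x = c * pfun p x + pfun q x.
Proof. by rewrite /pfun mpoly.mevalD mpoly.mevalZ. Qed.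

Lemma integrable_pfun_gweight q :
  leb.-integrable setT (fun x => (pfun q x * gweight x)%:E).
Proof.
elim/mpoly.mpolyind: q => [|c m p _ _ IH].
  rewrite (_ : (fun x => _) = cst 0%E); first exact: integrable0.
  by apply/funext => x; rewrite /pfun mpoly.meval0 mul0r.
rewrite (_ : (fun x => _) = (fun x => c%:E * (pfun (X_ m) x * gweight x)%:E) \+
    (fun x => (pfun p x * gweight x)%:E))%E; last first.
  by apply/funext => x; rewrite pfunZD mulrDl -mulrA.
apply: integrableD => //; apply: integrableZl => //.
under eq_fun do rewrite pfunX_gweight.
have [h _] := @integrable_prod R N (fun i => gmono (m i)) (fun i => integrable_gmono (m i)).
exact: h.
Qed.

Definition gint q : R := \int[leb]_x (pfun q x * gweight x).

Lemma gint_linear (c : R) p q : gint (c *: p + q) = c * gint p + gint q.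
Proof.
rewrite /gint; under eq_Rintegral do rewrite pfunZD mulrDl -mulrA.
rewrite RintegralD//; last 2 first.
- have := integrableZl measurableT c (integrable_pfun_gweight p).
  by [].
- exact: integrable_pfun_gweight.
by rewrite RintegralZl//; exact: integrable_pfun_gweight.
Qed.

Lemma gint0 : gint 0 = 0.
Proof.
have := gint_linear 1 0 0; rewrite scale1r addr0 mul1r => /eqP.
by rewrite -subr_eq0 opprD addNKr oppr_eq0 => /eqP.
Qed.

Lemma gintZ c q : gint (c *: q) = c * gint q.
Proof. by have := gint_linear c q 0; rewrite addr0 gint0 addr0. Qed.

Lemma gintD p q : gint (p + q) = gint p + gint q.
Proof. by have := gint_linear 1 p q; rewrite scale1r mul1r. Qed.

Lemma gint_sum (I : Type) (r : seq I) (F : I -> mpoly.mpoly N R) :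
  gint (\sum_(i <- r) F i) = \sum_(i <- r) gint (F i).
Proof. by apply: (big_morph gint); [exact: gintD|exact: gint0]. Qed.

Lemma gintX (m : mpoly.multinom N) : gint (X_ m) = \prod_(i < N) gmoment (m i).
Proof.
rewrite /gint /Rintegral; under eq_integral do rewrite pfunX_gweight.
have [_ ->] := @integrable_prod R N (fun i => gmono (m i)) (fun i => integrable_gmono (m i)).
by [].
Qed.

(** Integration by parts against the Gaussian weight, checked on monomials. *)
Lemma gint_deriv (i : 'I_N) q : gint (mpoly.mderiv i q) = 4 * gint (X_ (mpoly.mnm1 i) * q).
Proof.
elim/mpoly.mpolyind: q => [|c m p _ _ IH].
  by rewrite mpoly.mderiv0 mulr0 !gint0 mulr0.
rewrite mpoly.mderivD mpoly.mderivZ mulrDr -scalerAr !gint_linear IH mulrDr.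
congr (_ + _); rewrite mulrCA; congr (c * _).
rewrite mpoly.mderivX gintZ -mpoly.mpolyXD !gintX (bigD1 i)//= [in RHS](bigD1 i)//=.
rewrite mpoly.mnmBE mpoly.mnmDE !mpoly.mnm1E eqxx /= subn1 add1n.
rewrite [LHS]mulrA gmoment_rec -mulrA.
congr (4 * (_ * _)); apply: eq_bigr => j ji.
by rewrite mpoly.mnmBE mpoly.mnmDE !mpoly.mnm1E eq_sym (negbTE ji) subn0 add0n.
Qed.

Lemma euler_identity l q : homog l q ->
  \sum_(i < N) X_ (mpoly.mnm1 i) * mpoly.mderiv i q = l%:R *: q.
Proof.
move=> hq; rewrite [in RHS](mpoly.mpolyE q) scaler_sumr.
transitivity (\sum_(i < N) \sum_(m <- mpoly.msupp q)
   (mpoly.mcoeff m q * (m i)%:R) *: X_ m).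
  apply: eq_bigr => i _; rewrite /mpoly.mderiv mulr_sumr; apply: eq_bigr => m _.
  rewrite -scalerAr -mpoly.mpolyXD [(m i)%:R * _]mulrC.
  have [mi0|mi0] := posnP (m i); first by rewrite mi0 mulr0 !scale0r.
  congr (_ *: X_ _); apply/mpoly.mnmP => j.
  rewrite mpoly.mnmDE mpoly.mnmBE mpoly.mnm1E.
  by case: eqP => [<-|_]; [rewrite add1n subn1 prednK|rewrite subn0].
rewrite exchange_big /= !big_seq; apply: eq_bigr => m mq.
rewrite -scaler_suml -mulr_sumr -natr_sum -mpoly.mdegE (homog_mdeg hq mq).
by rewrite scalerA mulrC.
Qed.

(** Green's identity in Gaussian space: the field [p grad q - q grad p] is
    divergence free when [p] and [q] are harmonic, and its radial component is
    proportional to [p q] by Euler's identity. *)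
Lemma gint_orthogonal l l' p q : homog l p -> homog l' q ->
  laplacian p = 0 -> laplacian q = 0 -> l != l' -> gint (p * q) = 0.
Proof.
move=> hp hq Lp Lq ll'.
pose F i := p * mpoly.mderiv i q - q * mpoly.mderiv i p.
have divF : \sum_(i < N) mpoly.mderiv i (F i) = 0.
  transitivity (p * laplacian q - q * laplacian p); last by rewrite Lp Lq !mulr0 subr0.
  rewrite /laplacian !mulr_sumr -sumrB; apply: eq_bigr => i _.
  rewrite /F mpoly.mderivB !mpoly.mderivM.
  set a := mpoly.mderiv i p; set b := mpoly.mderiv i q.
  by rewrite [b * a]mulrC; ring.
have : gint (\sum_(i < N) mpoly.mderiv i (F i)) = 0 by rewrite divF gint0.
rewrite gint_sum.
under eq_bigr do rewrite gint_deriv.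
rewrite -mulr_sumr -gint_sum.
have -> : \sum_(i < N) X_ (mpoly.mnm1 i) * F i = (l'%:R - l%:R) *: (p * q).
  transitivity (p * (\sum_(i < N) X_ (mpoly.mnm1 i) * mpoly.mderiv i q) -
                q * (\sum_(i < N) X_ (mpoly.mnm1 i) * mpoly.mderiv i p)).
    rewrite !mulr_sumr -sumrB; apply: eq_bigr => i _; rewrite /F; ring.
  rewrite (euler_identity hp) (euler_identity hq) -!scalerAr [q * p]mulrC.
  by rewrite scalerBl.
rewrite gintZ => /eqP; rewrite !mulf_eq0 pnatr_eq0 /= subr_eq0 eqr_nat eq_sym (negbTE ll').
by move=> /eqP.
Qed.

Hypothesis N0 : (0 < N)%N.

Lemma pfun_bounded_sphere q : exists K : R, forall w, sphere w -> `|pfun q w| <= K.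
Proof.
exists (\sum_(m <- mpoly.msupp q) `|mpoly.mcoeff m q|) => w w1.
rewrite pfunE (le_trans (ler_norm_sum _ _ _))// ler_sum// => m _.
rewrite normrM ler_piMr// normr_prod; apply: prodr_ile1 => i _.
rewrite normr_ge0 normrX exprn_ile1// (le_trans (norm_tnth_le _ _))//.
by rewrite (w1 : enorm w = 1).
Qed.

Lemma integrable_pfun_sphere q : sigma.-integrable setT (EFin \o pfun q).
Proof.
have [K hK] := pfun_bounded_sphere q.
exact: (integrable_sphere N0 (measurable_pfun q) hK).
Qed.

(** The polynomial [(1 + |x|^2) ^ l] dominates [|x| ^ l] and is integrable against the
    Gaussian weight. *)
Lemma integrable_radial_gauss (l : nat) :
  leb.-integrable setT (fun x => (gmono l (enorm x))%:E).
Proof.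
pose Q : mpoly.mpoly N R := (1 + \sum_(i < N) X_ (mpoly.mnm1 i) ^+ 2) ^+ l.
have QE x : pfun Q x = (1 + enorm x ^+ 2) ^+ l.
  rewrite /pfun rmorphXn rmorphD rmorph1 rmorph_sum; congr ((1 + _) ^+ l).
  by rewrite sqr_enorm; apply: eq_bigr => i _; rewrite rmorphXn /= mpoly.mevalXU.
apply: le_integrable (integrable_pfun_gweight Q) => //.
  apply/measurable_EFinP; apply: (measurableT_comp _ (@measurable_enorm R N)).
  by apply: continuous_measurable_fun; exact: continuous_gmono.
move=> x _; rewrite lee_fin QE /gmono -/(gweight x) normrM [leRHS]normrM ler_wpM2r//.
rewrite !ger0_norm ?exprn_ge0 ?enorm_ge0 ?addr_ge0 ?sqr_ge0//.
rewrite lerXn2r// ?nnegrE ?enorm_ge0 ?addr_ge0 ?sqr_ge0//.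
have : 0 <= (enorm x - 2^-1) ^+ 2 by rewrite sqr_ge0.
have : 0 <= enorm x ^+ 2 by rewrite sqr_ge0.
by move: (enorm x) => y; nra.
Qed.

Lemma integral_radial_gt0 (f : R -> R) : measurable_fun setT f ->
  (forall s, 0 <= f s) -> (forall s, 0 < s -> 0 < f s) ->
  (0 < \int[leb]_x (f (enorm x))%:E)%E.
Proof.
move=> mf f0 fpos; rewrite lt_neqAle integral_ge0 ?andbT//; last first.
  by move=> x _; rewrite lee_fin.
apply/eqP => /esym I0.
have mfe : measurable_fun [set: N.-tuple R] (fun x => (f (enorm x))%:E).
  by apply/measurable_EFinP; apply: (measurableT_comp mf); exact: measurable_enorm.
have : (\int[leb]_x `|(f (enorm x))%:E| = 0)%E.
  by rewrite -I0; apply: eq_integral => x _; rewrite gee0_abs// lee_fin.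
move/(ae_eq_integral_abs leb measurableT mfe) => fae.
have : {ae leb, forall x : N.-tuple R, False}.
  near=> x; have h1 : enorm x != 0 by near: x; exact: ae_enorm_neq0.
  have : (f (enorm x))%:E = 0%E by near: x; apply: filterS fae => y; exact.
  move=> [] /eqP; rewrite gt_eqF// fpos// lt_neqAle eq_sym h1; exact: enorm_ge0.
move=> [A [mA A0 sA]].
have AT : A = setT by apply/seteqP; split => // x _; apply: sA.
have := @unit_ball_gt0 R N; rewrite ltNge => /negP; apply.
rewrite -A0 AT; apply: le_measure; rewrite ?inE//; exact: measurable_unit_ball.
Unshelve. all: by end_near. Qed.

(** In polar coordinates homogeneity separates a positive radial moment. *)
Lemma gint_sphere l q : homog l q ->
  exists2 c : R, 0 < c & gint q = c * \int[sigma]_(w in @sphere R N) pfun q w.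
Proof.
move=> hq.
have mpg : measurable_fun setT (fun x => pfun q x * gweight x).
  by apply: measurable_funM; [exact: measurable_pfun|exact: measurable_gweight].
have mgm : measurable_fun setT (@gmono R l).
  by apply: continuous_measurable_fun; exact: continuous_gmono.
have iq := integrable_pfun_sphere q.
have mq : measurable_fun [set: N.-tuple R] (EFin \o pfun q).
  by apply/measurable_EFinP; exact: measurable_pfun.
have IE : (\int[sigma]_(w in @sphere R N) pfun q w)%:E = (\int[sigma]_w (pfun q w)%:E)%E.
  rewrite /Rintegral (integral_in_sphere N0 mq).
  by rewrite fineK// integrable_fin_num.
have inner (s : R) :
    (\int[sigma]_w (pfun q (scalev s w) * gweight (scalev s w))%:E)%E =
    ((gmono l s)%:E * \int[sigma]_w (pfun q w)%:E)%E.
  rewrite -integralZl//; apply: eq_integral_sphere => //.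
  - apply/measurable_EFinP; apply: (measurableT_comp mpg); exact: measurable_scalevl.
  - exact: measurable_funeM.
  - move=> w w1; rewrite -EFinM /gmono (pfun_homog _ _ hq) /gweight; congr EFin.
    have -> : enorm (scalev s w) ^+ 2 = s ^+ 2.
      rewrite sqr_enorm; under eq_bigr do rewrite tnth_mktuple exprMn.
      by rewrite -mulr_sumr -sqr_enorm (w1 : enorm w = 1) expr1n mulr1.
    ring.
have ig := integrable_radial_gauss l.
have fn := integrable_fin_num measurableT ig.
have cE : (\int[leb]_x gmono l (enorm x))%:E = (\int[leb]_x (gmono l (enorm x))%:E)%E.
  by rewrite /Rintegral fineK.
exists (\int[leb]_x gmono l (enorm x)).
  rewrite -lte_fin cE.
  have mf : measurable_fun setT (fun s : R => gmono l `|s|).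
    by apply: (measurableT_comp mgm); exact: normr_measurable.
  have := @integral_radial_gt0 (fun s => gmono l `|s|) mf.
  under eq_integral do rewrite ger0_norm ?enorm_ge0//.
  apply=> s.
    by rewrite mulr_ge0 ?exprn_ge0 ?expR_ge0.
  by move=> s0; rewrite mulr_gt0 ?exprn_gt0 ?normr_gt0 ?gt_eqF// expR_gt0.
apply: EFin_inj; rewrite EFinM IE cE.
have qf : (\int[sigma]_w (pfun q w)%:E)%E \is a fin_num by rewrite integrable_fin_num.
rewrite -(fineK qf) -integralZr//.
rewrite /gint /Rintegral fineK; last first.
  by rewrite integrable_fin_num//; exact: integrable_pfun_gweight.
rewrite (integral_polar mpg (integrable_pfun_gweight q)).
by apply: eq_integral => x _; rewrite inner fineK.
Qed.

(** The product of two homogeneous polynomials is homogeneous, so the Gaussian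
    integral and the spherical one vanish together. *)
Lemma sphere_orthogonal l l' p q : homog l p -> homog l' q ->
  laplacian p = 0 -> laplacian q = 0 -> l != l' ->
  \int[sigma]_(w in @sphere R N) (pfun p w * pfun q w) = 0.
Proof.
move=> hp hq Lp Lq ll'.
have hpq : homog (l + l') (p * q).
  rewrite /homog; apply/allP => m; move=> /mpoly.msuppM_le /allpairsP[[m1 m2] /= [h1 h2 ->]].
  by rewrite mpoly.mdegD (homog_mdeg hp h1) (homog_mdeg hq h2).
have [c c0 /eqP] := gint_sphere hpq.
rewrite (gint_orthogonal hp hq)// eq_sym mulf_eq0 gt_eqF//= => /eqP <-.
by apply: eq_Rintegral => w _; rewrite pfunM.
Qed.

End gaussian_functional.

(** * Zonal functions *)

Section sphere_norms.
Context {R : realType} {N : nat}.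
Notation sigma := (@sphere_measure R N).
Hypothesis N0 : (0 < N)%N.
Local Open Scope ereal_scope.

(** Hoelder's inequality, the sphere having total mass [1]. *)
Lemma sphere_L1_le_Lp (p : R) (g : N.-tuple R -> R) : (1 <= p)%R ->
  measurable_fun setT g -> \int[sigma]_w (`|g w|)%:E <= sphere_Lnorm p g.
Proof.
move=> p1 mg.
have mgs : measurable_fun setT ((EFin \o g) \_ (@sphere R N)).
  apply/(measurable_restrictT _ _).1; first exact: measurable_sphere.
  by apply: measurable_funTS; exact/measurable_EFinP.
have -> : \int[sigma]_w (`|g w|)%:E = 'N[sigma]_1%:E[(EFin \o g) \_ (@sphere R N)].
  rewrite Lnorm1; apply: eq_integral_sphere => //.
  - by apply/measurable_EFinP; exact: measurableT_comp.
  - exact: measurableT_comp.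
  - by move=> w ws; rewrite patchE mem_set.
rewrite /sphere_Lnorm.
move: p1; rewrite le_eqVlt => /predU1P[<-//|p1].
pose g' : N.-tuple R -> R := g \_ (@sphere R N).
have mg' : measurable_fun setT g'.
  by apply/(measurable_restrictT _ _).1; [exact: measurable_sphere|exact: measurable_funTS].
have -> : (EFin \o g) \_ (@sphere R N) = EFin \o g'.
  by apply/funext => w; rewrite /g' /= !patchE; case: ifP.
have p0 : (0 < p)%R by exact: lt_trans p1.
pose q := (p / (p - 1))%R.
have q0 : (0 < q)%R by rewrite divr_gt0// subr_gt0.
have pq : (p^-1 + q^-1 = 1)%R.
  by rewrite /q; field; rewrite !gt_eqF// subr_gt0.
have := @hoelder _ _ R sigma g' (cst 1%R) p q mg' (measurable_cst _) p0 q0 pq.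
have -> : 'N[sigma]_q%:E[EFin \o cst 1%R] = 1.
  by rewrite [LHS](@Lnorm_cst1 _ _ R sigma q) [X in X `^ _](sphere_measureT) poweR1r.
rewrite mule1.
by rewrite (_ : (g' \* cst 1)%R = g')//; apply/funext => w /=; rewrite mulr1.
Qed.

Lemma sphere_Lnorm_ge0 (p : R) (g : N.-tuple R -> R) : 0 <= sphere_Lnorm p g.
Proof. exact: Lnorm_ge0. Qed.

Lemma eq_sphere_Lnorm (p : R) (f g : N.-tuple R -> R) :
  (forall w, sphere w -> f w = g w) -> sphere_Lnorm p f = sphere_Lnorm p g.
Proof.
move=> fg; rewrite /sphere_Lnorm; congr Lnorm; apply/funext => w.
by rewrite !patchE; case: ifPn => // /set_mem ws; congr EFin; exact: fg.
Qed.

Lemma sphere_bounded_mul (b h : N.-tuple R -> R) (K : R) :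
  measurable_fun setT b -> (forall w, sphere w -> (`|b w| <= K)%R) ->
  sigma.-integrable setT (EFin \o h) ->
  sigma.-integrable setT (EFin \o (fun w => b w * h w)%R) /\
  \int[sigma]_w (`|b w * h w|)%:E <= (`|K|%R)%:E * \int[sigma]_w (`|h w|)%:E.
Proof.
move=> mb bK ih.
have mh : measurable_fun setT h by have := measurable_int _ ih; move/measurable_EFinP.
have mbh : measurable_fun setT (fun w => b w * h w)%R by exact: measurable_funM.
have le : \int[sigma]_w (`|b w * h w|)%:E <= (`|K|%R)%:E * \int[sigma]_w (`|h w|)%:E.
  rewrite -ge0_integralZl//; last first.
    by apply/measurable_EFinP; exact: measurableT_comp.
  apply: ae_ge0_le_integral => //.
  - by apply/measurable_EFinP; exact: measurableT_comp.
  - by apply: measurable_funeM; apply/measurable_EFinP; exact: measurableT_comp.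
  - apply: filterS (ae_sphere N0) => w ws _.
    by rewrite -EFinM lee_fin normrM ler_wpM2r// (le_trans (bK _ ws))// ler_norm.
split => //; apply/integrableP; split; first exact/measurable_EFinP.
apply: (le_lt_trans le); have /integrableP[_ hfin] := ih.
have hf : \int[sigma]_w (`|h w|)%:E \is a fin_num.
  by rewrite ge0_fin_numE// integral_ge0// => w _.
by rewrite -(fineK hf) -EFinM ltry.
Qed.

End sphere_norms.

Section zonal_kernel.
Context {R : realType} {N : nat} (d : nat -> nat).
Variable q : forall l, 'I_(d l) -> mpoly.mpoly N R.
Notation sigma := (@sphere_measure R N).
Hypothesis N0 : (0 < N)%N.

Definition sdot (p p' : mpoly.mpoly N R) : R :=
  \int[sigma]_(w in @sphere R N) (pfun p w * pfun p' w).

Lemma integrable_sphere_pfunM p p' :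
  sigma.-integrable (@sphere R N) (EFin \o (fun w => pfun p w * pfun p' w)).
Proof.
apply: (@integrableS _ _ R sigma setT) => //; first exact: measurable_sphere.
rewrite (_ : EFin \o _ = EFin \o pfun (p * p')); first exact: integrable_pfun_sphere.
by apply/funext => w /=; rewrite pfunM.
Qed.

Lemma sdotC p p' : sdot p p' = sdot p' p.
Proof. by apply: eq_Rintegral => w _; rewrite mulrC. Qed.

Lemma sdot_linear p (c : R) p1 p2 : sdot p (c *: p1 + p2) = c * sdot p p1 + sdot p p2.
Proof.
have mS := @measurable_sphere R N.
rewrite /sdot; under eq_Rintegral do rewrite pfunZD mulrDr mulrCA.
rewrite RintegralD//.
- by rewrite RintegralZl//; exact: integrable_sphere_pfunM.
- exact: (integrableZl mS c (integrable_sphere_pfunM p p1)).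
- exact: integrable_sphere_pfunM.
Qed.

Lemma sdot0 p : sdot p 0 = 0.
Proof.
have := sdot_linear p 1 0 0; rewrite scale1r addr0 mul1r => /eqP.
by rewrite -subr_eq0 opprD addNKr oppr_eq0 => /eqP.
Qed.

Lemma sdotZ p c p1 : sdot p (c *: p1) = c * sdot p p1.
Proof. by have := sdot_linear p c p1 0; rewrite addr0 sdot0 addr0. Qed.

Lemma sdot_sum p (I : Type) (r : seq I) (F : I -> mpoly.mpoly N R) :
  sdot p (\sum_(i <- r) F i) = \sum_(i <- r) sdot p (F i).
Proof.
apply: (big_morph (sdot p)); last exact: sdot0.
by move=> p1 p2; have := sdot_linear p 1 p1 p2; rewrite scale1r mul1r.
Qed.

Hypothesis hq : forall l (m : 'I_(d l)), homog l (q m).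
Hypothesis Lq : forall l (m : 'I_(d l)), laplacian (q m) = 0.
Hypothesis oq : forall l (m m' : 'I_(d l)), sdot (q m) (q m') = (m == m')%:R.

Definition zonal l (w eta : N.-tuple R) : R :=
  \sum_(m < d l) pfun (q m) w * pfun (q m) eta.

Definition zonal_poly l (w : N.-tuple R) : mpoly.mpoly N R :=
  \sum_(m < d l) pfun (q m) w *: q m.

Lemma zonal_polyE l w eta : pfun (zonal_poly l w) eta = zonal l w eta.
Proof.
rewrite /zonal_poly /zonal /pfun rmorph_sum; apply: eq_bigr => m _.
by rewrite /= mpoly.mevalZ.
Qed.

Lemma homog_zonal l w : homog l (zonal_poly l w).
Proof. by rewrite /homog; apply: rpred_sum => m _; apply: rpredZ; exact: hq. Qed.

Lemma sdot_zonal_diff l l' (w : N.-tuple R) (m : 'I_(d l')) : l' != l ->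
  sdot (zonal_poly l w) (q m) = 0.
Proof.
move=> ll'; rewrite sdotC sdot_sum big1// => i _.
by rewrite sdotZ /sdot (sphere_orthogonal N0 (hq m) (hq i) (Lq m) (Lq i) ll') mulr0.
Qed.

Lemma sdot_zonal_same l (w : N.-tuple R) (m : 'I_(d l)) :
  sdot (zonal_poly l w) (q m) = pfun (q m) w.
Proof.
rewrite sdotC sdot_sum (bigD1 m)//= sdotZ oq eqxx mulr1.
by rewrite big1 ?addr0// => i im; rewrite sdotZ oq eq_sym (negbTE im) mulr0.
Qed.

Lemma sdot_zonal_zonal l (w : N.-tuple R) :
  sdot (zonal_poly l w) (zonal_poly l w) = zonal l w w.
Proof.
rewrite sdot_sum; apply: eq_bigr => m _.
by rewrite sdotZ sdot_zonal_same.
Qed.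

Lemma measurable_zonal l w : measurable_fun setT (zonal l w).
Proof.
rewrite (_ : zonal l w = pfun (zonal_poly l w)); first exact: measurable_pfun.
by apply/funext => eta; rewrite zonal_polyE.
Qed.

Lemma zonal_diag_ge0 l w : 0 <= zonal l w w.
Proof. by apply: sumr_ge0 => m _; exact: sqr_ge0. Qed.

(** By orthonormality, the square of the [L^2] norm of a zonal function is its value
    at its pole. *)
Lemma sphere_L1_zonal l w :
  (\int[sigma]_eta (`|zonal l w eta|)%:E <= (Num.sqrt (zonal l w w))%:E)%E.
Proof.
have z0 := zonal_diag_ge0 l w.
have mz := measurable_zonal l w.
apply: (le_trans (sphere_L1_le_Lp N0 (_ : 1 <= 2) mz)); first by rewrite ler1n.
have E : (\int[sigma]_eta (`|((EFin \o zonal l w) \_ (@sphere R N)) eta| `^ 2) = (zonal l w w)%:E)%E.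
  rewrite -sdot_zonal_zonal /sdot /Rintegral fineK; last first.
    by apply: (integrable_fin_num (@measurable_sphere R N)); exact: integrable_sphere_pfunM.
  rewrite [RHS]integral_mkcond; apply: eq_integral => eta _.
  rewrite !patchE; case: ifPn => _ /=.
    by rewrite powR_mulrn// real_normK ?num_real// !zonal_polyE expr2.
  by rewrite normr0 powR0.
by rewrite /sphere_Lnorm unlock /= E /= powR12_sqrt.
Qed.

(** The sup bound applies to the zonal function itself and, its [L^1] norm being at
    most the square root of its value at the pole, yields
    [Z <= B ^ (l + 1) * sqrt Z] there. Any other value is at most
    the mean of the values at its two poles. *)
Lemma zonal_bound : exists2 B : R, 1 <= B &
  (forall l w eta, sphere w -> sphere eta -> `|zonal l w eta| <= (B ^+ l.+1) ^+ 2) /\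
  (forall (p : R) l (m : 'I_(d l)) w, 1 <= p -> sphere w ->
    ((`|pfun (q m) w|)%:E <= (B ^+ l.+1)%:E * sphere_Lnorm p (pfun (q m)))%E).
Proof.
have [B B1 HB] := @pfun_sup_sphere R N N0.
have Bl l : 0 <= B ^+ l.+1 by rewrite exprn_ge0// (le_trans ler01).
exists B => //; split; last first.
  move=> p l m w p1 w1; apply: (le_trans (HB l _ _ (hq m) w1)).
  by rewrite lee_wpmul2l ?lee_fin//; apply: sphere_L1_le_Lp => //; exact: measurable_pfun.
have diag l w : sphere w -> zonal l w w <= (B ^+ l.+1) ^+ 2.
  move=> w1; have z0 := zonal_diag_ge0 l w.
  have := HB l _ _ (homog_zonal l w) w1; rewrite zonal_polyE ger0_norm//.
  under eq_integral do rewrite zonal_polyE.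
  move=> h; have {h} : zonal l w w <= B ^+ l.+1 * Num.sqrt (zonal l w w).
    rewrite -lee_fin (le_trans h)// EFinM lee_wpmul2l ?lee_fin//.
    exact: sphere_L1_zonal.
  set s := Num.sqrt _; have s2 : s ^+ 2 = zonal l w w by rewrite sqr_sqrtr.
  rewrite -s2 expr2 => h.
  have s0 : 0 <= s by exact: sqrtr_ge0.
  rewrite -expr2 lerXn2r ?nnegrE//.
  move: s0; rewrite le_eqVlt => /predU1P[<-//|s0].
  by move: h; rewrite ler_pM2r.
move=> l w eta w1 eta1.
apply: (@le_trans _ _ (2^-1 * (zonal l w w + zonal l eta eta))).
  rewrite /zonal (le_trans (ler_norm_sum _ _ _))// -big_split/= mulr_sumr ler_sum// => m _.
  rewrite normrM.
  have h1 (x : R) : x * x = `|x| ^+ 2 by rewrite real_normK ?num_real.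
  rewrite (h1 (pfun _ w)) (h1 (pfun _ eta)).
  move: (`|pfun _ w|) (`|pfun _ eta|) => a b.
  have : 0 <= (a - b) ^+ 2 by rewrite sqr_ge0.
  nra.
have := diag l _ w1; have := diag l _ eta1; lra.
Qed.

(** Testing the [L^2] expansion against the zonal kernel extracts the component
    of degree [l]. *)
Lemma zonal_reproducing (f : N.-tuple R -> R) (c : forall l, 'I_(d l) -> R) :
  measurable_fun setT f ->
  (fun L : nat => sphere_Lnorm 2 (fun w =>
     f w - \sum_(l < L) \sum_(m < d l) c l m * pfun (q m) w)) @ \oo --> 0%E ->
  sigma.-integrable setT (EFin \o f) /\
  forall l w, \int[sigma]_eta (zonal l w eta * f eta) =
    \sum_(m < d l) pfun (q m) w * c l m.
Proof.
move=> mf fL.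
pose P L : mpoly.mpoly N R := \sum_(l < L) \sum_(m < d l) c l m *: q m.
have PE L w : pfun (P L) w = \sum_(l < L) \sum_(m < d l) c l m * pfun (q m) w.
  rewrite /P /pfun rmorph_sum; apply: eq_bigr => l _.
  rewrite rmorph_sum; apply: eq_bigr => m _.
  by rewrite /= mpoly.mevalZ.
pose g L w := f w - pfun (P L) w.
have mg L : measurable_fun setT (g L).
  by apply: measurable_funB => //; exact: measurable_pfun.
have gN : (fun L => sphere_Lnorm 2 (g L)) @ \oo --> 0%E.
  rewrite (_ : (fun L => sphere_Lnorm 2 (g L)) = (fun L : nat => sphere_Lnorm 2 (fun w =>
     f w - \sum_(l < L) \sum_(m < d l) c l m * pfun (q m) w)))//.
  by apply/funext => L; congr sphere_Lnorm; apply/funext => w; rewrite /g PE.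
have gI : (fun L => \int[sigma]_w (`|g L w|)%:E)%E @ \oo --> 0%E.
  apply: (@squeeze_cvge _ _ _ _ (fun=> 0%E) _ (fun L => sphere_Lnorm 2 (g L))) => //; last exact: cvg_cst.
  apply: nearW => L; rewrite sphere_L1_le_Lp ?ler1n// andbT integral_ge0// => w _.
have /fine_cvgP[gfin gR] := gI.
have igL L : (\int[sigma]_w (`|g L w|)%:E)%E \is a fin_num ->
    sigma.-integrable setT (EFin \o g L).
  move=> h; apply/integrableP; split; first exact/measurable_EFinP.
  by move: h; rewrite ge0_fin_numE// integral_ge0// => w _.
have fE L : EFin \o f = ((EFin \o g L) \+ (EFin \o pfun (P L)))%E.
  by apply/funext => w; rewrite /= -EFinD /g subrK.
have fint : sigma.-integrable setT (EFin \o f).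
  have [L hL] : exists L, (\int[sigma]_w (`|g L w|)%:E)%E \is a fin_num.
    by case: gfin => L0 _ /(_ L0 (leqnn _)); exists L0.
  by rewrite (fE L); apply: integrableD => //; [exact: igL|exact: integrable_pfun_sphere].
split => // l w.
set S := \sum_(m < d l) _.
have [K HK] := pfun_bounded_sphere (zonal_poly l w).
have zpoly : zonal l w = pfun (zonal_poly l w) by apply/funext => eta; rewrite zonal_polyE.
have mz := measurable_zonal l w.
have HK' eta : sphere eta -> `|zonal l w eta| <= K by rewrite zpoly; exact: HK.
have izP L : sigma.-integrable setT (EFin \o (fun eta => zonal l w eta * pfun (P L) eta)).
  by have [] := sphere_bounded_mul N0 mz HK' (integrable_pfun_sphere N0 (P L)).
have SE L : (l < L)%N -> \int[sigma]_eta (zonal l w eta * pfun (P L) eta) = S.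
  move=> lL.
  transitivity (sdot (zonal_poly l w) (P L)).
    rewrite /sdot /Rintegral integral_in_sphere//; first by rewrite zpoly.
    apply/measurable_EFinP.
    by apply: measurable_funM; exact: measurable_pfun.
  rewrite /P sdot_sum (bigD1 (Ordinal lL))//= sdot_sum [X in _ + X]big1 ?addr0 => [|i il].
    by apply: eq_bigr => m _; rewrite sdotZ sdot_zonal_same mulrC.
  by rewrite sdot_sum big1// => m _; rewrite sdotZ sdot_zonal_diff ?mulr0.
have bnd : \forall L \near \oo, `|\int[sigma]_eta (zonal l w eta * f eta) - S| <=
    `|K| * fine (\int[sigma]_w (`|g L w|)%:E)%E.
  near=> L.
  have hL : (\int[sigma]_w (`|g L w|)%:E)%E \is a fin_num by near: L.
  have [izg le] := sphere_bounded_mul N0 mz HK' (igL _ hL).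
  have -> : \int[sigma]_eta (zonal l w eta * f eta) - S = \int[sigma]_eta (zonal l w eta * g L eta).
    rewrite -(SE L); last by near: L; exact: nbhs_infty_gt.
    under eq_Rintegral => eta _.
      rewrite (_ : zonal l w eta * f eta = zonal l w eta * g L eta + zonal l w eta * pfun (P L) eta);
        last by rewrite -mulrDr /g subrK.
      over.
    by rewrite RintegralD// addrK.
  apply: (le_trans (le_normr_Rintegral measurableT izg)).
  have e1 : (\int[sigma]_t `|zonal l w t * g L t|)%:E =
      (\int[sigma]_t (`|zonal l w t * g L t|)%:E)%E.
    by rewrite /Rintegral fineK//; exact: (integrable_fin_num measurableT (integrable_norm izg)).
  by rewrite -lee_fin EFinM e1 (fineK hL).
apply/eqP; rewrite -subr_eq0 -normr_le0.
have cv : (fun L => `|K| * fine (\int[sigma]_w (`|g L w|)%:E)%E) @ \oo --> (0 : R).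
  by rewrite -[X in _ --> X](mulr0 `|K|); apply: cvgM; [exact: cvg_cst|exact: gR].
rewrite -(cvg_lim (@Rhausdorff R) cv); apply: limr_ge => //.
by apply/cvg_ex; exists 0.
Unshelve. all: by end_near. Qed.

End zonal_kernel.

(** * Bessel indices and measurability of the kernels *)

Section bessel_indices.
Context {R : realType} (N : nat) (lam : R).
Hypotheses (hN : (3 <= N)%N) (hlam0 : 0 <= lam) (hlam : lam <= (N%:R - 2) ^+ 2 / 4).
Notation mu := (mu R N).

Lemma mu_gt0 : 0 < mu.
Proof. by rewrite /Defs.mu divr_gt0// subr_gt0 (ltr_nat R 2). Qed.

Lemma lam_le_mu2 : lam <= mu ^+ 2.
Proof. by rewrite /Defs.mu expr_div_n (le_trans hlam)// -natrX. Qed.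

Lemma nul_ge l : l%:R <= nul N lam l.
Proof.
rewrite /nul -[leLHS]ger0_norm// -sqrtr_sqr ler_wsqrtr//.
have := lam_le_mu2; have := mu_gt0; move: mu => m m0 h.
have : 0 <= 2 * m * l%:R by rewrite !mulr_ge0// ltW.
move: (l%:R : R) => k; nra.
Qed.

Lemma nul_ge0 l : 0 <= nul N lam l. Proof. exact: sqrtr_ge0. Qed.

Lemma nu_le_nul l : nu N lam <= nul N lam l.
Proof.
rewrite /nu /nul ler_wsqrtr// lerD2r lerXn2r ?nnegrE ?addr_ge0 ?lerDl//;
  exact: ltW mu_gt0.
Qed.

Lemma nu_le_mu : nu N lam <= mu.
Proof.
rewrite /nu -[leRHS](ger0_norm (ltW mu_gt0)) -sqrtr_sqr ler_wsqrtr//.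
by rewrite gerBl.
Qed.

(** This is integrability at the origin of the [p]-th power of [|x| ^ (nu_l - mu)]. *)
Lemma p_upperP (p : R) : 1 <= p -> (p%:E < p_upper N lam)%E ->
  forall l, 0 < N%:R + (nul N lam l - mu) * p.
Proof.
move=> p1; rewrite /p_upper; have p0 : 0 < p by exact: lt_le_trans p1.
have N0 : 0 < N%:R :> R by rewrite ltr0n (leq_trans _ hN).
move=> hp l; apply: (@lt_le_trans _ _ (N%:R + (nu N lam - mu) * p)); last first.
  by rewrite lerD2l ler_pM2r// lerD2r nu_le_nul.
move: hp; case: eqP => [<- _|/eqP mn].
  by rewrite subrr mul0r addr0.
have mn0 : 0 < mu - nu N lam by rewrite subr_gt0 lt_neqAle eq_sym mn nu_le_mu.
by rewrite lte_fin ltr_pdivlMr//; lra.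
Qed.

End bessel_indices.

Section measurability_off_origin.
Context {R : realType} {N : nat}.

Lemma enorm0_uniq (x y : N.-tuple R) : enorm x = 0 -> enorm y = 0 -> x = y.
Proof.
by move=> x0 y0; apply: eq_from_tnth => i; rewrite !tnth_enorm_eq0.
Qed.

Lemma measurable_off_origin (g g' : N.-tuple R -> R) : measurable_fun setT g' ->
  (forall y, enorm y != 0 -> g y = g' y) -> measurable_fun setT g.
Proof.
move=> mg' gg'.
pose z : N.-tuple R := [tuple 0 | _ < N].
have z0 : enorm z = 0.
  rewrite /enorm big1 ?sqrtr0// => i _; by rewrite tnth_mktuple expr0n.
have -> : g = fun y => if enorm y != 0 then g' y else g z.
  apply/funext => y; case: ifPn => [/gg'//|]; rewrite negbK => /eqP y0.
  by congr g; exact: enorm0_uniq.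
apply: measurable_fun_ifT => //.
apply: measurable_neg; apply: measurable_fun_eqr => //; exact: measurable_enorm.
Qed.

Lemma measurable_radial (f : R -> R) : measurable_fun (`]0, +oo[%classic : set R) f ->
  measurable_fun setT (fun y : N.-tuple R => f (enorm y)).
Proof.
move=> mf.
have mf' : measurable_fun setT (f \_ (`]0, +oo[%classic : set R)).
  by apply/(measurable_restrictT _ _).1.
apply: (@measurable_off_origin _ (fun y => (f \_ (`]0, +oo[%classic : set R)) (enorm y))).
  by apply: (measurableT_comp mf'); exact: measurable_enorm.
move=> y y0; rewrite patchE mem_set//= in_itv/= andbT lt_neqAle eq_sym y0.
exact: enorm_ge0.
Qed.

End measurability_off_origin.

Section parametric_measurability.
Context d1 d2 (T1 : measurableType d1) (T2 : measurableType d2) (R : realType).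
Variable m2 : {sigma_finite_measure set T2 -> \bar R}.

Lemma measurable_integral_param (g : T1 * T2 -> R) : measurable_fun setT g ->
  measurable_fun setT (fun x => \int[m2]_y (g (x, y))%:E)%E.
Proof.
move=> mg; under eq_fun do rewrite integralE.
have mG : measurable_fun setT (EFin \o g) by exact/measurable_EFinP.
apply: emeasurable_funB.
- apply: (eq_measurable_fun (fubini_F m2 ((EFin \o g) ^\+)%E)).
    by move=> x _; apply: eq_integral => y _; rewrite /= !funeposE.
  apply: measurable_fun_fubini_tonelli_F => //; exact: measurable_funepos.
- apply: (eq_measurable_fun (fubini_F m2 ((EFin \o g) ^\-)%E)).
    by move=> x _; apply: eq_integral => y _; rewrite /= !funenegE.
  apply: measurable_fun_fubini_tonelli_F => //; exact: measurable_funeneg.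
Qed.

Lemma measurable_Rintegral_param (g : T1 * T2 -> R) : measurable_fun setT g ->
  measurable_fun setT (fun x => \int[m2]_y g (x, y)).
Proof.
move=> mg; rewrite /Rintegral.
by apply: (measurableT_comp (f := @fine R)) => //; exact: measurable_integral_param.
Qed.

End parametric_measurability.

Section kernel_measurability.
Context {R : realType}.

Lemma measurable_bessel_sum d (T : measurableType d) (a : R) (h : T -> R) : 0 <= a ->
  measurable_fun setT h -> (forall x, 0 <= h x) ->
  measurable_fun setT (fun x => bessel_sum a (h x)).
Proof.
move=> a0 mh h0.
apply: (measurable_fun_cvg (h := fun K x => series (bessel_term a (h x)) K)).
- move=> K; apply: measurable_sum => k; rewrite /bessel_term.
  by do 2! apply: measurable_funM => //; exact: measurable_funX.
- by move=> x _; exact: is_cvg_bessel_sum.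
Qed.

(** The remainder kernel, in the form in which it makes sense for all radii. *)
Definition remainder_kernel (mu a : R) (n : nat) (t r rho : R) : R :=
  kernel_prefactor mu a r rho t * expR (- (r ^+ 2 / (4 * t))) *
  series_remainder a n (rho ^+ 2 / (4 * t)) (r ^+ 2 / (4 * t)).

Lemma measurable_remainder_kernel d (T : measurableType d) (mu a t : R) n (h1 h2 : T -> R) :
  0 <= a -> measurable_fun setT h1 -> measurable_fun setT h2 ->
  measurable_fun setT (fun x => remainder_kernel mu a n t (h1 x) (h2 x)).
Proof.
move=> a0 m1 m2.
have mz : measurable_fun setT (fun x => h1 x ^+ 2 / (4 * t)).
  by apply: measurable_funM => //; exact: measurable_funX.
have me : measurable_fun setT (fun x => h2 x ^+ 2 / (4 * t)).
  by apply: measurable_funM => //; exact: measurable_funX.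
rewrite /remainder_kernel /kernel_prefactor /series_remainder; apply: measurable_funM.
  apply: measurable_funM; last first.
    by apply: (measurableT_comp (@measurable_expR R)); exact: measurableT_comp.
  apply: measurable_funM => //; apply: measurable_funM => //.
  apply: (measurableT_comp (f := @powR R ^~ (a - mu))); first exact: measurable_powR.
  exact: measurable_funM.
apply: measurable_funB.
  apply: measurable_funM.
    by apply: (measurableT_comp (@measurable_expR R)); exact: measurableT_comp.
  apply: measurable_bessel_sum => //; first exact: measurable_funM.
  move=> x.
  have -> : h2 x ^+ 2 / (4 * t) * (h1 x ^+ 2 / (4 * t)) = (h2 x * h1 x / (4 * t)) ^+ 2.
    by rewrite !expr2; move: (4 * t)^-1 => i; ring.
  exact: sqr_ge0.
apply: measurable_sum => j; apply: measurable_funM; first exact: measurable_funX.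
rewrite /profile_poly; apply: measurable_sum => k.
by do 2! apply: measurable_funM => //; apply: measurable_funM => //; exact: measurable_funX.
Qed.

End kernel_measurability.

(** * The radial remainder *)

Lemma Rintegral_sum_ord d (T : measurableType d) (R : realType)
    (m : {measure set T -> \bar R}) K (f : 'I_K -> T -> R) :
  (forall j, m.-integrable setT (fun y => (f j y)%:E)) ->
  \int[m]_y (\sum_(j < K) f j y) = \sum_(j < K) \int[m]_y f j y.
Proof.
move=> fint; rewrite /Rintegral.
under eq_integral do rewrite -sumEFin.
rewrite integral_sum//; apply: EFin_inj; rewrite -sumEFin fineK; last first.
  rewrite sum_fin_num; apply/allP => _ /mapP[j _ ->].
  exact: (integrable_fin_num _ (fint j)).
by apply: eq_bigr => j _; rewrite fineK//; exact: integrable_fin_num.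
Qed.

Section weighted_integrals.
Context {R : realType} {N : nat}.
Hypothesis N0 : (0 < N)%N.
Notation leb := (lebesgueN R N).

Lemma enorm_gt0 (x : N.-tuple R) : enorm x != 0 -> 0 < enorm x.
Proof. by move=> x0; rewrite lt_neqAle eq_sym x0 enorm_ge0. Qed.

Lemma weighted_L1_le (w k f : N.-tuple R -> R) (c : R) :
  measurable_fun setT w -> measurable_fun setT k -> measurable_fun setT f ->
  0 <= c -> (forall y, 0 <= w y) ->
  (forall y, enorm y != 0 -> `|k y * f y| <= c * (w y * `|f y|)) ->
  (\int[leb]_y (w y * `|f y|)%:E < +oo)%E ->
  (\int[leb]_y (`|k y * f y|)%:E <= (c * fine (\int[leb]_y (w y * `|f y|)%:E))%:E)%E.
Proof.
move=> mw mk mf c0 w0 kw wfin.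
have mwf : measurable_fun setT (fun y => (w y * `|f y|)%:E).
  apply/measurable_EFinP; apply: measurable_funM => //.
  exact: (measurableT_comp (@normr_measurable R setT)).
have I0 : (0 <= \int[leb]_y (w y * `|f y|)%:E)%E.
  by apply: integral_ge0 => y _; rewrite lee_fin mulr_ge0.
have Ifin : (\int[leb]_y (w y * `|f y|)%:E)%E \is a fin_num by rewrite ge0_fin_numE.
rewrite EFinM fineK// -ge0_integralZl//; last first.
  by move=> y _; rewrite lee_fin mulr_ge0.
apply: ae_ge0_le_integral => //.
- apply/measurable_EFinP; apply: (measurableT_comp (@normr_measurable R setT)).
  exact: measurable_funM.
- by move=> y _; rewrite mule_ge0 ?lee_fin ?mulr_ge0.
- exact: measurable_funeM.
- by apply: filterS (ae_enorm_neq0 N0) => y y0 _; rewrite -EFinM lee_fin kw.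
Qed.

Lemma weighted_integrable (w k f : N.-tuple R -> R) (c : R) :
  measurable_fun setT w -> measurable_fun setT k -> measurable_fun setT f ->
  0 <= c -> (forall y, 0 <= w y) ->
  (forall y, enorm y != 0 -> `|k y * f y| <= c * (w y * `|f y|)) ->
  (\int[leb]_y (w y * `|f y|)%:E < +oo)%E ->
  leb.-integrable setT (fun y => (k y * f y)%:E) /\
  `|\int[leb]_y (k y * f y)| <= c * fine (\int[leb]_y (w y * `|f y|)%:E)%E.
Proof.
move=> mw mk mf c0 w0 kw wfin.
have mkf : measurable_fun setT (fun y => (k y * f y)%:E).
  by apply/measurable_EFinP; exact: measurable_funM.
have le1 := weighted_L1_le mw mk mf c0 w0 kw wfin.
have int1 : leb.-integrable setT (fun y => (k y * f y)%:E).
  by apply/integrableP; split => //; apply: le_lt_trans le1 _; rewrite ltry.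
split=> //.
rewrite -lee_fin; apply: le_trans le1.
have Jfin : (\int[leb]_y (k y * f y)%:E)%E \is a fin_num by exact: integrable_fin_num.
by rewrite /Rintegral -abse_EFin fineK//; exact: le_abse_integral.
Qed.

End weighted_integrals.

Section remainder_integrals.
Context {R : realType} {N : nat}.
Hypothesis N0 : (0 < N)%N.
Variables (mu a : R) (n : nat).
Hypothesis a0 : 0 <= a.
Notation leb := (lebesgueN R N).
Implicit Type f : R -> R.

(** The weight of the norm [L^1_(a, n+1)]. *)
Definition moment_weight (rho : R) : R := rho `^ (a - mu) * (1 + rho ^+ (2 * n + 2)).

(** [wnorm] for an arbitrary Bessel index. *)
Definition weighted_mass f : \bar R := (\int[leb]_y (moment_weight (enorm y) * `|f (enorm y)|)%:E)%E.

(** The part of [kernel_prefactor] that depends on the outer radius [r]. *)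
Definition outer_prefactor (r t : R) : R :=
  (2 * t)^-1 * (4 * t) `^ (- a) * r `^ (a - mu) / Gamma (a + 1).

Definition radial_remainder f (r t : R) : R :=
  \int[leb]_y (remainder_kernel mu a n t r (enorm y) * f (enorm y)).

Lemma moment_weight_ge0 rho : 0 <= rho -> 0 <= moment_weight rho.
Proof. by move=> h; rewrite mulr_ge0 ?powR_ge0// addr_ge0// exprn_ge0. Qed.

Lemma measurable_moment_weight : measurable_fun setT (fun y : N.-tuple R => moment_weight (enorm y)).
Proof.
apply: (measurableT_comp (f := moment_weight)); last exact: measurable_enorm.
apply: measurable_funM; first exact: measurable_powR.
apply: measurable_funD => //; exact: measurable_funX.
Qed.

Lemma outer_prefactor_ge0 r t : 0 <= r -> 0 < t -> 0 <= outer_prefactor r t.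
Proof.
move=> r0 t0; rewrite /outer_prefactor divr_ge0 ?mulr_ge0 ?powR_ge0 ?invr_ge0//.
  by rewrite mulr_ge0// ltW.
by rewrite ltW// Gamma_gt0// lerDr.
Qed.

Lemma kernel_prefactorE r rho t : 0 <= r -> 0 <= rho ->
  kernel_prefactor mu a r rho t = outer_prefactor r t * rho `^ (a - mu).
Proof.
move=> r0 rho0; rewrite /kernel_prefactor /outer_prefactor (powRM _ r0 rho0).
by move: (Gamma _)^-1 (_ `^ (- a)) (2 * t)^-1 => ? ? ?; ring.
Qed.

Lemma pow_le_moment_weight j rho : 0 <= rho -> (j <= n.+1)%N ->
  rho `^ (a - mu) * (rho ^+ 2) ^+ j <= moment_weight rho.
Proof.
move=> rho0 jn; rewrite ler_wpM2l ?powR_ge0//.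
rewrite (_ : 2 * n + 2 = 2 * n.+1)%N; last by rewrite mulnS addnC.
rewrite exprM; have : 0 <= rho ^+ 2 by rewrite sqr_ge0.
move: (rho ^+ 2) => s s0; have [s1|/ltW s1] := leP s 1.
  by rewrite (@le_trans _ _ 1) ?exprn_ile1// lerDl exprn_ge0.
by rewrite (@le_trans _ _ (s ^+ n.+1)) ?ler_weXn2l// lerDr.
Qed.

Lemma kernel_prefactor_le_moment_weight r rho t : 0 <= r -> 0 <= rho -> 0 < t ->
  kernel_prefactor mu a r rho t <= outer_prefactor r t * moment_weight rho.
Proof.
move=> r0 rho0 t0; rewrite kernel_prefactorE// ler_wpM2l ?outer_prefactor_ge0//.
by have := @pow_le_moment_weight 0%N rho rho0 isT; rewrite expr0 mulr1.
Qed.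

Lemma rkernel_le_moment_weight r rho t : 0 < r -> 0 < rho -> 0 < t ->
  `|rkernel mu a r rho t| <= outer_prefactor r t * moment_weight rho.
Proof.
move=> r0 rho0 t0; rewrite ger0_norm ?rkernel_ge0//.
by apply: le_trans (rkernel_le _ _ _ _ _) _ => //; apply: kernel_prefactor_le_moment_weight => //; exact: ltW.
Qed.

Lemma rprofile_le_moment_weight j r rho t : (j <= n)%N -> 0 < r -> 0 < rho -> 1 <= t ->
  `|rprofile mu a j r rho t| <= outer_prefactor r t * moment_weight rho.
Proof.
move=> jn r0 rho0 t1; have t0 : 0 < t by exact: lt_le_trans t1.
apply: le_trans (rprofile_le _ _ _ _ _ _) _ => //.
rewrite kernel_prefactorE; [|exact: ltW..].
rewrite -mulrA; apply: ler_wpM2l; first by rewrite outer_prefactor_ge0// ltW.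
apply: le_trans (pow_le_moment_weight (ltW rho0) (leqW jn)).
rewrite ler_wpM2l ?powR_ge0// lerXn2r ?nnegrE ?sqr_ge0//.
  by rewrite divr_ge0 ?sqr_ge0// mulr_ge0// ltW.
rewrite ler_pdivrMr ?mulr_gt0// -[leLHS]mulr1 ler_wpM2l ?sqr_ge0//; lra.
Qed.

Lemma remainder_kernelE r rho t : 0 < r -> 0 < rho -> 0 < t ->
  remainder_kernel mu a n t r rho =
  rkernel mu a r rho t - \sum_(j < n.+1) rprofile mu a j r rho t.
Proof. by move=> r0 rho0 t0; rewrite rkernel_remainderE. Qed.

Lemma measurable_rprofile j r t :
  measurable_fun setT (fun y : N.-tuple R => rprofile mu a j r (enorm y) t).
Proof.
apply: (measurableT_comp (f := fun rho => rprofile mu a j r rho t));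
  last exact: measurable_enorm.
by apply: measurable_funM => //; exact: measurable_powR.
Qed.

Lemma measurable_remainder_kernel_enorm r t :
  measurable_fun setT (fun y : N.-tuple R => remainder_kernel mu a n t r (enorm y)).
Proof. by apply: measurable_remainder_kernel => //; exact: measurable_enorm. Qed.

(** The kernel is the sum of its remainder and its profiles, each measurable for all
    radii. *)
Lemma measurable_rkernel r t : 0 < r -> 0 < t ->
  measurable_fun setT (fun y : N.-tuple R => rkernel mu a r (enorm y) t).
Proof.
move=> r0 t0; apply: (@measurable_off_origin _ _ _ (fun y =>
  remainder_kernel mu a n t r (enorm y) + \sum_(j < n.+1) rprofile mu a j r (enorm y) t)).
  apply: measurable_funD; first exact: measurable_remainder_kernel_enorm.
  by apply: measurable_sum => j; exact: measurable_rprofile.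
by move=> y y0; rewrite remainder_kernelE ?enorm_gt0// subrK.
Qed.

Lemma measurable_rem f t : measurable_fun setT (fun y : N.-tuple R => f (enorm y)) ->
  measurable_fun setT (fun r => radial_remainder f r t).
Proof.
move=> mf.
apply: (@measurable_Rintegral_param _ _ (measurableTypeR R) _ R leb
  (fun z => remainder_kernel mu a n t z.1 (enorm z.2) * f (enorm z.2))).
apply: measurable_funM.
  apply: measurable_remainder_kernel => //.
  by apply: (measurableT_comp (@measurable_enorm R N)); exact: measurable_snd.
by apply: (measurableT_comp mf); exact: measurable_snd.
Qed.

Section fixed_profile.
Variable f : R -> R.
Hypothesis mf : measurable_fun setT (fun y : N.-tuple R => f (enorm y)).
Hypothesis ff : (weighted_mass f < +oo)%E.
Variables (r t : R).
Hypotheses (r0 : 0 < r) (t1 : 1 <= t).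

Let t0 : 0 < t. Proof. exact: lt_le_trans t1. Qed.
Let w0 (y : N.-tuple R) : 0 <= moment_weight (enorm y). Proof. exact/moment_weight_ge0/enorm_ge0. Qed.

Lemma rkernel_integrable :
  leb.-integrable setT (fun y => (rkernel mu a r (enorm y) t * f (enorm y))%:E) /\
  `|\int[leb]_y (rkernel mu a r (enorm y) t * f (enorm y))| <= outer_prefactor r t * fine (weighted_mass f).
Proof.
apply: weighted_integrable => //.
- exact: measurable_moment_weight.
- exact: measurable_rkernel.
- by rewrite outer_prefactor_ge0// ltW.
- by move=> y /enorm_gt0 y0; rewrite normrM mulrA ler_wpM2r// rkernel_le_moment_weight.
Qed.

Lemma rkernel_L1_le :
  (\int[leb]_y (`|rkernel mu a r (enorm y) t * f (enorm y)|)%:E <=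
   (outer_prefactor r t * fine (weighted_mass f))%:E)%E.
Proof.
apply: weighted_L1_le => //.
- exact: measurable_moment_weight.
- exact: measurable_rkernel.
- by rewrite outer_prefactor_ge0// ltW.
- by move=> y /enorm_gt0 y0; rewrite normrM mulrA ler_wpM2r// rkernel_le_moment_weight.
Qed.

Lemma rprofile_integrable j : (j <= n)%N ->
  leb.-integrable setT (fun y => (rprofile mu a j r (enorm y) t * f (enorm y))%:E) /\
  `|\int[leb]_y (rprofile mu a j r (enorm y) t * f (enorm y))| <= outer_prefactor r t * fine (weighted_mass f).
Proof.
move=> jn; apply: weighted_integrable => //.
- exact: measurable_moment_weight.
- exact: measurable_rprofile.
- by rewrite outer_prefactor_ge0// ltW.
- by move=> y /enorm_gt0 y0; rewrite normrM mulrA ler_wpM2r// rprofile_le_moment_weight.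
Qed.

Lemma remE : \int[leb]_y (rkernel mu a r (enorm y) t * f (enorm y)) -
  \sum_(j < n.+1) \int[leb]_y (rprofile mu a j r (enorm y) t * f (enorm y)) = radial_remainder f r t.
Proof.
have pint (j : 'I_n.+1) := rprofile_integrable (ltnSE (ltn_ord j)).
rewrite -Rintegral_sum_ord; last by move=> j; have [] := pint j.
rewrite -RintegralB//; last 2 first.
- exact: rkernel_integrable.1.
- rewrite (_ : EFin \o _ = fun y => (\sum_(j < n.+1)
    (rprofile mu a j r (enorm y) t * f (enorm y))%:E)%E); last first.
    by apply/funext => y /=; rewrite sumEFin.
  by apply: integrable_sum => // j _; have [] := pint j.
rewrite /radial_remainder /Rintegral; congr fine; apply: ae_eq_integral => //.
- apply/measurable_EFinP; apply: measurable_funB.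
    by apply: measurable_funM => //; exact: measurable_rkernel.
  apply: measurable_sum => j; apply: measurable_funM => //; exact: measurable_rprofile.
- by apply/measurable_EFinP; apply: measurable_funM => //; exact: measurable_remainder_kernel_enorm.
- apply: filterS (ae_enorm_neq0 N0) => y /enorm_gt0 y0 _.
  by congr EFin; rewrite remainder_kernelE// mulrBl mulr_suml.
Qed.

Lemma rem_integrable :
  leb.-integrable setT (fun y => (remainder_kernel mu a n t r (enorm y) * f (enorm y))%:E) /\
  `|radial_remainder f r t| <= n.+2%:R * outer_prefactor r t * fine (weighted_mass f).
Proof.
apply: weighted_integrable => //.
- exact: measurable_moment_weight.
- exact: measurable_remainder_kernel_enorm.
- by rewrite mulr_ge0// outer_prefactor_ge0// ltW.
- move=> y /enorm_gt0 y0; rewrite normrM mulrA ler_wpM2r// remainder_kernelE//.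
  rewrite (le_trans (ler_normB _ _))// -[n.+2]add1n natrD 2!mulrDl mul1r.
  rewrite lerD ?rkernel_le_moment_weight// (le_trans (ler_norm_sum _ _ _))//.
  rewrite -mulrA mulr_natl -[X in _ *+ X]card_ord -sumr_const ler_sum// => j _.
  by rewrite rprofile_le_moment_weight// -ltnS.
Qed.

(** Data carried by a ball of radius at most [sqrt (2 t)] gain the factor
    [t ^ (- n.+1)]. *)
Lemma rem_le_cutoff (M : R) : M ^+ 2 <= 2 * t -> (forall rho, M < rho -> f rho = 0) ->
  `|radial_remainder f r t| <= outer_prefactor r t * (2 * t) ^- n.+1 * expR (- (2^-1 * (r ^+ 2 / (4 * t)))) *
    fine (weighted_mass f).
Proof.
move=> Mt f0.
have c0 : 0 <= outer_prefactor r t * (2 * t) ^- n.+1 * expR (- (2^-1 * (r ^+ 2 / (4 * t)))).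
  apply: mulr_ge0; last exact: expR_ge0.
  apply: mulr_ge0; first by rewrite outer_prefactor_ge0 ?ltW.
  by rewrite invr_ge0 exprn_ge0// mulr_ge0// ltW.
apply: (@weighted_integrable _ _ N0 (fun y => moment_weight (enorm y))
  (fun y => remainder_kernel mu a n t r (enorm y)) (fun y => f (enorm y)) _ _ _ _ _ w0 _ ff).2 => //.
- exact: measurable_moment_weight.
- exact: measurable_remainder_kernel_enorm.
- move=> y /enorm_gt0; move: (enorm y) => rho rho0.
  have [Mr|rM] := ltP M rho; first by rewrite f0// normr0 !mulr0 normr0.
  rewrite normrM mulrA ler_wpM2r// remainder_kernelE//.
  apply: le_trans (rkernel_remainder_le _ _ _ _ _ _ _) _ => //.
    by rewrite (le_trans _ Mt)// lerXn2r// nnegrE ltW// (lt_le_trans rho0).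
  rewrite kernel_prefactorE ?(ltW r0) ?(ltW rho0)//.
  have -> : 2 * (rho ^+ 2 / (4 * t)) = rho ^+ 2 * (2 * t)^-1 by field; rewrite gt_eqF.
  rewrite exprMn exprVn.
  have -> : outer_prefactor r t * rho `^ (a - mu) * ((rho ^+ 2) ^+ n.+1 * (2 * t) ^- n.+1) *
     expR (- (2^-1 * (r ^+ 2 / (4 * t)))) =
     outer_prefactor r t * (2 * t) ^- n.+1 * expR (- (2^-1 * (r ^+ 2 / (4 * t)))) *
      (rho `^ (a - mu) * (rho ^+ 2) ^+ n.+1).
    by move: (outer_prefactor _ _) (_ `^ _) (_ ^+ n.+1) (_ ^- n.+1) (expR _) => *; ring.
  apply: ler_wpM2l=> //; exact: pow_le_moment_weight (ltW rho0) _.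
Qed.

End fixed_profile.
End remainder_integrals.

(** * Norms in L^p and integrals of powers *)

Lemma cvge0_le {R : realType} {T : Type} (F : set_system T) {FF : Filter F}
    (g : T -> \bar R) : (forall t, 0 <= g t)%E ->
  (forall eps : R, 0 < eps -> \forall t \near F, (g t <= eps%:E)%E) ->
  g @ F --> 0%E.
Proof.
move=> g0 ge; have gfin eps : 0 < eps -> \forall t \near F, `|fine (g t)| <= eps.
  move=> e0; near=> t; have h : (g t <= eps%:E)%E by near: t; exact: ge.
  have gf : g t \is a fin_num by rewrite ge0_fin_numE// (le_lt_trans h)// ltry.
  by rewrite ger0_norm ?fine_ge0// -lee_fin fineK.
apply/fine_cvgP; split.
  near=> t; have h : (g t <= 1%:E)%E by near: t; exact: ge.
  by rewrite ge0_fin_numE// (le_lt_trans h)// ltry.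
apply/cvgr0Pnorm_le => eps e0; exact: gfin.
Unshelve. all: by end_near. Qed.

Lemma measurable_normr_powR d (T : measurableType d) (R : realType) (p : R) (g : T -> R) :
  measurable_fun setT g -> measurable_fun setT (fun x => (`|g x| `^ p)%:E).
Proof.
move=> mg; apply/measurable_EFinP.
apply: (measurableT_comp (f := @powR R ^~ p)); first exact: measurable_powR.
exact: (measurableT_comp (@normr_measurable R setT)).
Qed.

Section Lnorm_real.
Context d (T : measurableType d) (R : realType).
Variable m : {measure set T -> \bar R}.
Local Open Scope ereal_scope.

Lemma LnormE (p : R) (g : T -> R) :
  'N[m]_p%:E[EFin \o g] = (\int[m]_x (`|g x| `^ p)%:E) `^ p^-1.
Proof. by rewrite unlock. Qed.

Lemma Lnorm_le_scale (p c : R) (g h : T -> R) : (0 < p)%R -> (0 <= c)%R ->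
  measurable_fun setT g -> measurable_fun setT h ->
  {ae m, forall x, (`|g x| <= c * `|h x|)%R} ->
  'N[m]_p%:E[EFin \o g] <= c%:E * 'N[m]_p%:E[EFin \o h].
Proof.
move=> p0 c0 mg mh gh; rewrite !LnormE.
have -> : c%:E = ((c `^ p)%:E `^ p^-1) :> \bar R.
  by rewrite poweR_EFin -powRrM mulfV ?gt_eqF// powRr1.
rewrite -poweRM ?lee_fin ?powR_ge0//; last first.
  by apply: integral_ge0 => x _; rewrite lee_fin powR_ge0.
apply: gt0_ler_poweR; rewrite ?invr_ge0 ?(ltW p0)//.
- by rewrite in_itv/= leey andbT; apply: integral_ge0 => x _; rewrite lee_fin powR_ge0.
- rewrite in_itv/= leey andbT mule_ge0// ?lee_fin ?powR_ge0//.
  by apply: integral_ge0 => x _; rewrite lee_fin powR_ge0.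
rewrite -ge0_integralZl//; last 2 first.
- exact: measurable_normr_powR.
- by rewrite lee_fin powR_ge0.
apply: ae_ge0_le_integral => //.
- exact: measurable_normr_powR.
- by move=> x _; rewrite -EFinM lee_fin mulr_ge0 ?powR_ge0.
- by apply: measurable_funeM; exact: measurable_normr_powR.
- apply: filterS gh => x gx _.
  by rewrite -EFinM lee_fin -powRM// ge0_ler_powR ?nnegrE ?mulr_ge0// ltW.
Qed.

Lemma Lnorm_le_ae (p : R) (g h : T -> R) : (0 < p)%R ->
  measurable_fun setT g -> measurable_fun setT h ->
  {ae m, forall x, (`|g x| <= `|h x|)%R} ->
  'N[m]_p%:E[EFin \o g] <= 'N[m]_p%:E[EFin \o h].
Proof.
move=> p0 mg mh gh; rewrite -[leRHS]mul1e; apply: Lnorm_le_scale => //.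
by apply: filterS gh => x; rewrite mul1r.
Qed.

End Lnorm_real.

Lemma measurable_enorm_bool {R : realType} {N : nat} (i : interval R) :
  measurable_fun setT (fun x : N.-tuple R => (enorm x \in i)%:R : R).
Proof.
rewrite (_ : (fun _ => _) = \1_(@enorm R N @^-1` [set` i])); last first.
  apply/funext => x; rewrite indicE; congr ((nat_of_bool _)%:R : R).
  by apply/idP/idP => [h|/set_mem//]; exact: mem_set.
by apply: measurable_indic; apply: measurable_enorm_preimage; exact: measurable_itv.
Qed.

Section power_integrals.
Context {R : realType} {N : nat}.
Hypothesis N0 : (0 < N)%N.
Notation leb := (lebesgueN R N).
Variable b : R.
Hypothesis b0 : 0 < N%:R + b.

Let annpow (k : nat) (x : N.-tuple R) : R :=
  (enorm x \in `]2 ^- k, 1])%:R * enorm x `^ b.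

Let annpow_ge0 k x : 0 <= annpow k x.
Proof. by rewrite mulr_ge0 ?powR_ge0. Qed.

Let measurable_enormX : measurable_fun setT (fun x : N.-tuple R => enorm x `^ b).
Proof.
apply: (measurableT_comp (f := @powR R ^~ b)); first exact: measurable_powR.
exact: measurable_enorm.
Qed.

Let mannpow k : measurable_fun setT (fun x => (annpow k x)%:E).
Proof. by apply/measurable_EFinP; apply: measurable_funM => //; exact: measurable_enorm_bool. Qed.

Let annpowS k x : annpow k.+1 x <= annpow 1 x + 2 `^ (- b) * annpow k (scalev 2 x).
Proof.
rewrite /annpow !in_itv/= enormZ// expr1.
have [h2|h2] := ltP 2^-1 (enorm x).
  have x0 : 0 <= enorm x by apply/ltW/lt_trans/h2.
  rewrite (_ : (2 * enorm x <= 1) = false) ?andbF ?mul0r ?mulr0 ?addr0; last first.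
    by apply/negbTE; rewrite -ltNge; lra.
  rewrite ler_wpM2r ?powR_ge0// ler_nat; case: (_ <= 1); rewrite ?andbF//.
  by rewrite leq_b1.
rewrite mul0r add0r; have [h1|h1] := ltP (2 ^- k.+1) (enorm x); last first.
  by rewrite mul0r mulr_ge0 ?powR_ge0// mulr_ge0 ?powR_ge0.
have x0 : 0 <= enorm x.
  by apply/ltW/lt_trans/h1; rewrite invr_gt0 exprn_gt0.
rewrite (_ : (2 ^- k < 2 * enorm x)); last first.
  by rewrite -ltr_pdivrMl// -invfM -exprS.
rewrite (_ : (2 * enorm x <= 1)); last by lra.
rewrite mul1r powRM// mulrA -powRD ?addNr ?eqxx ?pnatr_eq0//= powRr0 !mul1r.
by rewrite -[leRHS]mul1r ler_wpM2r ?powR_ge0// lern1 leq_b1.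
Qed.

Let annpow1_lty : (\int[leb]_x (annpow 1 x)%:E < +oo)%E.
Proof.
pose c : R := 1 + 2 `^ (- b).
have c0 : 0 <= c by rewrite addr_ge0 ?powR_ge0.
apply: (@le_lt_trans _ _ (\int[leb]_(x in @unit_ball R N) (cst c%:E x))%E).
  rewrite [leRHS]integral_mkcond; apply: ge0_le_integral => //.
  - by move=> x _; rewrite lee_fin.
  - have -> : (cst c%:E) \_ (@unit_ball R N) = (fun x => (c * \1_(@unit_ball R N) x)%:E).
      apply/funext => x; rewrite patchE indicE; case: ifPn => _; rewrite ?mulr1 ?mulr0//.
    apply/measurable_EFinP; apply: measurable_funM => //.
    apply: measurable_indic; exact: measurable_unit_ball.
  move=> x _; rewrite patchE; case: ifPn => [_|]; last first.
    rewrite notin_setE /unit_ball/= => /negP; rewrite -ltNge => h.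
    by rewrite /annpow in_itv/= (_ : (enorm x <= 1) = false) ?andbF ?mul0r// leNgt h.
  rewrite lee_fin /annpow in_itv/= expr1; case: ltP => [h1|_]; last by rewrite mul0r.
  case: (leP (enorm x) 1) => [h2|_] /=; last by rewrite mul0r.
  rewrite mul1r /c; have [b1|b1] := leP 0 b.
    rewrite (@le_trans _ _ 1) ?lerDl ?powR_ge0//.
    suff : enorm x `^ b <= 1 `^ b by rewrite powR1.
    by rewrite ge0_ler_powR ?nnegrE// (le_trans _ (ltW h1)).
  rewrite (@le_trans _ _ (2 `^ (- b))) ?lerDr//.
  have -> : 2 `^ (- b) = 2^-1 `^ b.
    by rewrite -powR_inv1// -powRrM mulN1r.
  rewrite -[b]opprK !(powRN _ (- b)) lef_pV2 ?posrE ?powR_gt0//; last first.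
    by rewrite (lt_trans _ h1).
  by rewrite ge0_ler_powR ?nnegrE ?oppr_ge0 ?(ltW b1) ?(ltW h1)// (le_trans _ (ltW h1)).
rewrite integral_cst//; last exact: measurable_unit_ball.
by rewrite lte_mul_pinfty// ?lee_fin//; exact: unit_ball_lty.
Qed.

(** The integral over the annulus [2 ^- k.+1 < |x| <= 1] is that over
    [2^-1 < |x| <= 1] plus [2 ^- (N + b)] times that over [2 ^- k < |x| <= 1]. *)
Let annpow_le k : (\int[leb]_x (annpow k x)%:E <=
  (fine (\int[leb]_x (annpow 1 x)%:E) / (1 - 2 `^ (- (N%:R + b))))%:E)%E.
Proof.
set I1 := (\int[leb]_x (annpow 1 x)%:E)%E; set q := 2 `^ (- (N%:R + b)).
have I1fin : I1 \is a fin_num.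
  rewrite ge0_fin_numE; first exact: annpow1_lty.
  by apply: integral_ge0 => x _; rewrite lee_fin.
have q1 : q < 1.
  rewrite /q powRN invf_lt1 ?powR_gt0//.
  suff : 1 `^ (N%:R + b) < 2 `^ (N%:R + b) :> R by rewrite powR1.
  by rewrite gt0_ltr_powR ?nnegrE// ltr1n.
have q0 : 0 <= q by exact: powR_ge0.
have I10 : 0 <= fine I1 by apply/fine_ge0/integral_ge0 => x _; rewrite lee_fin.
elim: k => [|k IH].
  rewrite integral0_eq ?lee_fin ?divr_ge0// ?subr_ge0 ?(ltW q1)// => x _.
  by rewrite /annpow in_itv/= expr0 invr1; case: ltP; case: leP; rewrite ?mul0r// => ? ?; exfalso; lra.
have -> : fine I1 / (1 - q) = fine I1 + q * (fine I1 / (1 - q)).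
  by field; rewrite subr_eq0 eq_sym lt_eqF.
apply: (@le_trans _ _ (\int[leb]_x
    ((annpow 1 x)%:E + (2 `^ (- b))%:E * (annpow k (scalev 2 x))%:E))%E).
  apply: ge0_le_integral => //.
  - by move=> x _; rewrite lee_fin.
  - apply: emeasurable_funD => //; apply: measurable_funeM.
    by apply: (measurableT_comp (mannpow k)); exact: measurable_scalevl.
  - by move=> x _; rewrite -EFinM -EFinD lee_fin annpowS.
have ms : measurable_fun setT (fun x : N.-tuple R => (annpow k (scalev 2 x))%:E).
  by apply: (measurableT_comp (mannpow k)); exact: measurable_scalevl.
rewrite ge0_integralD//; last 3 first.
- by move=> x _; rewrite lee_fin.
- by move=> x _; rewrite -EFinM lee_fin mulr_ge0 ?powR_ge0.
- exact: measurable_funeM.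
rewrite ge0_integralZl//; last by move=> x _; rewrite lee_fin.
rewrite (@ge0_integral_scalev R N 2 (fun x => (annpow k x)%:E))//; last first.
  by move=> x; rewrite lee_fin.
rewrite EFinD -/I1 fineK// leeD2l// muleA [leRHS]EFinM -[(_ * (2 ^- N)%:E)%E]EFinM.
rewrite (_ : 2 `^ (- b) / 2 ^+ N = q); last first.
  rewrite /q opprD addrC powRD ?pnatr_eq0 ?implybT//; congr (_ * _).
  by rewrite powRN powR_mulrn.
by rewrite lee_wpmul2l// lee_fin.
Qed.

(** The bound on annuli is uniform, and the annuli exhaust the punctured ball. *)
Lemma power_ball_lty : (\int[leb]_x ((enorm x \in `]-oo, 1])%:R * enorm x `^ b)%R%:E < +oo)%E.
Proof.
have nd x : nondecreasing_seq (fun k => (annpow k x)%:E).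
  move=> i j ij; rewrite lee_fin ler_wpM2r ?powR_ge0// ler_nat !in_itv/=.
  case: (ltP (2 ^- i)) => //= h; rewrite (_ : 2 ^- j < enorm x)//.
  apply: le_lt_trans h; rewrite lef_pV2 ?posrE ?exprn_gt0//.
  by rewrite ler_weXn2l// ler1n.
apply: (@le_lt_trans _ _ (\int[leb]_x (limn (fun k => (annpow k x)%:E)))%E).
  apply: ae_ge0_le_integral => //.
  - by move=> x _; rewrite lee_fin mulr_ge0 ?powR_ge0.
  - by apply/measurable_EFinP; apply: measurable_funM => //; exact: measurable_enorm_bool.
  - move=> x _; apply: lime_ge; first exact: ereal_nondecreasing_is_cvgn.
    by apply: nearW => k; rewrite lee_fin.
  - apply: (@emeasurable_fun_cvg _ _ R setT (fun k x => (annpow k x)%:E)) => // x _.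
    exact: ereal_nondecreasing_is_cvgn.
  apply: filterS (ae_enorm_neq0 N0) => x /enorm_gt0 x0 _.
  apply: lime_ge; first exact: ereal_nondecreasing_is_cvgn.
  have : (2 ^- k : R) @[k --> \oo] --> (0 : R).
    under eq_fun do rewrite -exprVn.
    by apply: cvg_expr; rewrite ger0_norm ?invr_ge0// invf_lt1// ltr1n.
  move=> /(cvgr_lt 0) /(_ _ x0); apply: filterS => k kx.
  by rewrite lee_fin /annpow !in_itv/= kx.
rewrite (monotone_convergence leb measurableT mannpow);
  [|by move=> k x _; rewrite lee_fin|by move=> x _; exact: nd].
apply: le_lt_trans (ltry (fine (\int[leb]_x (annpow 1 x)%:E) / (1 - 2 `^ (- (N%:R + b))))).
apply: lime_le.
  apply: ereal_nondecreasing_is_cvgn => i j ij; apply: ge0_le_integral => //.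
  - by move=> x _; rewrite lee_fin.
  - by move=> x _; exact: nd.
by apply: nearW => k; exact: annpow_le.
Qed.

Definition gausspow (c : R) (x : N.-tuple R) : R := enorm x `^ b * expR (- (c * enorm x ^+ 2)).

Lemma gausspow_ge0 c x : 0 <= gausspow c x.
Proof. by rewrite mulr_ge0 ?powR_ge0 ?expR_ge0. Qed.

Lemma measurable_gausspow c : measurable_fun setT (gausspow c).
Proof.
apply: measurable_funM => //; apply: (measurableT_comp (@measurable_expR R)).
apply: measurableT_comp => //; apply: measurable_funM => //; apply: measurable_funX.
exact: measurable_enorm.
Qed.

Lemma gausspow_lty : (\int[leb]_x (gausspow 2 x)%:E < +oo)%E.
Proof.
pose k := Num.bound `|b|.
have bk : b <= k%:R by rewrite (le_trans (ler_norm _))// ltW// archi_boundP.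
have m1 : measurable_fun setT (fun x : N.-tuple R => ((enorm x \in `]-oo, 1])%:R * enorm x `^ b)%R%:E).
  by apply/measurable_EFinP; apply: measurable_funM => //; exact: measurable_enorm_bool.
have gi := @integrable_radial_gauss R N k.
have m2 := measurable_int _ gi.
have g0 (x : N.-tuple R) : 0 <= gmono k (enorm x).
  by rewrite mulr_ge0 ?exprn_ge0 ?enorm_ge0 ?expR_ge0.
apply: (@le_lt_trans _ _ (\int[leb]_x (((enorm x \in `]-oo, 1])%:R * enorm x `^ b)%R%:E +
    (gmono k (enorm x))%:E))%E).
  apply: ge0_le_integral => //.
  - by move=> x _; rewrite lee_fin gausspow_ge0.
  - by apply/measurable_EFinP; exact: measurable_gausspow.
  - exact: emeasurable_funD.
  move=> x _; rewrite -EFinD lee_fin /gausspow in_itv/=.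
  have [x1|x1] := leP (enorm x) 1.
    rewrite mul1r (@le_trans _ _ (enorm x `^ b)) ?lerDl//.
    rewrite -[leRHS]mulr1 ler_wpM2l ?powR_ge0// -expR0 ler_expR oppr_le0.
    by rewrite mulr_ge0 ?sqr_ge0.
  rewrite mul0r add0r /gmono ler_wpM2r ?expR_ge0// -powR_mulrn ?enorm_ge0//.
  by rewrite ler_powR// ltW.
rewrite ge0_integralD//; last 2 first.
- by move=> x _; rewrite lee_fin mulr_ge0 ?powR_ge0.
- by move=> x _; rewrite lee_fin.
rewrite lte_add_pinfty//; first exact: power_ball_lty.
have /integrableP[_] := gi.
by congr (_ < _)%E; apply: eq_integral => x _; rewrite gee0_abs// lee_fin.
Qed.

Lemma integral_gausspow (c : R) : 0 < c ->
  (\int[leb]_x (gausspow c x)%:E =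
   ((c / 2) `^ (- ((N%:R + b) / 2)))%R%:E * \int[leb]_x (gausspow 2 x)%:E)%E.
Proof.
move=> c0; pose s := Num.sqrt (c / 2).
have s0 : 0 < s by rewrite sqrtr_gt0 divr_gt0.
have s2 : s ^+ 2 = c / 2 by rewrite sqr_sqrtr// ltW// divr_gt0.
have H x : gausspow 2 (scalev s x) = s `^ b * gausspow c x.
  rewrite /gausspow enormZ ?(ltW s0)// powRM ?enorm_ge0 ?(ltW s0)// -mulrA.
  by congr (_ * (_ * expR (- _))); rewrite exprMn s2; field.
have mg := (measurable_EFinP _ _).2 (measurable_gausspow 2).
have := @ge0_integral_scalev R N s (EFin \o gausspow 2) s0 mg
  (fun x => (gausspow_ge0 2 x : (0 <= (gausspow 2 x)%:E)%E)).
under eq_integral do rewrite /= H EFinM.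
rewrite ge0_integralZl//; last 3 first.
- by apply/measurable_EFinP; exact: measurable_gausspow.
- by move=> x _; rewrite lee_fin gausspow_ge0.
- by rewrite lee_fin powR_ge0.
move=> E1.
have -> : (c / 2) `^ (- ((N%:R + b) / 2)) = (s `^ b)^-1 * (s ^+ N)^-1.
  rewrite -s2 -powR_mulrn ?(ltW s0)// -powRrM -invfM -powR_mulrn ?(ltW s0)//.
  rewrite -(@powRD _ s b N%:R) ?(gt_eqF s0) ?implybT//.
  rewrite -powRN; congr (_ `^ _); field=> //.
rewrite EFinM -muleA -E1 muleA -EFinM mulVf ?mul1e//.
by rewrite gt_eqF// powR_gt0.
Qed.

End power_integrals.

(** * Decay of one mode *)

Section mode_decay.
Context {R : realType} {N : nat} (lam p a : R) (n : nat).
Hypotheses (N0 : (0 < N)%N) (p1 : 1 <= p) (a0 : 0 <= a) (nua : nu N lam <= a).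
Hypothesis hb : 0 < N%:R + (a - mu R N) * p.
Notation leb := (lebesgueN R N).
Notation mu := (mu R N).
Notation gam := (gammap N lam p).
Notation weighted_mass := (@weighted_mass R N mu a n).
Notation rem := (@radial_remainder R N mu a n).

Let p0 : 0 < p. Proof. exact: lt_le_trans p1. Qed.
Let b := (a - mu) * p.
Let E := (N%:R + b) / 2 / p.

(** The powers of [t] add up to [- 1 - (a - nu) / 2]: the [L^p] norm of the Gaussian
    profile contributes [t ^ E], which cancels the dependence on [p] of [gammap]. *)
Lemma decay_exponent (t : R) : 1 <= t ->
  t `^ (gam + n%:R) * ((2 * t)^-1 * (4 * t) `^ (- a) * (2 * t) ^- n.+1) *
    (p / (8 * t) / 2) `^ (- E) <=
  2^-1 * 4 `^ (- a) * 2 ^- n.+1 * (p / 16) `^ (- E) * t^-1.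
Proof.
move=> t1; have t0 : 0 < t by exact: lt_le_trans t1.
have tn0 : t != 0 by rewrite gt_eqF.
have pw x y : t `^ (x + y) = t `^ x * t `^ y by rewrite powRD// tn0 implybT.
have -> : p / (8 * t) / 2 = p / 16 * t^-1 by field.
have p16 : 0 <= p / 16 by rewrite divr_ge0// ltW.
rewrite (powRM _ p16) ?invr_ge0 ?(ltW t0)//.
have -> : t^-1 `^ (- E) = t `^ E.
  by rewrite -powR_inv1 ?(ltW t0)// -powRrM; congr (_ `^ _); ring.
rewrite (powRM _ (_ : 0 <= 4) (ltW t0))// exprMn 2!invfM.
have -> : t ^- n.+1 = t `^ (- n.+1%:R) by rewrite powRN powR_mulrn// ltW.
have H : t `^ (gam + n%:R) * t `^ (- a) * t `^ (- n.+1%:R) * t `^ E <= 1.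
  rewrite -!pw -[leRHS](powRr0 t) ler_powR//.
  have -> : gam + n%:R - a - n.+1%:R + E = - ((a - nu N lam) / 2).
    by rewrite /gammap /E /b /Defs.mu -natr1; field; rewrite gt_eqF.
  by rewrite oppr_le0 divr_ge0// subr_ge0.
have c0 : 0 <= 2^-1 * 4 `^ (- a) * 2 ^- n.+1 * (p / 16) `^ (- E) * t^-1.
  by rewrite !mulr_ge0 ?powR_ge0 ?invr_ge0 ?exprn_ge0 ?(ltW t0).
rewrite -[leRHS]mulr1; apply: le_trans (ler_wpM2l c0 H).
rewrite le_eqVlt; apply/orP; left; apply/eqP.
move: (2^-1) (4 `^ _) (2 ^- _) ((p / 16) `^ _) (t^-1) (t `^ _) (t `^ _) (t `^ _) (t `^ _).
by move=> *; ring.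
Qed.

Lemma Lnorm_profile (t : R) : 0 < t ->
  ('N[leb]_p%:E[EFin \o (fun x : N.-tuple R =>
     enorm x `^ (a - mu) * expR (- (2^-1 * (enorm x ^+ 2 / (4 * t)))))%R] =
  ((p / (8 * t) / 2) `^ (- E) *
    (fine (\int[leb]_x (gausspow b 2 x)%:E)) `^ p^-1)%R%:E)%E.
Proof.
move=> t0; rewrite LnormE.
under eq_integral => x _.
  rewrite ger0_norm ?mulr_ge0 ?powR_ge0 ?expR_ge0// powRM ?powR_ge0 ?expR_ge0//.
  rewrite -powRrM -/b -expRM.
  rewrite (_ : - (2^-1 * (enorm x ^+ 2 / (4 * t))) * p = - (p / (8 * t) * enorm x ^+ 2)).
    over.
  by field; rewrite gt_eqF.
have gfin : (\int[leb]_x (gausspow b 2 x)%:E)%E \is a fin_num.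
  rewrite ge0_fin_numE; first exact: (gausspow_lty N0 hb).
  by apply: integral_ge0 => x _; rewrite lee_fin gausspow_ge0.
transitivity ((\int[leb]_x (gausspow b (p / (8 * t)) x)%:E) `^ p^-1)%E; first by [].
rewrite integral_gausspow; last by rewrite divr_gt0// mulr_gt0.
have J0 : 0 <= fine (\int[leb]_x (gausspow b 2 x)%:E).
  by apply/fine_ge0/integral_ge0 => x _; rewrite lee_fin gausspow_ge0.
rewrite -(fineK gfin) -EFinM poweR_EFin (powRM _ (powR_ge0 _ _) J0).
by rewrite -powRrM /E !mulNr.
Qed.

(** For data supported in such a ball the remainder is of the order of the first
    omitted profile, which gains [1 / t]. *)
Lemma mode_decay : exists2 K : R, 0 <= K & forall (f : R -> R) (M t : R),
  measurable_fun setT (fun y : N.-tuple R => f (enorm y)) -> (weighted_mass f < +oo)%E ->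
  1 <= t -> M ^+ 2 <= 2 * t -> (forall rho, M < rho -> f rho = 0) ->
  ((t `^ (gam + n%:R))%:E * 'N[leb]_p%:E[EFin \o (fun x => rem f (enorm x) t)] <=
   (K / t)%:E * weighted_mass f)%E.
Proof.
set J := (fine (\int[leb]_x (gausspow b 2 x)%:E)) `^ p^-1.
have J0 : 0 <= J by exact: powR_ge0.
have G0 : 0 < Gamma (a + 1) by rewrite Gamma_gt0// lerDr.
exists (2^-1 * 4 `^ (- a) * 2 ^- n.+1 * (p / 16) `^ (- E) * (J / Gamma (a + 1))).
  by rewrite !mulr_ge0 ?powR_ge0 ?invr_ge0 ?exprn_ge0 ?(ltW G0).
move=> f M t mf ff t1 Mt fM; have t0 : 0 < t by exact: lt_le_trans t1.
have w0 : (0 <= weighted_mass f)%E.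
  apply: integral_ge0 => y _; rewrite lee_fin mulr_ge0//.
  exact/moment_weight_ge0/enorm_ge0.
have wfin : weighted_mass f \is a fin_num by rewrite ge0_fin_numE.
pose c := (2 * t)^-1 * (4 * t) `^ (- a) * (2 * t) ^- n.+1 / Gamma (a + 1) * fine (weighted_mass f).
have c0 : 0 <= c.
  by rewrite !mulr_ge0 ?powR_ge0 ?invr_ge0 ?exprn_ge0 ?(ltW G0) ?fine_ge0 ?mulr_ge0 ?(ltW t0).
have mH : measurable_fun setT (fun x : N.-tuple R =>
     enorm x `^ (a - mu) * expR (- (2^-1 * (enorm x ^+ 2 / (4 * t))))).
  apply: measurable_funM.
    apply: (measurableT_comp (f := @powR R ^~ (a - mu))); first exact: measurable_powR.
    exact: measurable_enorm.
  apply: (measurableT_comp (@measurable_expR R)); apply: measurableT_comp => //.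
  apply: measurable_funM => //; apply: measurable_funM => //; apply: measurable_funX.
  exact: measurable_enorm.
apply: (@le_trans _ _ ((t `^ (gam + n%:R))%:E * (c%:E * 'N[leb]_p%:E[EFin \o
   (fun x : N.-tuple R => enorm x `^ (a - mu) *
      expR (- (2^-1 * (enorm x ^+ 2 / (4 * t)))))%R]))%E).
  rewrite lee_wpmul2l ?lee_fin ?powR_ge0//; apply: Lnorm_le_scale => //.
    apply: (measurableT_comp (f := fun r => rem f r t)); last exact: measurable_enorm.
    exact: measurable_rem.
  apply: filterS (ae_enorm_neq0 N0) => x /enorm_gt0 x0.
  apply: le_trans (rem_le_cutoff N0 a0 mf ff x0 t1 Mt fM) _.
  rewrite [X in c * X]ger0_norm ?mulr_ge0 ?powR_ge0 ?expR_ge0// /c /outer_prefactor.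
  rewrite le_eqVlt; apply/orP; left; apply/eqP.
  move: (expR _) (2 * t)^-1 ((4 * t) `^ _) ((2 * t) ^- _) (Gamma _)^-1 (fine _) (enorm x `^ _).
  by move=> *; ring.
rewrite Lnorm_profile// -/J -[in leRHS](fineK wfin) -!EFinM lee_fin.
have := decay_exponent t1; move/(ler_wpM2r (_ : 0 <= J / Gamma (a + 1) * fine (weighted_mass f))).
rewrite mulr_ge0 ?divr_ge0 ?(ltW G0) ?fine_ge0// => /(_ isT) H.
apply: le_trans (le_trans _ H) _; rewrite le_eqVlt; apply/orP; left; apply/eqP; rewrite /c.
  move: (t `^ _) (2 * t)^-1 ((4 * t) `^ _) ((2 * t) ^- _) (Gamma _)^-1 (fine _) (_ `^ (- E)).
  by move=> *; ring.
move: (2^-1) (4 `^ _) (2 ^- _) (t^-1) (Gamma _)^-1 (fine _) (_ `^ (- E)).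
by move=> *; ring.
Qed.

(** Dominated convergence: distant data carry little weight. *)
Lemma weighted_mass_tail (f : R -> R) (eps : R) :
  measurable_fun setT (fun y : N.-tuple R => f (enorm y)) -> (weighted_mass f < +oo)%E -> 0 < eps ->
  exists M : nat, (weighted_mass (fun rho => (rho \in `]M%:R, +oo[)%R%:R * f rho)%R <= eps%:E)%E.
Proof.
move=> mf ff eps0.
pose g (k : nat) (y : N.-tuple R) :=
  (moment_weight mu a n (enorm y) * `|(enorm y \in `]k%:R, +oo[)%:R * f (enorm y)|)%:E.
have w0 (y : N.-tuple R) : 0 <= moment_weight mu a n (enorm y) by exact/moment_weight_ge0/enorm_ge0.
have mg k : measurable_fun setT (g k).
  apply/measurable_EFinP; apply: measurable_funM; first exact: measurable_moment_weight.
  apply: (measurableT_comp (@normr_measurable R setT)).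
  by apply: measurable_funM => //; exact: measurable_enorm_bool.
have mwf : measurable_fun setT (fun y : N.-tuple R => (moment_weight mu a n (enorm y) * `|f (enorm y)|)%:E).
  apply/measurable_EFinP; apply: measurable_funM; first exact: measurable_moment_weight.
  exact: (measurableT_comp (@normr_measurable R setT)).
have iwf : leb.-integrable setT (fun y : N.-tuple R => (moment_weight mu a n (enorm y) * `|f (enorm y)|)%:E).
  apply/integrableP; split => //; move: ff; rewrite /weighted_mass.
  by congr (_ < _)%E; apply: eq_integral => y _; rewrite gee0_abs// lee_fin mulr_ge0.
have := @dominated_convergence _ _ R leb setT measurableT g (cst 0%E)
  (fun y : N.-tuple R => (moment_weight mu a n (enorm y) * `|f (enorm y)|)%:E) mg (measurable_cst _).
case=> //.
- apply: aeW => y _; apply: cvg_near_cst.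
  near=> k; rewrite /g in_itv/= andbT ltNge.
  rewrite (_ : enorm y <= k%:R) ?mul0r ?normr0 ?mulr0//.
  by near: k; exact: nbhs_infty_ger.
- apply: aeW => y k _; rewrite /g gee0_abs; last by rewrite lee_fin mulr_ge0.
  rewrite lee_fin; apply: ler_wpM2l => //.
  by rewrite normrM ler_piMl// normr_nat lern1 leq_b1.
move=> _ _; rewrite integral0_eq => [H|//].
have /fine_cvgP[Hfin /cvgr0Pnorm_le /(_ _ eps0) Hle] := H.
have [k hk] : exists k, (\int[leb]_y g k y)%E \is a fin_num /\
    `|fine (\int[leb]_y g k y)%E| <= eps.
  near \oo%classic => k; exists k; split; near: k; [exact: Hfin|exact: Hle].
exists k; change (\int[leb]_y g k y <= eps%:E)%E.
case: hk => hf hk; rewrite -(fineK hf) lee_fin; exact: le_trans (ler_norm _) hk.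
Unshelve. all: by end_near. Qed.

End mode_decay.

Section mode_limit.
Context {R : realType} {N : nat} (lam p : R) (n l : nat).
Hypotheses (hN : (3 <= N)%N) (hlam0 : 0 <= lam) (hlam : lam <= (N%:R - 2) ^+ 2 / 4).
Hypotheses (p1 : 1 <= p) (hp : (p%:E < p_upper N lam)%E).
Notation leb := (lebesgueN R N).
Notation mu := (mu R N).
Notation a := (nul N lam l).
Notation gam := (gammap N lam p).
Notation weighted_mass := (@weighted_mass R N mu a n).
Notation rem := (@radial_remainder R N mu a n).

Let N0 : (0 < N)%N. Proof. exact: leq_trans hN. Qed.
Let p0 : 0 < p. Proof. exact: lt_le_trans p1. Qed.
Let a0 : 0 <= a. Proof. exact: nul_ge0. Qed.

Lemma weighted_mass_ge0 f : (0 <= weighted_mass f)%E.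
Proof.
by apply: integral_ge0 => y _; rewrite lee_fin mulr_ge0// moment_weight_ge0// enorm_ge0.
Qed.

Lemma weighted_mass_le (f g : R -> R) :
  measurable_fun setT (fun y : N.-tuple R => f (enorm y)) ->
  measurable_fun setT (fun y : N.-tuple R => g (enorm y)) ->
  (forall rho, `|f rho| <= `|g rho|) -> (weighted_mass f <= weighted_mass g)%E.
Proof.
move=> mf mg fg.
have m (h : R -> R) : measurable_fun setT (fun y : N.-tuple R => h (enorm y)) ->
    measurable_fun setT (fun y : N.-tuple R => (moment_weight mu a n (enorm y) * `|h (enorm y)|)%:E).
  move=> mh; apply/measurable_EFinP; apply: measurable_funM; first exact: measurable_moment_weight.
  exact: (measurableT_comp (@normr_measurable R setT)).
apply: ge0_le_integral => //.
- by move=> y _; rewrite lee_fin mulr_ge0// moment_weight_ge0// enorm_ge0.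
- exact: m.
- exact: m.
- by move=> y _; rewrite lee_fin ler_wpM2l// moment_weight_ge0// enorm_ge0.
Qed.

Lemma profileE j f (x : N.-tuple R) t : (j <= n)%N -> wL1 N lam l n f -> enorm x != 0 -> 1 <= t ->
  profile lam l j f x t =
  \int[leb]_y (rprofile mu a j (enorm x) (enorm y) t * f (enorm y)).
Proof.
move=> jn [/(measurable_radial (N := N)) mf ff] /enorm_gt0 x0 t1.
have : leb.-integrable setT
    (fun y : N.-tuple R => (enorm y `^ (a - mu + 2 * j%:R) * f (enorm y))%:E).
  apply: (@weighted_integrable _ _ N0 (fun y => moment_weight mu a n (enorm y))
    (fun y => enorm y `^ (a - mu + 2 * j%:R)) (fun y => f (enorm y)) 1 _ _ mf _ _ _ ff).1 => //.
  - exact: measurable_moment_weight.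
  - apply: (measurableT_comp (f := @powR R ^~ (a - mu + 2 * j%:R))).
      exact: measurable_powR.
    exact: measurable_enorm.
  - by move=> y; rewrite moment_weight_ge0// enorm_ge0.
  - move=> y /enorm_gt0 y0; rewrite mul1r normrM ler_wpM2r// ger0_norm ?powR_ge0//.
    apply: le_trans (pow_le_moment_weight mu a (enorm_ge0 y) (leqW jn)).
    rewrite powRD ?(gt_eqF y0) ?implybT// ler_wpM2l ?powR_ge0//.
    by rewrite -natrM powR_mulrn ?enorm_ge0// exprM.
move=> fi; rewrite /profile /moment; set ex := expR _; rewrite -3!mulrA.
rewrite -RintegralZr//; congr fine; apply: eq_integral => y _; congr EFin.
by rewrite /rprofile -/ex; ring.
Qed.

Lemma remainderE f x t : wL1 N lam l n f -> enorm x != 0 -> 1 <= t ->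
  \int[leb]_y (kl lam l x y t * f (enorm y)) - \sum_(j < n.+1) profile lam l j f x t =
  rem f (enorm x) t.
Proof.
move=> wf x0 t1; have [/(measurable_radial (N := N)) mf ff] := wf.
rewrite -(remE N0 a0 mf ff (enorm_gt0 x0) t1); congr (_ - _).
by apply: eq_bigr => j _; rewrite profileE// -ltnS.
Qed.

Lemma measurable_rem_enorm f t : measurable_fun setT (fun y : N.-tuple R => f (enorm y)) ->
  measurable_fun setT (fun x : N.-tuple R => rem f (enorm x) t).
Proof.
move=> mf; apply: (measurableT_comp (f := fun r => rem f r t)); last exact: measurable_enorm.
exact: measurable_rem.
Qed.

Variable C : R.
Hypothesis hC : radial_remainder_bound N lam l n p C.

Lemma Lnorm_rem_le f t : wL1 N lam l n f -> 1 <= t ->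
  ((t `^ (gam + n%:R))%:E * 'N[leb]_p%:E[EFin \o (fun x => rem f (enorm x) t)] <=
   C%:E * weighted_mass f)%E.
Proof.
move=> wf t1; have [/(measurable_radial (N := N)) mf ff] := wf.
apply: le_trans (hC wf t1); rewrite lee_wpmul2l ?lee_fin ?powR_ge0//.
have mr := measurable_rem_enorm t mf.
apply: Lnorm_le_ae => //.
  apply: (measurable_off_origin mr) => x x0; exact: remainderE.
by apply: filterS (ae_enorm_neq0 N0) => x x0; rewrite remainderE.
Qed.

(** The datum is cut at a radius [M]. The outer part is small uniformly in [t] by the
    remainder estimate, the inner part decays like [1 / t] once [M ^ 2 <= 2 t]. *)
Lemma mode_cvg f : wL1 N lam l n f ->
  ((t `^ (gam + n%:R))%:E * 'N[leb]_p%:E[EFin \o (fun x => rem f (enorm x) t)])%E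
  @[t --> +oo%R] --> 0%E.
Proof.
move=> wf; have [mf0 ff] := wf; have mf := measurable_radial mf0 (N := N).
have hb : 0 < N%:R + (a - mu) * p by exact: p_upperP.
have [K K0 hK] := mode_decay n N0 p1 a0 (nu_le_nul lam hN l) hb.
apply: cvge0_le => [t|eps eps0].
  by rewrite mule_ge0 ?Lnorm_ge0// lee_fin powR_ge0.
have e2 : 0 < eps / 2 / (`|C| + 1) by rewrite !divr_gt0// ltr_wpDl.
have [M hM] := weighted_mass_tail mf ff e2.
pose f1 rho := (rho \in `]-oo, (M%:R : R)])%:R * f rho.
pose f2 rho := (rho \in `](M%:R : R), +oo[)%:R * f rho.
have mf1 : measurable_fun setT (fun y : N.-tuple R => f1 (enorm y)).
  by apply: measurable_funM => //; exact: measurable_enorm_bool.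
have mf2 : measurable_fun setT (fun y : N.-tuple R => f2 (enorm y)).
  by apply: measurable_funM => //; exact: measurable_enorm_bool.
have nb (b : bool) (u : R) : `|b%:R * u| <= `|u|.
  by rewrite normrM ler_piMl// normr_nat lern1 leq_b1.
have ff1 : (weighted_mass f1 < +oo)%E by apply: le_lt_trans ff; apply: weighted_mass_le => // rho; exact: nb.
have ff2 : (weighted_mass f2 < +oo)%E by apply: le_lt_trans ff; apply: weighted_mass_le => // rho; exact: nb.
have wf2 : wL1 N lam l n f2.
  split=> //; apply: measurable_funM => //.
  rewrite (_ : (fun _ => _) = \1_([set` `](M%:R : R), +oo[])) //.
  apply/funext => rho; rewrite indicE; congr ((nat_of_bool _)%:R : R).
  by apply/idP/idP => [h|/set_mem//]; exact: mem_set.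
have split_f t x : enorm x != 0 -> 1 <= t ->
    rem f (enorm x) t = rem f1 (enorm x) t + rem f2 (enorm x) t.
  move=> /enorm_gt0 x0 t1; rewrite /radial_remainder -RintegralD//; last 2 first.
  - exact: (rem_integrable N0 a0 mf1 ff1 x0 t1).1.
  - exact: (rem_integrable N0 a0 mf2 ff2 x0 t1).1.
  congr fine; apply: eq_integral => y _; congr EFin; rewrite -mulrDr -mulrDl.
  by rewrite !in_itv/= andbT; case: leP; rewrite ?addr0 ?add0r mul1r.
near=> t; have t1 : 1 <= t by near: t; exact: nbhs_pinfty_ge.
have t0 : 0 < t by exact: lt_le_trans t1.
apply: (@le_trans _ _ ((t `^ (gam + n%:R))%:E *
  ('N[leb]_p%:E[EFin \o (fun x => rem f1 (enorm x) t)] +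
   'N[leb]_p%:E[EFin \o (fun x => rem f2 (enorm x) t)]))%E).
  rewrite lee_wpmul2l ?lee_fin ?powR_ge0//.
  have m1 := measurable_rem_enorm t mf1; have m2 := measurable_rem_enorm t mf2.
  apply: le_trans (minkowski_EFin leb m1 m2 p1); apply: Lnorm_le_ae => //.
  - exact: measurable_rem_enorm.
  - exact: measurable_funD.
  - by apply: filterS (ae_enorm_neq0 N0) => x x0; rewrite split_f.
rewrite ge0_muleDr ?Lnorm_ge0//.
rewrite [X in (_ <= X%:E)%E](splitr eps) EFinD leeD//.
  apply: le_trans (hK f1 M%:R t mf1 ff1 t1 _ _) _.
  - have : (M%:R ^+ 2 : R) <= t by near: t; exact: nbhs_pinfty_ge.
    by move=> h; rewrite (le_trans h)// ler_peMl// ?ler1n// ltW.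
  - by move=> rho; rewrite ltNge /f1 in_itv/= => /negbTE->; rewrite mul0r.
  have w1 : weighted_mass f1 \is a fin_num by rewrite ge0_fin_numE// weighted_mass_ge0.
  rewrite -(fineK w1) -EFinM lee_fin mulrAC ler_pdivrMr// -ler_pdivrMl ?divr_gt0//.
apply: le_trans (Lnorm_rem_le wf2 t1) _.
have w2 : weighted_mass f2 \is a fin_num by rewrite ge0_fin_numE// weighted_mass_ge0.
have w20 : 0 <= fine (weighted_mass f2) by rewrite fine_ge0// weighted_mass_ge0.
move: hM; rewrite -(fineK w2) -EFinM !lee_fin ler_pdivlMr ?ltr_wpDl// => hM.
rewrite (le_trans _ hM)// mulrC ler_wpM2l//.
by rewrite (le_trans (ler_norm _))// lerDl.
Unshelve. all: by end_near. Qed.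

End mode_limit.

(** * A lower bound for admissible constants *)

Section shells.
Context {R : realType} {N : nat}.
Hypothesis N0 : (0 < N)%N.
Notation leb := (lebesgueN R N).

Lemma shell_measure (s : R) : 0 < s ->
  exists2 v : R, 0 < v & (\int[leb]_x ((enorm x \in `[s, (2 * s)])%R%:R)%:E = v%:E)%E.
Proof.
move=> s0; pose S : set (N.-tuple R) := @enorm R N @^-1` `[s, 2 * s].
have mS : measurable S by apply: measurable_enorm_preimage; exact: measurable_itv.
have mB (x : R) : measurable (@enorm R N @^-1` `]-oo, x[).
  by apply: measurable_enorm_preimage; exact: measurable_itv.
have -> : (\int[leb]_x ((enorm x \in `[s, (2 * s)])%R%:R)%:E = leb S)%E.
  rewrite -(setIT S) -integral_indic//; apply: eq_integral => x _.
  rewrite indicE; congr ((nat_of_bool _)%:R)%:E.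
  by apply/idP/idP => [h|/set_mem//]; exact: mem_set.
have V0 := @V_gt0 R N.
have Slty : (leb S < +oo)%E.
  apply: (@le_lt_trans _ _ (leb (@enorm R N @^-1` `]-oo, (3 * s)%R[))).
    apply: le_measure; rewrite ?inE// => x; rewrite /S/= !in_itv/= => /andP[_ h].
    by rewrite (le_lt_trans h)// ltr_pM2r// ltr_nat.
  by rewrite ball_open_ray// ltry.
have Sfin : leb S \is a fin_num by rewrite ge0_fin_numE.
exists (fine (leb S)); last by rewrite fineK.
rewrite -lte_fin fineK//.
have le2 : (leb (@enorm R N @^-1` `]-oo, (2 * s)%R[) <=
            leb (@enorm R N @^-1` `]-oo, s[) + leb S)%E.
  apply: le_trans (measureU2 _ _ _) => //.
  apply: le_measure; rewrite ?inE//; first exact: measurableU.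
  move=> x; rewrite /S/= !in_itv/= => h.
  by have [h1|h1] := ltP (enorm x) s; [left|right]; rewrite /= ?in_itv/= ?h1 ?ltW.
move: le2; rewrite !ball_open_ray// -(fineK Sfin) -EFinD lee_fin lte_fin.
rewrite !(max_idPl _) ?mulr_ge0 ?(ltW s0)// s0 mulr_gt0// => le2.
have : 0 < s ^+ N * fine (leb (@unit_ball R N)) by rewrite mulr_gt0 ?exprn_gt0.
have : 2 <= (2 : R) ^+ N by rewrite -natrX ler_nat -[X in (X <= _)%N]expn1 leq_pexp2l.
rewrite !mulr1n exprMn in le2.
move: le2; move: (s ^+ N) (fine (leb (@unit_ball R N))) (2 ^+ N) (fine (leb S)) => u v w z h1 h2 h3.
nra.
Qed.

End shells.

Section constant_lower_bound.
Context {R : realType} {N : nat} (lam p : R) (n : nat).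
Hypotheses (hN : (3 <= N)%N) (hlam0 : 0 <= lam) (hlam : lam <= (N%:R - 2) ^+ 2 / 4).
Hypotheses (p1 : 1 <= p).
Notation leb := (lebesgueN R N).
Notation mu := (mu R N).

Let N0 : (0 < N)%N. Proof. exact: leq_trans hN. Qed.
Let p0 : 0 < p. Proof. exact: lt_le_trans p1. Qed.

Let shell (rho : R) : R := (rho \in `[1, 2])%:R.

Let mshell : measurable_fun setT (fun x : N.-tuple R => shell (enorm x)).
Proof. exact: measurable_enorm_bool. Qed.

Lemma weighted_mass_shell : exists2 D : R, 0 < D & forall l,
  exists2 w : R, 0 < w <= 2 `^ (nul N lam l) * D & @weighted_mass R N mu (nul N lam l) n shell = w%:E.
Proof.
have [v v0 hv] := shell_measure N0 (ltr01 : 0 < 1 :> R); rewrite mulr1 in hv.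
pose c : R := 1 + 2 ^+ (2 * n + 2).
have c0 : 0 < c by rewrite ltr_wpDr// exprn_ge0.
exists (c * v) => [|l]; first by rewrite mulr_gt0.
set a := nul N lam l; have a0 : 0 <= a by exact: nul_ge0.
have mu0 : 0 <= mu by exact/ltW/mu_gt0.
have m1 (k : R) : measurable_fun setT (fun x : N.-tuple R => (k * shell (enorm x))%:E).
  by apply/measurable_EFinP; exact: measurable_funM.
have I1 (k : R) : 0 <= k -> (\int[leb]_x (k * shell (enorm x))%:E = (k * v)%:E)%E.
  move=> k0; under eq_integral do rewrite EFinM.
  rewrite ge0_integralZl//; last by move=> x _; rewrite lee_fin.
    by rewrite hv.
  exact/measurable_EFinP.
have mw : measurable_fun setT
    (fun x : N.-tuple R => (moment_weight mu a n (enorm x) * `|shell (enorm x)|)%:E).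
  apply/measurable_EFinP; apply: measurable_funM; first exact: measurable_moment_weight.
  exact: (measurableT_comp (@normr_measurable R setT)).
have s0 rho : 0 <= shell rho by [].
have up : (@weighted_mass R N mu a n shell <= (2 `^ a * c * v)%:E)%E.
  rewrite -I1; last by rewrite mulr_ge0 ?powR_ge0 ?(ltW c0).
  apply: ge0_le_integral => //.
  - by move=> y _; rewrite lee_fin mulr_ge0// moment_weight_ge0// enorm_ge0.
  move=> y _; rewrite lee_fin ger0_norm// /shell in_itv/=.
  have [/andP[y1 y2]|_] := boolP (1 <= enorm y <= 2); last by rewrite !mulr0.
  rewrite !mulr1.
  rewrite ler_pM ?powR_ge0 ?addr_ge0 ?exprn_ge0 ?enorm_ge0//.
    rewrite (@le_trans _ _ (enorm y `^ a))//.
      by rewrite ler_powR// gerBl.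
    by rewrite ge0_ler_powR ?nnegrE// enorm_ge0.
  by rewrite lerD2l lerXn2r ?nnegrE ?enorm_ge0.
have lo : ((2 `^ (- mu) * v)%:E <= @weighted_mass R N mu a n shell)%E.
  rewrite -I1 ?powR_ge0//; apply: ge0_le_integral => //.
  - by move=> y _; rewrite lee_fin mulr_ge0 ?powR_ge0.
  move=> y _; rewrite lee_fin [`|shell _|]ger0_norm// /shell in_itv/=.
  have [/andP[y1 y2]|_] := boolP (1 <= enorm y <= 2); last by rewrite !mulr0.
  have y0 : 0 < enorm y by exact: lt_le_trans y1.
  rewrite !mulr1 (@le_trans _ _ (enorm y `^ (a - mu)))//; last first.
    by rewrite ler_peMr ?powR_ge0// lerDl exprn_ge0// ltW.
  rewrite (@le_trans _ _ (enorm y `^ (- mu)))//.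
    by rewrite !powRN lef_pV2 ?posrE ?powR_gt0// ge0_ler_powR ?nnegrE ?(ltW y0).
  by rewrite ler_powR// lerDr.
have fw : @weighted_mass R N mu a n shell \is a fin_num.
  by rewrite fin_numElt (lt_le_trans _ lo) ?ltNyr// (le_lt_trans up) ?ltry.
exists (fine (@weighted_mass R N mu a n shell)); last by rewrite fineK.
rewrite -lte_fin -lee_fin fineK// mulrA up andbT (lt_le_trans _ lo)// lte_fin.
by rewrite mulr_gt0// powR_gt0.
Qed.

Lemma wL1_shell l : wL1 N lam l n shell.
Proof.
split; last first.
  have [D _ /(_ l)[w _ hw]] := weighted_mass_shell.
  by change (@weighted_mass R N mu (nul N lam l) n shell < +oo)%E; rewrite hw ltry.
rewrite (_ : shell = \1_([set` `[(1 : R), 2]])); last first.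
  apply/funext => rho; rewrite indicE; congr ((nat_of_bool _)%:R : R).
  by apply/idP/idP => [h|/set_mem//]; exact: mem_set.
exact: measurable_indic.
Qed.

Lemma radial_constant_ge0 l C : radial_remainder_bound N lam l n p C -> 0 <= C.
Proof.
move=> hC; have := Lnorm_rem_le hN p1 hC (wL1_shell l) (lexx 1).
have [D _ /(_ l)[w /andP[w0 _] ->]] := weighted_mass_shell.
rewrite powR1 mul1e => h; have : (0 <= C%:E * w%:E)%E by apply: le_trans h; exact: Lnorm_ge0.
by rewrite -EFinM lee_fin pmulr_lge0.
Qed.

(** Testing the remainder estimate on the indicator of the shell [1 <= |y| <= 2]
    at time [1]: at radii in [[A, 2 * A]] the remainder is comparable to the
    prefactor of the kernel as soon as the Bessel index is large. *)
Lemma rem_shell_ge (A : R) : 1 <= A -> exists2 k : R, 0 < k & exists l0, forall l r, (l0 <= l)%N ->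
  A <= r <= 2 * A ->
  k * (4 `^ (- nul N lam l) * A `^ (nul N lam l) / Gamma (nul N lam l + 1)) <=
  `|@radial_remainder R N mu (nul N lam l) n shell r 1|.
Proof.
move=> A1; have A0 : 0 < A by exact: lt_le_trans A1.
have [v v0 hv] := shell_measure N0 (ltr01 : 0 < 1 :> R); rewrite mulr1 in hv.
have F0 : 0 < n.+1`!%:R :> R by rewrite ltr0n fact_gt0.
pose k0 : R := expR (- A ^+ 2) * (4^-1 * (4 ^- n.+1 / n.+1`!%:R)).
have k00 : 0 < k0.
  by rewrite mulr_gt0 ?expR_gt0 ?mulr_gt0 ?invr_gt0 ?exprn_gt0.
exists (2^-1 * A `^ (- mu) * k0 * v).
  by do 3! (apply: mulr_gt0; rewrite ?powR_gt0 ?invr_gt0//).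
(* From [l1] on the index is large enough for [rkernel_remainder_ge], uniformly in
   the two shells; from [l2] on the exponent [a - mu] is nonnegative. *)
pose l1 := Num.bound (4 * n.+1`!%:R * expR (A ^+ 2) * 4 ^+ n.+1).
pose l2 := Num.bound mu.
exists (maxn l1 l2) => l r; rewrite geq_max => /andP[l1l l2l] /andP[rA1 rA2].
set a := nul N lam l; have a0 : 0 <= a by exact: nul_ge0.
have mu0 : 0 <= mu by exact/ltW/mu_gt0.
have la : l%:R <= a by exact: nul_ge.
have mua : mu <= a.
  rewrite (le_trans _ la)// (le_trans (ltW (archi_boundP _)))// ler_nat//.
have r0 : 0 < r by exact: lt_le_trans rA1.
have z1 : r ^+ 2 / (4 * 1) <= A ^+ 2.
  rewrite mulr1 ler_pdivrMr//.
  have -> : A ^+ 2 * 4 = (2 * A) ^+ 2 by ring.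
  by rewrite lerXn2r ?nnegrE ?mulr_ge0 ?(ltW r0) ?(ltW A0).
have G0 : 0 < Gamma (a + 1) by rewrite Gamma_gt0// lerDr.
pose K := 2^-1 * 4 `^ (- a) * A `^ (a - mu) / Gamma (a + 1) * k0.
have K0 : 0 <= K by rewrite !mulr_ge0 ?powR_ge0 ?invr_ge0 ?(ltW G0) ?(ltW k00).
have low (y : N.-tuple R) : K * shell (enorm y) <=
    (-1) ^+ n.+1 * remainder_kernel mu a n 1 r (enorm y) * shell (enorm y).
  rewrite /shell in_itv/=; have [/andP[y1 y2]|_] := boolP (1 <= enorm y <= 2);
    last by rewrite !mulr0.
  rewrite !mulr1; move: (enorm y) y1 y2 => rho y1 y2.
  have rho0 : 0 < rho by exact: lt_le_trans y1.
  have e1 : rho ^+ 2 / (4 * 1) <= 1.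
    rewrite mulr1 ler_pdivrMr// mul1r -(_ : 2 ^+ 2 = 4); last by rewrite -natrX.
    by rewrite lerXn2r ?nnegrE ?(ltW rho0).
  have e4 : 4^-1 <= rho ^+ 2 / (4 * 1).
    by rewrite mulr1 ler_pdivlMr// mulVf// exprn_ege1.
  rewrite remainder_kernelE//; apply: le_trans (rkernel_remainder_ge _ _ _ _ _ _ _) => //; last first.
    apply: (@le_trans _ _ (l1%:R * 4 ^- n.+1)).
      rewrite ler_pdivlMr ?exprn_gt0//; apply: le_trans (ltW (archi_boundP _)).
        by rewrite ler_wpM2r ?exprn_ge0// ler_wpM2l ?mulr_ge0 ?(ltW F0)// ler_expR.
      by rewrite !mulr_ge0 ?expR_ge0 ?exprn_ge0 ?(ltW F0).
    rewrite ler_pM// ?invr_ge0 ?exprn_ge0//.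
      by rewrite (@le_trans _ _ a) ?lerDl// (le_trans _ la)// ler_nat.
    by rewrite -exprVn lerXn2r ?nnegrE ?invr_ge0// (le_trans _ e4) ?invr_ge0.
  have -> : K = (2^-1 * 4 `^ (- a) * A `^ (a - mu) / Gamma (a + 1)) * expR (- A ^+ 2) *
      (4^-1 * (4 ^- n.+1 / n.+1`!%:R)) by exact: mulrA.
  have h1 : 2^-1 * 4 `^ (- a) * A `^ (a - mu) / Gamma (a + 1) <= kernel_prefactor mu a r rho 1.
    rewrite /kernel_prefactor !mulr1 ler_wpM2r ?invr_ge0 ?(ltW G0)// ler_wpM2l ?mulr_ge0 ?powR_ge0//.
    rewrite ge0_ler_powR ?nnegrE ?subr_ge0 ?mulr_ge0 ?(ltW A0) ?(ltW r0) ?(ltW rho0)//.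
    by rewrite (le_trans rA1)// ler_peMr// ltW.
  have h2 : expR (- A ^+ 2) <= expR (- (r ^+ 2 / (4 * 1))) by rewrite ler_expR lerN2.
  have h3 : 4^-1 * (4 ^- n.+1 / n.+1`!%:R) <=
      4^-1 * ((rho ^+ 2 / (4 * 1)) ^+ n.+1 / n.+1`!%:R).
    rewrite ler_wpM2l// ler_wpM2r ?invr_ge0 ?(ltW F0)// -exprVn.
    by rewrite lerXn2r ?nnegrE ?invr_ge0// (le_trans _ e4) ?invr_ge0.
  have p1' : 0 <= 2^-1 * 4 `^ (- a) * A `^ (a - mu) / Gamma (a + 1).
    by rewrite !mulr_ge0 ?powR_ge0 ?invr_ge0 ?(ltW G0).
  apply: ler_pM h3; last exact: ler_pM p1' (expR_ge0 _) h1 h2.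
  - exact: mulr_ge0 p1' (expR_ge0 _).
  - by rewrite !mulr_ge0 ?invr_ge0 ?exprn_ge0 ?(ltW F0).
have wf : (@weighted_mass R N mu a n shell < +oo)%E := (wL1_shell l).2.
have [ri _] := rem_integrable N0 a0 mshell wf r0 (lexx 1).
apply: (@le_trans _ _ (K * v)).
  rewrite le_eqVlt; apply/orP; left; apply/eqP; rewrite /K.
  have -> : A `^ (a - mu) = A `^ a * A `^ (- mu) by rewrite powRD// (gt_eqF A0) implybT.
  by move: (4 `^ (- a)) (A `^ a) (A `^ (- mu)) (Gamma _)^-1 => *; ring.
have -> : `|@radial_remainder R N mu a n shell r 1| = `|(-1) ^+ n.+1 * @radial_remainder R N mu a n shell r 1|.
  by rewrite normrM normrX normrN1 expr1n mul1r.
apply: le_trans (ler_norm _); rewrite /radial_remainder -RintegralZl//.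
have ish : leb.-integrable setT (fun x : N.-tuple R => (shell (enorm x))%:E).
  apply/integrableP; split; first exact/measurable_EFinP.
  by under eq_integral do rewrite gee0_abs ?lee_fin//; rewrite hv ltry.
have -> : K * v = \int[leb]_x (K * shell (enorm x)).
  by rewrite RintegralZl// /Rintegral hv.
apply: le_Rintegral => //.
- exact: (integrableZl measurableT K ish).
- exact: (integrableZl measurableT ((-1) ^+ n.+1) ri).
- by move=> y _; rewrite mulrA.
Qed.

(** The admissible constants cannot be much smaller than the kernels themselves:
    up to a fixed factor, [C] dominates [(A / 8) ^ a / Gamma (a + 1)], for every [A >= 1]. *)
Lemma radial_constant_ge (A : R) : 1 <= A -> exists2 c : R, 0 < c & exists l0, forall l C,
  (l0 <= l)%N -> radial_remainder_bound N lam l n p C ->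
  c * ((A / 8) `^ (nul N lam l) / Gamma (nul N lam l + 1)) <= C.
Proof.
move=> A1; have A0 : 0 < A by exact: lt_le_trans A1.
have [D D0 hD] := weighted_mass_shell.
have [k k0 [l0 hl]] := rem_shell_ge A1.
have [v v0 hv] := shell_measure N0 A0.
exists (k * v `^ p^-1 / D); first by rewrite divr_gt0 ?mulr_gt0 ?powR_gt0.
exists l0 => l C ll hC; have C0 := radial_constant_ge0 hC.
have := Lnorm_rem_le hN p1 hC (wL1_shell l) (lexx 1).
have [w /andP[w0 wD] ->] := hD l; rewrite powR1 mul1e.
set a := nul N lam l; have a0 : 0 <= a by exact: nul_ge0.
have G0 : 0 < Gamma (a + 1) by rewrite Gamma_gt0// lerDr.
set kap := k * (4 `^ (- a) * A `^ a / Gamma (a + 1)).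
have kap0 : 0 <= kap by rewrite !mulr_ge0 ?powR_ge0 ?invr_ge0 ?(ltW k0) ?(ltW G0).
pose h (x : N.-tuple R) : R := kap * (enorm x \in `[A, 2 * A])%:R.
have mh : measurable_fun setT h by apply: measurable_funM => //; exact: measurable_enorm_bool.
have hN' : ('N[leb]_p%:E[EFin \o h] = (kap * v `^ p^-1)%R%:E)%E.
  rewrite LnormE.
  have -> : (\int[leb]_x (`|h x| `^ p)%:E = (kap `^ p * v)%:E)%E.
    transitivity (\int[leb]_x ((kap `^ p)%:E * ((enorm x \in `[A, (2 * A)])%R%:R)%:E))%E.
      apply: eq_integral => x _; rewrite /h -EFinM; congr EFin.
      case: (enorm x \in _); last by rewrite !mulr0 normr0 powR0 ?gt_eqF.
      by rewrite !mulr1 ger0_norm.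
    rewrite ge0_integralZl//; last by rewrite lee_fin powR_ge0.
      by rewrite hv -EFinM.
    by apply/measurable_EFinP; exact: measurable_enorm_bool.
  by rewrite poweR_EFin powRM ?powR_ge0 ?(ltW v0)// -powRrM mulfV ?gt_eqF// powRr1.
move=> hle; have : ('N[leb]_p%:E[EFin \o h] <= C%:E * w%:E)%E.
  apply: le_trans hle; apply: Lnorm_le_ae => //; first exact: measurable_rem_enorm.
  apply: aeW => x; rewrite /h; case: (boolP (_ \in _)) => [|_].
    by rewrite in_itv/= mulr1 => hx; rewrite ger0_norm// /kap hl.
  by rewrite mulr0 normr0.
rewrite hN' -EFinM lee_fin => kle.
have kle2 : kap * v `^ p^-1 <= C * (2 `^ a * D) by rewrite (le_trans kle)// ler_wpM2l.
(* Of the factor [8 ^ a], a part [4 ^ a] is the power of [4 t] in the kernel at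
   [t = 1], and [2 ^ a] bounds the weighted norm of the shell. *)
have -> : k * v `^ p^-1 / D * ((A / 8) `^ a / Gamma (a + 1)) =
  (kap * v `^ p^-1) / (2 `^ a * D).
  have -> : A / 8 = 4^-1 * A * 2^-1 by field.
  rewrite !powRM ?mulr_ge0 ?(ltW A0)// /kap invfM.
  have -> : 4^-1 `^ a = 4 `^ (- a) by rewrite -[in RHS]mulN1r powRrM powR_inv1.
  have -> : 2^-1 `^ a = (2 `^ a)^-1 by rewrite -powRN -[in RHS]mulN1r powRrM powR_inv1.
  by move: (v `^ p^-1) (4 `^ (- a)) (A `^ a) (2 `^ a)^-1 (Gamma _)^-1 (D^-1) => *; ring.
by rewrite ler_pdivrMr ?mulr_gt0 ?powR_gt0.
Qed.

End constant_lower_bound.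

(** * Pointwise summability of the modes *)

Section series_tools.
Context {R : realType}.
Implicit Types u v : nat -> R.

Lemma norm_series_dominated u v : (forall k, `|u k| <= v k) -> cvgn (series v) ->
  cvgn (series u).
Proof.
move=> uv cv; apply: normed_cvg; apply: series_le_cvg cv => // k.
  exact: normr_ge0.
exact: le_trans (normr_ge0 (u k)) (uv k).
Qed.

Lemma cvg_series_restrict_nneseries u (T : nat -> \bar R) (l0 : nat) :
  (forall l, 0 <= u l) -> (forall l, 0 <= T l)%E ->
  (forall l, (l0 <= l)%N -> ((u l)%:E <= T l)%E) ->
  (\sum_(0 <= l <oo) T l < +oo)%E -> cvgn (series u).
Proof.
move=> u0 T0 uT Tfin; rewrite -(is_cvg_series_restrict l0).
apply: nondecreasing_is_cvgn.
  move=> i j ij; have [il|/ltnW li] := leqP l0 i.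
    by rewrite [leRHS](big_cat_nat il ij)/= lerDl sumr_ge0.
  by rewrite [leLHS]big_geq// sumr_ge0.
have Tf : (\sum_(0 <= l <oo) T l)%E \is a fin_num by rewrite ge0_fin_numE// nneseries_ge0.
exists (fine (\sum_(0 <= l <oo) T l)%E) => _ [k _ <-].
rewrite -lee_fin fineK// -sumEFin.
apply: (@le_trans _ _ (\sum_(0 <= i < k) T i)%E); last by apply: nneseries_lim_ge => i _ _.
apply: (@le_trans _ _ (\sum_(l0 <= i < k) T i)%E).
  by rewrite big_nat [leRHS]big_nat; apply: lee_sum => i /andP[li _]; exact: uT.
exact: lee_sum_nneg_natl.
Qed.

End series_tools.

Section pointwise_summability.
Context {R : realType} {N : nat} (lam p : R) (n : nat).
Hypotheses (hN : (3 <= N)%N) (hlam0 : 0 <= lam) (hlam : lam <= (N%:R - 2) ^+ 2 / 4).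
Hypotheses (p1 : 1 <= p).
Notation leb := (lebesgueN R N).
Notation mu := (mu R N).
Notation nul := (nul N lam).
Variable d : nat -> nat.
Variable q : forall l, 'I_(d l) -> mpoly.mpoly N R.
Arguments q {l} _.
Hypothesis hq : forall l (m : 'I_(d l)), homog l (q m).
Hypothesis Lq : forall l (m : 'I_(d l)), laplacian (q m) = 0.
Hypothesis oq : forall l (m m' : 'I_(d l)), sdot (q m) (q m') = (m == m')%:R.
Variable C : nat -> R.
Hypothesis hC : forall l, radial_remainder_bound N lam l n p (C l).
Variable u0lm : forall l : nat, 'I_(d l) -> R -> R.
Arguments u0lm {l} _.
Hypothesis hu0lm : forall l (m : 'I_(d l)), wL1 N lam l n (u0lm m).

Definition mode_bound : nat -> \bar R := fun l => (\sum_(m < d l)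
  (sphere_Lnorm p (pfun (q m)) * (C l)%:E * wnorm N lam l n (u0lm m)))%E.

Hypothesis hsum : (\sum_(0 <= l <oo) mode_bound l < +oo)%E.

Let N0 : (0 < N)%N. Proof. exact: leq_trans hN. Qed.

Let C0 l : 0 <= C l. Proof. exact: (@radial_constant_ge0 R N lam p n hN p1 l (C l) (@hC l)). Qed.

Definition wmass l (m : 'I_(d l)) : R := fine (wnorm N lam l n (u0lm m)).

Lemma wmass_ge0 l (m : 'I_(d l)) : 0 <= wmass m.
Proof. by apply: fine_ge0; exact: (weighted_mass_ge0 lam n l (u0lm m)). Qed.

Lemma wmassE l (m : 'I_(d l)) : wnorm N lam l n (u0lm m) = (wmass m)%:E.
Proof.
rewrite fineK// ge0_fin_numE; last exact: (weighted_mass_ge0 lam n l (u0lm m)).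
by have [] := hu0lm m.
Qed.

Definition mode_mass (w : N.-tuple R) (r t : R) (l : nat) : R :=
  \sum_(m < d l) `|pfun (q m) w| * (outer_prefactor mu (nul l) r t * wmass m).

Lemma mode_mass_ge0 w r t l : 0 <= r -> 0 < t -> 0 <= mode_mass w r t l.
Proof.
move=> r0 t0; apply: sumr_ge0 => m _; rewrite mulr_ge0// mulr_ge0 ?wmass_ge0//.
by apply: outer_prefactor_ge0 => //; exact: nul_ge0.
Qed.

Lemma mode_bound_ge0 l : (0 <= mode_bound l)%E.
Proof.
apply: sume_ge0 => m _; rewrite wmassE !mule_ge0 ?sphere_Lnorm_ge0 ?lee_fin ?wmass_ge0 ?C0//.
Qed.

Lemma outer_prefactorE a r t : 0 < r -> 0 < t ->
  outer_prefactor mu a r t = (2 * t)^-1 * r `^ (- mu) * ((r / (4 * t)) `^ a / Gamma (a + 1)).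
Proof.
move=> r0 t0; have t4 : 0 < 4 * t by rewrite mulr_gt0.
rewrite /outer_prefactor (powRD (_ : (a + - mu == 0) ==> (r != 0))) ?(gt_eqF r0) ?implybT//.
rewrite (@powRM _ r (4 * t)^-1) ?(ltW r0) ?invr_ge0 ?(ltW t4)//.
have -> : (4 * t)^-1 `^ a = (4 * t) `^ (- a).
  by rewrite -[in RHS]mulN1r powRrM powR_inv1// ltW.
by move: (2 * t)^-1 (Gamma _)^-1 (r `^ a) (r `^ (- mu)) (_ `^ (- a)) => *; ring.
Qed.

(** The lower bound on the constants makes the summability hypothesis control
    the modes at every single point. *)
Lemma mode_mass_summable w r t : sphere w -> 0 < r -> 0 < t ->
  cvgn (series (mode_mass w r t)).
Proof.
move=> w1 r0 t0; have [B B1 [_ hB]] := zonal_bound N0 hq oq.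
have B0 : 0 < B by exact: lt_le_trans B1.
have t4 : 0 < 4 * t by rewrite mulr_gt0.
(* [A / 8] must exceed [B * r / (4 t)]: [B ^ l] comes from the sup bound of the
   harmonics, [(r / (4 t)) ^ nu_l / Gamma (nu_l + 1)] from the kernel. *)
pose A := 1 + 8 * (B * (r / (4 * t))).
have A1 : 1 <= A by rewrite lerDl !mulr_ge0 ?invr_ge0 ?ltW.
have [c c0 [l0 hl]] := radial_constant_ge n hN hlam p1 A1.
pose K := (2 * t)^-1 * r `^ (- mu) * B / c.
have K0 : 0 <= K by rewrite !mulr_ge0 ?powR_ge0 ?invr_ge0 ?mulr_ge0 ?ltW.
apply: (@cvg_series_restrict_nneseries _ _ (fun l => K%:E * mode_bound l)%E l0).
- by move=> l; rewrite mode_mass_ge0// ltW.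
- by move=> l; rewrite mule_ge0 ?lee_fin// mode_bound_ge0.
- move=> l ll; rewrite /mode_bound ge0_sume_distrr; last first.
    move=> m _; rewrite wmassE !mule_ge0 ?sphere_Lnorm_ge0 ?lee_fin ?wmass_ge0 ?C0//.
  rewrite /mode_mass -sumEFin; apply: lee_sum => m _.
  set a := nul l; have la : l%:R <= a by exact: nul_ge hN hlam l.
  have a0 : 0 <= a by exact: nul_ge0.
  have G0 : 0 < Gamma (a + 1) by rewrite Gamma_gt0// lerDr.
  have X0 : 0 <= r / (4 * t) by rewrite divr_ge0 ?ltW.
  rewrite EFinM; apply: le_trans (lee_wpmul2r _ (hB p l m w p1 w1)) _.
    by rewrite lee_fin mulr_ge0 ?wmass_ge0// outer_prefactor_ge0// ltW.
  rewrite wmassE EFinM; set Y := sphere_Lnorm _ _.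
  have Y0 : (0 <= Y)%E by exact: sphere_Lnorm_ge0.
  have -> : ((B ^+ l.+1)%:E * Y * ((outer_prefactor mu a r t)%:E * (wmass m)%:E) =
    (B ^+ l.+1 * outer_prefactor mu a r t)%:E * (Y * (wmass m)%:E))%E.
    by rewrite EFinM muleACA.
  have -> : (K%:E * (Y * (C l)%:E * (wmass m)%:E) = (K * C l)%:E * (Y * (wmass m)%:E))%E.
    by rewrite [(K * C l)%:E]EFinM -!muleA (muleCA Y).
  rewrite lee_wpmul2r ?mule_ge0 ?lee_fin ?wmass_ge0// outer_prefactorE// exprS.
  apply: (@le_trans _ _ (K * (c * ((A / 8) `^ a / Gamma (a + 1))))); last first.
    by rewrite ler_wpM2l// (hl _ _ ll (@hC l)).
  have -> : K * (c * ((A / 8) `^ a / Gamma (a + 1))) =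
     ((2 * t)^-1 * r `^ (- mu) * B * (Gamma (a + 1))^-1) * (A / 8) `^ a.
    rewrite /K; move: (2 * t)^-1 (r `^ _) (_ `^ a) (Gamma _)^-1 => *; field.
    by rewrite gt_eqF.
  have -> : B * B ^+ l * ((2 * t)^-1 * r `^ (- mu) * ((r / (4 * t)) `^ a / Gamma (a + 1))) =
     ((2 * t)^-1 * r `^ (- mu) * B * (Gamma (a + 1))^-1) * (B ^+ l * (r / (4 * t)) `^ a).
    by move: (2 * t)^-1 (r `^ _) (_ `^ a) (Gamma _)^-1 => *; ring.
  apply: ler_wpM2l.
    by rewrite !mulr_ge0 ?powR_ge0 ?invr_ge0 ?mulr_ge0 ?ltW.
  apply: (@le_trans _ _ ((B * (r / (4 * t))) `^ a)).
    rewrite powRM ?(ltW B0)// ler_wpM2r ?powR_ge0// -powR_mulrn ?(ltW B0)//.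
    exact: ler_powR.
  have A80 : 0 <= A / 8 by rewrite divr_ge0// (le_trans ler01 A1).
  have BX0 : 0 <= B * (r / (4 * t)) by exact: mulr_ge0 (ltW B0) X0.
  rewrite ge0_ler_powR ?nnegrE//.
  by rewrite /A; lra.
- rewrite nneseriesZl; last by move=> l _; exact: mode_bound_ge0.
  by rewrite lte_mul_pinfty// ?lee_fin//.
Qed.

End pointwise_summability.

(** * Expansion of the mild solution *)

Lemma nneseries_cvgn {R : realType} (u : nat -> R) : (forall l, 0 <= u l) ->
  cvgn (series u) -> (\sum_(0 <= l <oo) (u l)%:E < +oo)%E.
Proof.
move=> u0 cu; rewrite (_ : (fun K => _) = EFin \o series u).
  by rewrite EFin_lim// ltry.
by apply/funext => K; rewrite /series /= sumEFin.
Qed.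

Section solution_expansion.
Context {R : realType} {N : nat} (lam p : R) (n : nat).
Hypotheses (hN : (3 <= N)%N) (hlam0 : 0 <= lam) (hlam : lam <= (N%:R - 2) ^+ 2 / 4).
Hypotheses (p1 : 1 <= p).
Notation leb := (lebesgueN R N).
Notation sigma := (@sphere_measure R N).
Notation mu := (mu R N).
Notation nul := (nul N lam).
Variable d : nat -> nat.
Variable q : forall l, 'I_(d l) -> mpoly.mpoly N R.
Arguments q {l} _.
Hypothesis hq : forall l (m : 'I_(d l)), homog l (q m).
Hypothesis Lq : forall l (m : 'I_(d l)), laplacian (q m) = 0.
Hypothesis oq : forall l (m m' : 'I_(d l)), sdot (q m) (q m') = (m == m')%:R.

Let N0 : (0 < N)%N. Proof. exact: leq_trans hN. Qed.

(** [Gamma_ge] at [B = 2 X] compares with a geometric series of ratio [1 / 2]. *)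
Lemma power_Gamma_summable (X : R) : 0 < X ->
  cvgn (series (fun l => X `^ (nul l) / Gamma (nul l + 1))).
Proof.
move=> X0; have G0 l : 0 < Gamma (nul l + 1) by rewrite Gamma_gt0// lerDr nul_ge0.
apply: (@series_le_cvg _ _ (geometric (expR (2 * X + 1)) 2^-1)).
- by move=> l; rewrite divr_ge0 ?powR_ge0// ltW.
- by move=> l; rewrite /= mulr_ge0 ?expR_ge0// exprn_ge0.
- move=> l; rewrite /= ler_pdivrMr//.
  have X2 : 0 < 2 * X by rewrite mulr_gt0.
  have /(Gamma_ge X2) : 1 <= nul l + 1 by rewrite lerDr nul_ge0.
  rewrite addrK => h.
  have c0 : 0 <= expR (2 * X + 1) * 2^-1 ^+ l by rewrite mulr_ge0 ?expR_ge0// exprn_ge0.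
  apply: le_trans (ler_wpM2l c0 h).
  rewrite (powRM _ (_ : 0 <= 2) (ltW X0))//.
  have -> : expR (2 * X + 1) * 2^-1 ^+ l * (2 `^ nul l * X `^ nul l * expR (- (2 * X + 1))) =
     (expR (2 * X + 1) * expR (- (2 * X + 1))) * (2^-1 ^+ l * 2 `^ nul l) * X `^ nul l.
    by move: (expR _) (expR _) (2 `^ _) (X `^ _) (2^-1 ^+ l) => *; ring.
  rewrite -expRD subrr expR0 mul1r ler_peMl ?powR_ge0// exprVn ler_pdivlMl ?exprn_gt0//.
  by rewrite mulr1 -powR_mulrn// ler_powR ?ler1n// (nul_ge hN hlam l).
- apply: is_cvg_geometric_series; rewrite ger0_norm// invf_lt1// ltr1n//.
Qed.

(** The general term dominates that of the Hardy kernel, [B ^ (2 (l + 1))] being the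
    bound for the zonal function of degree [l]. *)
Lemma kernel_prefactor_summable (B r s t : R) : 1 <= B -> 0 < r -> 0 < s -> 0 < t ->
  cvgn (series (fun l => kernel_prefactor mu (nul l) r s t * (B ^+ l.+1) ^+ 2)).
Proof.
move=> B1 r0 s0 t0; have B0 : 0 < B by exact: lt_le_trans B1.
have t4 : 0 < 4 * t by rewrite mulr_gt0.
pose X := B ^+ 2 * (r / (4 * t) * s).
have X0 : 0 < X by rewrite mulr_gt0 ?exprn_gt0// mulr_gt0// divr_gt0.
pose c := (2 * t)^-1 * r `^ (- mu) * s `^ (- mu) * B ^+ 2.
have c0 : 0 <= c by rewrite !mulr_ge0 ?powR_ge0 ?invr_ge0 ?exprn_ge0 ?mulr_ge0 ?ltW.
have G0 l : 0 < Gamma (nul l + 1) by rewrite Gamma_gt0// lerDr nul_ge0.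
apply: (@series_le_cvg _ _ (c *: (fun l => X `^ (nul l) / Gamma (nul l + 1)))).
- by move=> l; rewrite mulr_ge0 ?sqr_ge0// ltW// kernel_prefactor_gt0// nul_ge0.
- by move=> l; rewrite fctE mulr_ge0// divr_ge0 ?powR_ge0// ltW.
- move=> l; rewrite fctE [leRHS]/GRing.scale/= kernel_prefactorE ?(ltW r0) ?(ltW s0)// outer_prefactorE//.
  rewrite (powRD (_ : (nul l + - mu == 0) ==> (s != 0))) ?(gt_eqF s0) ?implybT//.
  have -> : (2 * t)^-1 * r `^ (- mu) * ((r / (4 * t)) `^ nul l / Gamma (nul l + 1)) *
      (s `^ nul l * s `^ (- mu)) * (B ^+ l.+1) ^+ 2 =
      c / Gamma (nul l + 1) * ((r / (4 * t)) `^ nul l * s `^ nul l * (B ^+ 2) ^+ l).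
    rewrite exprAC [(_ ^+ 2) ^+ l.+1]exprS /c.
    by move: (2 * t)^-1 (r `^ _) (_ `^ nul l) (s `^ _) (s `^ _) (Gamma _)^-1 (B ^+ 2)
      ((B ^+ 2) ^+ l) => *; ring.
  have -> : c * (X `^ nul l / Gamma (nul l + 1)) = c / Gamma (nul l + 1) * X `^ nul l.
    by rewrite mulrA mulrAC.
  apply: ler_wpM2l; first by rewrite divr_ge0// ltW.
  have rt0 : 0 <= r / (4 * t) by rewrite divr_ge0 ?ltW.
  have Z0 : 0 <= r / (4 * t) * s by rewrite mulr_ge0// ltW.
  rewrite -(powRM _ rt0 (ltW s0)) /X (powRM _ (sqr_ge0 B) Z0).
  rewrite mulrC ler_wpM2r ?powR_ge0// -powR_mulrn ?sqr_ge0// ler_powR ?exprn_ege1//.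
  exact: (nul_ge hN hlam l).
- by apply: is_cvg_seriesZ; exact: power_Gamma_summable.
Qed.

Variable C : nat -> R.
Hypothesis hC : forall l, radial_remainder_bound N lam l n p (C l).
Variable u0lm : forall l : nat, 'I_(d l) -> R -> R.
Arguments u0lm {l} _.
Hypothesis hu0lm : forall l (m : 'I_(d l)), wL1 N lam l n (u0lm m).
Hypothesis hsum : (\sum_(0 <= l <oo) mode_bound lam p n (@q) C (@u0lm) l < +oo)%E.
Variable Y : forall l : nat, 'I_(d l) -> N.-tuple R -> R.
Arguments Y {l} _ _.
Hypothesis hYq : forall l (m : 'I_(d l)) w, sphere w -> Y m w = pfun (q m) w.
Variable u0 : N.-tuple R -> R.
Hypothesis hu0 : measurable_fun setT u0.
Hypothesis hexp : harmonic_expansion (@Y) (@u0lm) u0.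
Hypothesis hu : mild_solution_defined lam (@Y) u0.

Section fixed_point.
Variables (x : N.-tuple R) (t : R).
Hypotheses (x0 : enorm x != 0) (t1 : 1 <= t).

Let t0 : 0 < t. Proof. exact: lt_le_trans t1. Qed.
Let r : R := enorm x.
Let w : N.-tuple R := dir x.
Let r0 : 0 < r. Proof. exact: enorm_gt0. Qed.
Let w1 : sphere w. Proof. exact: enorm_dir. Qed.
Let rk l (s : R) : R := rkernel mu (nul l) r s t.
Let F (y : N.-tuple R) : R := hardy_kernel lam (@Y) x y t * u0 y.

Let mF : measurable_fun setT F.
Proof. by apply/measurable_EFinP; exact: (measurable_int _ (hu r0 t0)). Qed.

Let zdom (s : R) (eta : N.-tuple R) (B : R) :
  (forall l, `|zonal (@q) l w eta| <= (B ^+ l.+1) ^+ 2) -> 0 < s -> forall l,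
  `|rk l s * zonal (@q) l w eta| <= kernel_prefactor mu (nul l) r s t * (B ^+ l.+1) ^+ 2.
Proof.
move=> hB s0 l; rewrite normrM ler_pM// ger0_norm ?rkernel_le ?rkernel_ge0 ?nul_ge0//.
Qed.

Let FE (s : R) (eta : N.-tuple R) : 0 < s -> sphere eta ->
  F (scalev s eta) =
  limn (series (fun l => rk l s * zonal (@q) l w eta)) * u0 (scalev s eta).
Proof.
move=> s0 eta1; rewrite /F /hardy_kernel enormZ ?(ltW s0)// dirZ// (dir_sphere eta1).
rewrite (eta1 : enorm eta = 1) mulr1 -/r -/w; congr (_ * _).
have [B B1 [hB _]] := zonal_bound N0 hq oq.
have cz : cvgn (series (fun l => rk l s * zonal (@q) l w eta)).
  apply: norm_series_dominated (kernel_prefactor_summable B1 r0 s0 t0).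
  by apply: zdom => // l; exact: hB.
set g := (2 * t)^-1 * _ * _.
have g0 : g != 0.
  rewrite gt_eqF// !mulr_gt0 ?expR_gt0 ?invr_gt0 ?mulr_gt0 ?powR_gt0//.
  exact: mulr_gt0.
rewrite (_ : (fun l => besselI _ _ * _) = g^-1 *: (fun l => rk l s * zonal (@q) l w eta)).
  by rewrite lim_seriesZ// /GRing.scale/= mulrA mulfV// mul1r.
apply/funext => l; rewrite -[RHS]/(g^-1 * (g * besselI (nul l) (r * s / (2 * t)) * zonal (@q) l w eta)).
rewrite -[g * _ * _]mulrA mulKf//.
by congr (_ * _); apply: eq_bigr => m _; rewrite !hYq.
Qed.

Let ang l (s : R) : R := \sum_(m < d l) pfun (q m) w * u0lm m s.

Let good (s : R) : Prop := (fun L : nat => sphere_Lnorm 2 (fun eta =>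
  u0 (scalev s eta) - \sum_(l < L) \sum_(m < d l) u0lm m s * Y m eta)) @ \oo --> 0%E.

(** On the sphere of radius [s] the series of the kernel converges uniformly, and its
    terms select the modes of [u0] one degree at a time. *)
Let inner_cvg (s : R) : 0 < s -> good s ->
  (fun L : nat => (\sum_(l < L) rk l s * ang l s)%:E) @ \oo -->
  (\int[sigma]_eta (F (scalev s eta))%:E)%E.
Proof.
move=> s0 gs; have [B B1 [hB _]] := zonal_bound N0 hq oq.
have cB := kernel_prefactor_summable B1 r0 s0 t0.
have mu0s : measurable_fun setT (fun eta : N.-tuple R => u0 (scalev s eta)).
  by apply: (measurableT_comp hu0); exact: measurable_scalevl.
have gq : (fun L : nat => sphere_Lnorm 2 (fun eta => u0 (scalev s eta) -
    \sum_(l < L) \sum_(m < d l) u0lm m s * pfun (q m) eta)) @ \oo --> 0%E.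
  move: gs; rewrite /good; congr (_ @ \oo --> 0%E); apply/funext => L.
  apply: eq_sphere_Lnorm => eta eta1; congr (_ - _).
  by apply: eq_bigr => l _; apply: eq_bigr => m _; rewrite hYq.
have [iu0 zrep] := zonal_reproducing (c := fun l m => @u0lm l m s) N0 hq Lq oq mu0s gq.
set v := fun eta => u0 (scalev s eta) in iu0 zrep mu0s.
pose M : R := limn (series (fun l => kernel_prefactor mu (nul l) r s t * (B ^+ l.+1) ^+ 2)).
pose f_ (L : nat) (eta : N.-tuple R) : \bar R :=
  (\sum_(l < L) rk l s * (zonal (@q) l w eta * v eta))%:E.
have iz l : sigma.-integrable setT (EFin \o (fun eta => zonal (@q) l w eta * v eta)).
  by have [] := sphere_bounded_mul N0 (measurable_zonal (@q) l w) (fun eta => hB l w eta w1) iu0.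
have mz l : measurable_fun setT (fun eta => zonal (@q) l w eta * v eta).
  by apply/measurable_EFinP; exact: (measurable_int _ (iz l)).
have If_ L : (\int[sigma]_eta f_ L eta)%E = (\sum_(l < L) rk l s * ang l s)%:E.
  have ir (l : 'I_L) : sigma.-integrable setT
      (fun eta => (rk l s * (zonal (@q) l w eta * v eta))%:E).
    exact: (integrableZl measurableT (rk l s) (iz l)).
  have iS : sigma.-integrable setT (f_ L).
    rewrite (_ : f_ L = fun eta => (\sum_(l < L)
        (rk l s * (zonal (@q) l w eta * v eta))%:E)%E); last first.
      by apply/funext => eta; rewrite sumEFin.
    by apply: integrable_sum => // l _; exact: ir.
  rewrite -[LHS]fineK; last exact: integrable_fin_num.
  congr EFin; rewrite -[LHS]/(\int[sigma]_eta
    (\sum_(l < L) rk l s * (zonal (@q) l w eta * v eta))) Rintegral_sum_ord//.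
  by apply: eq_bigr => l _; rewrite RintegralZl// zrep.
have mFs : measurable_fun setT (fun eta : N.-tuple R => (F (scalev s eta))%:E).
  apply/measurable_EFinP; apply: (measurableT_comp mF); exact: measurable_scalevl.
have M0 : 0 <= M.
  apply: limr_ge => //; apply: nearW => K; rewrite sumr_ge0// => l _.
  by rewrite mulr_ge0 ?sqr_ge0// ltW// kernel_prefactor_gt0// nul_ge0.
have iD : sigma.-integrable setT (fun eta => (M * `|v eta|)%:E).
  exact: (integrableZl measurableT M (integrable_norm iu0)).
have := @dominated_convergence _ _ R sigma setT measurableT f_
  (fun eta => (F (scalev s eta))%:E) (fun eta => (M * `|v eta|)%:E) _ mFs.
case=> //.
- move=> L; apply/measurable_EFinP; apply: measurable_sum => l.
  by apply: measurable_funM.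
- apply: filterS (ae_sphere N0) => eta eta1 _.
  rewrite FE//; apply: cvg_EFin; first exact: nearW.
  rewrite (_ : _ \o _ = (fun L => series (fun l => rk l s * zonal (@q) l w eta) L * v eta)).
    apply: cvgMr_tmp.
    apply: norm_series_dominated (kernel_prefactor_summable B1 r0 s0 t0).
    by apply: zdom => // l; exact: hB.
  apply/funext => L; rewrite /f_ /series /= mulr_suml big_mkord.
  by apply: eq_bigr => l _; rewrite mulrA.
- apply: filterS (ae_sphere N0) => eta eta1 L _; rewrite lee_fin.
  rewrite (le_trans (ler_norm_sum _ _ _))//.
  apply: (@le_trans _ _ ((\sum_(l < L) kernel_prefactor mu (nul l) r s t * (B ^+ l.+1) ^+ 2) * `|v eta|)).
    rewrite mulr_suml; apply: ler_sum => l _; rewrite mulrA normrM ler_wpM2r//.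
    by apply: zdom => // k; exact: hB.
  rewrite ler_wpM2r// -(big_mkord xpredT (fun l => kernel_prefactor mu (nul l) r s t * (B ^+ l.+1) ^+ 2)).
  apply: nondecreasing_cvgn_le cB _ => i j ij.
  rewrite [leRHS](big_cat_nat (leq0n i) ij)/= lerDl sumr_ge0// => l _.
  by rewrite mulr_ge0 ?sqr_ge0// ltW// kernel_prefactor_gt0// nul_ge0.
move=> _ _; have <- : (fun L => \int[sigma]_eta f_ L eta)%E =
    (fun L : nat => (\sum_(l < L) rk l s * ang l s)%:E) by apply/funext.
by [].
Qed.


Let rint l : R := \sum_(m < d l) pfun (q m) w *
  \int[leb]_y (rkernel mu (nul l) r (enorm y) t * u0lm m (enorm y)).

Let mu0lm l (m : 'I_(d l)) : measurable_fun setT (fun y : N.-tuple R => u0lm m (enorm y)).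
Proof. by have [/(measurable_radial (N := N))] := hu0lm m. Qed.

Let modes l (y : N.-tuple R) : R := rk l (enorm y) * ang l (enorm y).

Let modesE l y : modes l y =
  \sum_(m < d l) pfun (q m) w * (rkernel mu (nul l) r (enorm y) t * u0lm m (enorm y)).
Proof. by rewrite /modes /ang mulr_sumr; apply: eq_bigr => m _; rewrite /rk mulrCA. Qed.

Let irk l (m : 'I_(d l)) : leb.-integrable setT
  (fun y => (rkernel mu (nul l) r (enorm y) t * u0lm m (enorm y))%:E).
Proof. exact: (rkernel_integrable N0 (nul_ge0 _ _ _) (mu0lm m) (hu0lm m).2 r0 t1).1. Qed.

Let imodes l : leb.-integrable setT (fun y => (modes l y)%:E).
Proof.
rewrite (_ : (fun y => _) = fun y => (\sum_(m < d l)
    ((pfun (q m) w)%:E * (rkernel mu (nul l) r (enorm y) t * u0lm m (enorm y))%:E))%E).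
  by apply: integrable_sum => // m _; apply: integrableZl => //; exact: irk.
by apply/funext => y; rewrite modesE -sumEFin.
Qed.

Let Imodes l : \int[leb]_y modes l y = rint l.
Proof.
under eq_Rintegral do rewrite modesE.
rewrite Rintegral_sum_ord => [|m].
  by apply: eq_bigr => m _; rewrite RintegralZl//; exact: irk.
exact: (integrableZl measurableT (pfun (q m) w) (irk m)).
Qed.

Let L1_modes l : (\int[leb]_y (`|modes l y|)%:E <= (mode_mass lam n (@q) (@u0lm) w r t l)%:E)%E.
Proof.
have mk (m : 'I_(d l)) : measurable_fun setT
    (fun y : N.-tuple R => (rkernel mu (nul l) r (enorm y) t * u0lm m (enorm y))).
  by apply/measurable_EFinP; exact: (measurable_int _ (irk m)).
have mak (m : 'I_(d l)) : measurable_fun setT (fun y : N.-tuple R => (`|pfun (q m) w| *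
    `|rkernel mu (nul l) r (enorm y) t * u0lm m (enorm y)|)%:E).
  apply/measurable_EFinP; apply: measurable_funM => //.
  exact: (measurableT_comp (@normr_measurable R setT)).
apply: (@le_trans _ _ (\int[leb]_y (\sum_(m < d l) (`|pfun (q m) w| *
    `|rkernel mu (nul l) r (enorm y) t * u0lm m (enorm y)|)%:E))%E).
  apply: ge0_le_integral => //.
  - apply/measurable_EFinP; apply: (measurableT_comp (@normr_measurable R setT)).
    by apply/measurable_EFinP; exact: (measurable_int _ (imodes l)).
  - by apply: emeasurable_sum.
  - move=> y _; rewrite sumEFin lee_fin modesE (le_trans (ler_norm_sum _ _ _))//.
    by apply: ler_sum => m _; rewrite normrM.
rewrite ge0_integral_sum//.
rewrite -sumEFin; apply: lee_sum => m _.
under eq_integral do rewrite EFinM.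
rewrite ge0_integralZl//; last first.
  by apply/measurable_EFinP; exact: (measurableT_comp (@normr_measurable R setT)).
rewrite EFinM lee_wpmul2l ?lee_fin//.
exact: (rkernel_L1_le N0 (nul_ge0 _ _ _) (mu0lm m) (hu0lm m).2 r0 t1).
Qed.

(** Radii in a null set correspond to a null set of points. *)
Let ae_good : {ae leb, forall y : N.-tuple R, 0 < enorm y /\ good (enorm y)}.
Proof.
have [A [mA A0 sA]] := hexp.
have nA : {ae leb, forall y : N.-tuple R, ~ A (enorm y)}.
  exists (@enorm R N @^-1` A); split.
  - exact: measurable_enorm_preimage.
  - exact: radial_measure_abscont.
  - by move=> y /=; rewrite not_notE.
apply: filterS2 nA (ae_enorm_neq0 N0) => y nAy /enorm_gt0 y0; split=> //.
by have := contra_not (@sA (enorm y)) nAy; rewrite /= not_notE; apply.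
Qed.

(** The kernel is integrated over directions by [inner_cvg], then over radii. The
    second dominated convergence rests on [mode_mass_summable]. *)
Lemma solution_series_cvg : series rint @ \oo --> mild_solution lam (@Y) u0 x t.
Proof.
pose Phi (y : N.-tuple R) : \bar R := (\int[sigma]_eta (F (scalev (enorm y) eta))%:E)%E.
have iF : leb.-integrable setT (EFin \o F) by exact: (hu r0 t0).
have IF : (\int[leb]_y (F y)%:E = \int[leb]_y Phi y)%E by exact: integral_polar.
have mPhi : measurable_fun setT Phi.
  apply: (measurableT_comp (f := fun s : measurableTypeR R =>
    \int[sigma]_eta (F (scalev s eta))%:E)%E); last exact: measurable_enorm.
  apply: (@measurable_integral_param _ _ (measurableTypeR R) _ R (@usphere_measure R N)
    (fun z => F (scalev z.1 z.2))).
  exact: measurable_scalev_polar.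
pose D (y : N.-tuple R) : \bar R := (\sum_(0 <= l <oo) (`|modes l y|)%:E)%E.
have mmodes l : measurable_fun setT (modes l).
  by apply/measurable_EFinP; exact: (measurable_int _ (imodes l)).
have mam l : measurable_fun setT (fun y => (`|modes l y|)%:E).
  by apply/measurable_EFinP; exact: (measurableT_comp (@normr_measurable R setT)).
have D0 y : (0 <= D y)%E by apply: nneseries_ge0 => l _ _; rewrite lee_fin.
have iD : leb.-integrable setT D.
  apply/integrableP; split.
    by apply: ge0_emeasurable_sum => // l y _ _; rewrite lee_fin.
  under eq_integral do rewrite gee0_abs//.
  rewrite integral_nneseries//.
  have := nneseries_cvgn (fun l => mode_mass_ge0 lam n (@q) (@u0lm) w l (ltW r0) t0)
    (mode_mass_summable hN hlam p1 hq oq hC hu0lm hsum w1 r0 t0).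
  apply: le_lt_trans; apply: lee_nneseries => l _; last exact: L1_modes.
  by move=> _; apply: integral_ge0 => y _; rewrite lee_fin.
have := @dominated_convergence _ _ R leb setT measurableT
  (fun L y => (\sum_(l < L) modes l y)%:E) Phi D _ mPhi.
case=> //.
- by move=> L; apply/measurable_EFinP; apply: measurable_sum => l; exact: mmodes.
- by apply: filterS ae_good => y [y0 gy] _; exact: inner_cvg.
- apply: aeW => y L _; apply: le_trans (nneseries_lim_ge L _) => //.
  rewrite big_mkord sumEFin lee_fin.
  exact: ler_norm_sum.
move=> _ _ H.
have {}H : (fun L => (series rint L)%:E) @ \oo --> (\int[leb]_y (F y)%:E)%E.
  rewrite IF; have <- : (fun L => \int[leb]_y (\sum_(l < L) modes l y)%:E)%E =
      (fun L => (series rint L)%:E); last by [].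
  apply/funext => L.
  have iS : leb.-integrable setT (fun y => (\sum_(l < L) modes l y)%:E).
    rewrite (_ : (fun y => _) = fun y => (\sum_(l < L) (modes l y)%:E)%E); last first.
      by apply/funext => y; rewrite sumEFin.
    by apply: integrable_sum => // l _; exact: imodes.
  rewrite -[LHS]fineK; last exact: integrable_fin_num.
  congr EFin; rewrite -[LHS]/(\int[leb]_y (\sum_(l < L) modes l y)).
  rewrite Rintegral_sum_ord; last by move=> l; exact: imodes.
  by rewrite /series /= big_mkord; apply: eq_bigr => l _; exact: Imodes.
have Ffin : (\int[leb]_y (F y)%:E)%E \is a fin_num by exact: integrable_fin_num.
rewrite -(fineK Ffin) in H.
exact: (fine_cvg H).
Qed.

End fixed_point.
End solution_expansion.

(** * Limits of L^p norms and product structure *)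

Lemma cvg_powR {R : realType} (u : nat -> R) (l p : R) : 0 < p -> (forall k, 0 <= u k) ->
  u @ \oo --> l -> (fun k => u k `^ p) @ \oo --> l `^ p.
Proof.
move=> p0 u0 ul; have l0 : 0 <= l.
  by rewrite -(cvg_lim (@Rhausdorff R) ul); apply: limr_ge; [apply/cvg_ex; exists l|exact: nearW].
move: (l0); rewrite le_eqVlt => /predU1P[l00|lpos].
  rewrite -l00 powR0 ?gt_eqF//; apply/cvgr0Pnorm_le => e e0.
  have e1 : 0 < e `^ p^-1 by rewrite powR_gt0.
  move: ul; rewrite -l00 => /cvgr0Pnorm_le /(_ _ e1); apply: filterS => k.
  rewrite !ger0_norm ?powR_ge0// => ue.
  have -> : e = (e `^ p^-1) `^ p by rewrite -powRrM mulVf ?gt_eqF// powRr1// ltW.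
  by rewrite ge0_ler_powR ?nnegrE ?powR_ge0// ltW.
have H : (fun k => expR (p * ln (u k))) @ \oo --> l `^ p.
  rewrite [X in _ --> X]/powR gt_eqF//.
  apply: (@cvg_comp _ _ _ (fun k => p * ln (u k)) expR _ (nbhs (p * ln l))); last exact: continuous_expR.
  apply: cvgMl_tmp; apply: (@cvg_comp _ _ _ u (@ln R) _ (nbhs l)); [exact: ul|exact: continuous_ln].
apply: cvg_trans H; apply: near_eq_cvg.
have : \forall k \near \oo, 0 < u k by move/(cvgr_gt l) : ul; apply.
by apply: filterS => k uk; rewrite /powR gt_eqF.
Qed.

Section Lnorm_limits.
Context d (T : measurableType d) (R : realType).
Variable m : {measure set T -> \bar R}.
Variable p : R.
Hypothesis p1 : 1 <= p.
Local Open Scope ereal_scope.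

Let p0 : (0 < p)%R. Proof. exact: lt_le_trans p1. Qed.

Lemma Lnorm_sum_le (I : Type) (s : seq I) (f : I -> T -> R) :
  (forall i, measurable_fun setT (f i)) ->
  'N[m]_p%:E[EFin \o (fun x => \sum_(i <- s) f i x)%R] <=
  \sum_(i <- s) 'N[m]_p%:E[EFin \o f i].
Proof.
move=> mf; elim: s => [|i s IH].
  rewrite big_nil (_ : EFin \o _ = cst 0).
    by rewrite Lnorm0// eqe gt_eqF.
  by apply/funext => x; rewrite /= big_nil.
have mS : measurable_fun setT (fun x => \sum_(i <- s) f i x)%R by exact: measurable_sum.
rewrite big_cons; apply: le_trans (leeD2l _ IH).
apply: le_trans (minkowski_EFin m (mf i) mS p1).
apply: Lnorm_le_ae => //.
- exact: measurable_sum.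
- exact: measurable_funD.
- by apply: aeW => x; rewrite big_cons.
Qed.

(** Fatou's lemma for the [p]-th powers. *)
Lemma Lnorm_lim_le (f_ : nat -> T -> R) (f : T -> R) (M : \bar R) :
  (forall k, measurable_fun setT (f_ k)) -> measurable_fun setT f ->
  {ae m, forall x, (fun k => f_ k x) @ \oo --> f x} ->
  (forall k, 'N[m]_p%:E[EFin \o f_ k] <= M) -> 'N[m]_p%:E[EFin \o f] <= M.
Proof.
move=> mf_ mf cf fM.
have M0 : 0 <= M by apply: le_trans (fM 0%N); exact: Lnorm_ge0.
have I0 (g : T -> R) : 0 <= \int[m]_x (`|g x| `^ p)%:E.
  by apply: integral_ge0 => x _; rewrite lee_fin powR_ge0.
have IM k : \int[m]_x (`|f_ k x| `^ p)%:E <= M `^ p.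
  have := fM k; rewrite LnormE => h.
  have -> : \int[m]_x (`|f_ k x| `^ p)%:E = ((\int[m]_x (`|f_ k x| `^ p)%:E) `^ p^-1) `^ p.
    by rewrite -poweRrM mulVf ?gt_eqF// poweRe1.
  by apply: gt0_ler_poweR => //; rewrite ?(ltW p0)// in_itv/= leey andbT ?poweR_ge0.
rewrite LnormE.
have -> : M = (M `^ p) `^ p^-1 by rewrite -poweRrM mulfV ?gt_eqF// poweRe1.
apply: gt0_ler_poweR; rewrite ?invr_ge0 ?(ltW p0)// ?in_itv/= ?leey ?andbT ?poweR_ge0//.
apply: (@le_trans _ _ (\int[m]_x limn_einf (fun k => (`|f_ k x| `^ p)%:E))).
  apply: ae_ge0_le_integral => //.
  - exact: measurable_normr_powR.
  - move=> x _; rewrite limn_einf_lim; apply: lime_ge; first exact: is_cvg_einfs.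
    apply: nearW => k; apply: le_ereal_inf_tmp => _ [j _ <-].
    by rewrite lee_fin powR_ge0.
  - apply: (@emeasurable_fun_cvg _ _ R setT
      (fun k x => einfs (fun j => (`|f_ j x| `^ p)%:E) k)).
      by move=> k; apply: measurable_fun_einfs => j; exact: measurable_normr_powR.
    by move=> x _; rewrite limn_einf_lim; exact: is_cvg_einfs.
  - apply: filterS cf => x fx _.
    have : (fun k => (`|f_ k x| `^ p)%:E) @ \oo --> (`|f x| `^ p)%:E.
      apply: cvg_EFin; first exact: nearW.
      by apply: cvg_powR => //; exact: cvg_norm.
    move=> h; rewrite is_cvg_limn_einfE; last by apply/cvg_ex; exists (`|f x| `^ p)%:E.
    by rewrite (cvg_lim (@ereal_hausdorff R) h).
apply: le_trans (fatou m measurableT (fun k => measurable_normr_powR p (mf_ k)) _) _.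
  by move=> k x _; rewrite lee_fin powR_ge0.
rewrite limn_einf_lim; apply: lime_le; first exact: is_cvg_einfs.
apply: nearW => k; apply: le_trans (IM k); apply: ereal_inf_lbound.
by exists k => /=.
Qed.

End Lnorm_limits.

Section product_norms.
Context {R : realType} {N : nat}.
Hypothesis N0 : (0 < N)%N.
Notation leb := (lebesgueN R N).
Notation sigma := (@sphere_measure R N).
Variable p : R.
Hypothesis p1 : 1 <= p.
Local Open Scope ereal_scope.

Let p0 : (0 < p)%R. Proof. exact: lt_le_trans p1. Qed.

Lemma sphere_LnormE (h : N.-tuple R -> R) : measurable_fun setT h ->
  sphere_Lnorm p h = (\int[sigma]_w (`|h w| `^ p)%:E) `^ p^-1.
Proof.
move=> mh; rewrite /sphere_Lnorm unlock /=; congr (_ `^ _).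
have mhs : measurable_fun setT ((EFin \o h) \_ (@sphere R N)).
  apply/(measurable_restrictT _ _).1; first exact: measurable_sphere.
  by apply: measurable_funTS; exact/measurable_EFinP.
apply: eq_integral_sphere => //.
- apply: (measurableT_comp (f := fun y : \bar R => y `^ p)); first exact: measurable_poweR.
  exact: (measurableT_comp (@abse_measurable R setT)).
- exact: measurable_normr_powR.
- by move=> w ws; rewrite patchE mem_set.
Qed.

(** Radius and direction are independent under Lebesgue measure. *)
Lemma Lnorm_radial_angular (g : R -> R) (h : N.-tuple R -> R) :
  measurable_fun setT g -> measurable_fun setT h ->
  'N[leb]_p%:E[EFin \o (fun x => h (dir x) * g (enorm x))%R] =
  sphere_Lnorm p h * 'N[leb]_p%:E[EFin \o (fun x => g (enorm x))].
Proof.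
move=> mg mh; rewrite !LnormE sphere_LnormE//.
rewrite -poweRM; last 2 first.
- by apply: integral_ge0 => w _; rewrite lee_fin powR_ge0.
- by apply: integral_ge0 => w _; rewrite lee_fin powR_ge0.
congr (_ `^ _); rewrite muleC.
rewrite -(@ge0_integral_radial_angular R N (fun s => `|g s| `^ p)%R (fun w => `|h w| `^ p)%R).
- by apply: eq_integral => x _; congr EFin; rewrite normrM powRM// mulrC.
- apply: (measurableT_comp (f := @powR R ^~ p)); first exact: measurable_powR.
  exact: (measurableT_comp (@normr_measurable R setT)).
- by apply/measurable_EFinP; exact: measurable_normr_powR.
- by move=> s; rewrite powR_ge0.
- by move=> s; rewrite powR_ge0.
Qed.

Lemma sphere_Lnorm_pfun_lty (q : mpoly.mpoly N R) : sphere_Lnorm p (pfun q) < +oo.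
Proof.
have [K hK] := pfun_bounded_sphere q; have mq := measurable_pfun q.
rewrite sphere_LnormE//; apply: poweR_lty.
have iK : sigma.-integrable setT (EFin \o (fun w => `|pfun q w| `^ p)%R).
  apply: (@integrable_sphere _ _ N0 _ (K `^ p)%R).
    by apply/measurable_EFinP; exact: measurable_normr_powR.
  move=> w w1; rewrite ger0_norm ?powR_ge0//.
  have Kw := hK w w1; rewrite ge0_ler_powR ?nnegrE ?(ltW p0)//.
  exact: le_trans Kw.
have /integrableP[_] := iK.
by congr (_ < _); apply: eq_integral => w _; rewrite gee0_abs// lee_fin powR_ge0.
Qed.

End product_norms.

(** Tannery's theorem for series of nonnegative extended real functions. *)
Lemma nneseries_cvg0 {R : realType} (b : nat -> R -> \bar R) (T : nat -> \bar R) :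
  (forall l t, 0 <= b l t)%E -> (forall l, 0 <= T l)%E ->
  (\forall t \near +oo%R, forall l, (b l t <= T l)%E) ->
  (\sum_(0 <= l <oo) T l < +oo)%E ->
  (forall l, b l t @[t --> +oo%R] --> 0%E) ->
  (\sum_(0 <= l <oo) b l t)%E @[t --> +oo%R] --> 0%E.
Proof.
move=> b0 T0 bT Tfin bcvg; apply: cvge0_le => [t|eps e0].
  exact: nneseries_ge0.
have [L hL] : exists L, (\sum_(L <= l <oo) T l <= (eps / 2)%:E)%E.
  have /fine_cvgP[Hfin /cvgr0Pnorm_le Hle] := nneseries_tail_cvg Tfin (fun l _ => T0 l).
  have e2 : 0 < eps / 2 by rewrite divr_gt0.
  have := Hle _ e2; move: Hfin => [L1 _ h1] [L2 _ h2].
  exists (maxn L1 L2).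
  rewrite -[leLHS]fineK; last by apply: h1; rewrite /= leq_maxl.
  by rewrite lee_fin (le_trans (ler_norm _))//; apply: h2; rewrite /= leq_maxr.
have eL : 0 < eps / 2 / L.+1%:R by rewrite !divr_gt0.
have small : \forall t \near +oo%R, forall l : 'I_L, (b l t <= (eps / 2 / L.+1%:R)%:E)%E.
  apply: filter_forall => l; have /fine_cvgP[Hfin /cvgr0Pnorm_le /(_ _ eL)] := bcvg l.
  apply: filterS2 Hfin => t bf; rewrite /= -[in X in _ -> X](fineK bf) lee_fin.
  exact: le_trans (ler_norm _).
near=> t.
rewrite (@nneseries_split _ _ 0 L)// add0n big_mkord (splitr eps) EFinD leeD//.
  apply: (@le_trans _ _ (\sum_(l < L) (eps / 2 / L.+1%:R)%:E)%E).
    by apply: lee_sum => l _; move: l; near: t.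
  rewrite sumEFin lee_fin sumr_const card_ord -[X in X <= _]mulr_natr mulrAC.
  by rewrite ler_pdivrMr// ler_wpM2l ?divr_ge0 ?(ltW e0)// ler_nat.
apply: le_trans hL; apply: lee_nneseries => [l _ _|l _]; first exact: b0.
by move: l; near: t.
Unshelve. all: by end_near. Qed.

(** * Decay of the full error *)

Lemma cvg0_sume {R : realType} {T : Type} (F : set_system T) {FF : Filter F} (I : Type)
    (s : seq I) (f : I -> T -> \bar R) : (forall i, f i @ F --> 0%E) ->
  (\sum_(i <- s) f i t)%E @[t --> F] --> 0%E.
Proof.
move=> f0; elim: s => [|i s IH].
  by under eq_fun do rewrite big_nil; exact: cvg_cst.
under eq_fun do rewrite big_cons.
have H : (f i t + \sum_(j <- s) f j t)%E @[t --> F] --> (0 + 0)%E by apply: cvgeD.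
by rewrite adde0 in H.
Qed.

Section assembly.
Context {R : realType} {N : nat} (lam p : R) (n : nat).
Hypotheses (hN : (3 <= N)%N) (hlam0 : 0 <= lam) (hlam : lam <= (N%:R - 2) ^+ 2 / 4).
Hypotheses (p1 : 1 <= p) (hp : (p%:E < p_upper N lam)%E).
Notation leb := (lebesgueN R N).
Notation mu := (mu R N).
Notation nul := (nul N lam).
Notation gam := (gammap N lam p).
Variable d : nat -> nat.
Variable q : forall l, 'I_(d l) -> mpoly.mpoly N R.
Arguments q {l} _.
Hypothesis hq : forall l (m : 'I_(d l)), homog l (q m).
Hypothesis Lq : forall l (m : 'I_(d l)), laplacian (q m) = 0.
Hypothesis oq : forall l (m m' : 'I_(d l)), sdot (q m) (q m') = (m == m')%:R.
Variable C : nat -> R.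
Hypothesis hC : forall l, radial_remainder_bound N lam l n p (C l).
Variable u0lm : forall l : nat, 'I_(d l) -> R -> R.
Arguments u0lm {l} _.
Hypothesis hu0lm : forall l (m : 'I_(d l)), wL1 N lam l n (u0lm m).
Hypothesis hsum : (\sum_(0 <= l <oo) mode_bound lam p n (@q) C (@u0lm) l < +oo)%E.
Variable Y : forall l : nat, 'I_(d l) -> N.-tuple R -> R.
Arguments Y {l} _ _.
Hypothesis hYq : forall l (m : 'I_(d l)) w, sphere w -> Y m w = pfun (q m) w.
Variable u0 : N.-tuple R -> R.
Hypothesis hu0 : measurable_fun setT u0.
Hypothesis hexp : harmonic_expansion (@Y) (@u0lm) u0.
Hypothesis hu : mild_solution_defined lam (@Y) u0.

Let N0 : (0 < N)%N. Proof. exact: leq_trans hN. Qed.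
Let p0 : 0 < p. Proof. exact: lt_le_trans p1. Qed.

Notation rem l f := (radial_remainder (N := N) mu (nul l) n f).

Let mode_rem t l (x : N.-tuple R) : R :=
  \sum_(m < d l) pfun (q m) (dir x) * rem l (u0lm m) (enorm x) t.

Let err t (x : N.-tuple R) : R :=
  mild_solution lam (@Y) u0 x t - A_infty lam (@Y) (@u0lm) n x t.

Let mu0lm l (m : 'I_(d l)) : measurable_fun setT (fun y : N.-tuple R => u0lm m (enorm y)).
Proof. by have [/(measurable_radial (N := N))] := hu0lm m. Qed.

(** The series of [u] and of [A_infty] both converge, so their difference is the
    series of the radial remainders. *)
Lemma error_series_cvg x t : enorm x != 0 -> 1 <= t ->
  series (fun l => mode_rem t l x) @ \oo --> err t x.
Proof.
move=> x0 t1; have t0 : 0 < t by exact: lt_le_trans t1.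
have r0 := enorm_gt0 x0; have w1 : sphere (dir x) by exact: enorm_dir.
have cu := solution_series_cvg hN hlam p1 hq Lq oq hC hu0lm hsum hYq hu0 hexp hu x0 t1.
have mm := mode_mass_summable hN hlam p1 hq oq hC hu0lm hsum w1 r0 t0.
pose a l := \sum_(m < d l) \sum_(j < n.+1) profile lam l j (u0lm m) x t * Y m (dir x).
have ca : cvgn (series a).
  apply: (@norm_series_dominated _ _ (n.+1%:R *: mode_mass lam n (@q) (@u0lm) (dir x) (enorm x) t));
    last exact: is_cvg_seriesZ.
  move=> l; rewrite (le_trans (ler_norm_sum _ _ _))// fctE /GRing.scale/= /mode_mass mulr_sumr.
  apply: ler_sum => m _; rewrite (le_trans (ler_norm_sum _ _ _))//.
  rewrite mulr_natl -[X in _ *+ X]card_ord -sumr_const ler_sum// => j _.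
  rewrite normrM mulrC hYq// ler_wpM2l//.
  rewrite (profileE hN (ltnSE (ltn_ord j)) (hu0lm m) x0 t1).
  exact: (rprofile_integrable N0 (nul_ge0 _ _ _) (mu0lm m) (hu0lm m).2 r0 t1 (ltnSE (ltn_ord j))).2.
have := cvgB cu (ca : _ --> _); rewrite -/(A_infty _ _ _ _ _ _).
rewrite (_ : _ - _ = series (fun l => mode_rem t l x)); first exact.
apply/funext => L; rewrite -[LHS]/(series _ L - series _ L) /series /= -sumrB.
apply: eq_bigr => l _.
rewrite /a -sumrB; apply: eq_bigr => m _.
by rewrite -mulr_suml hYq// mulrC -mulrBl mulrC -remainderE.
Qed.

Let measurable_mode_rem t l : measurable_fun setT (mode_rem t l).
Proof.
apply: measurable_sum => m; apply: measurable_funM.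
  by apply: (measurableT_comp (measurable_pfun _)); exact: measurable_dir.
exact: measurable_rem_enorm.
Qed.

(** Off the origin the error is a pointwise limit of measurable functions; the
    indicator makes the sequence converge at the origin as well. *)
Let measurable_err t : 1 <= t -> measurable_fun setT (err t).
Proof.
move=> t1.
apply: (@measurable_off_origin _ _ _ (fun x => limn (fun L =>
  (enorm x \in `]0, +oo[)%:R * series (fun l => mode_rem t l x) L))).
  apply: (measurable_fun_cvg (h := fun L x =>
    (enorm x \in `]0, +oo[)%:R * series (fun l => mode_rem t l x) L)).
  - move=> L; apply: measurable_funM.
      exact: measurable_enorm_bool.
    by apply: measurable_sum => l; exact: measurable_mode_rem.
  - move=> x _; rewrite in_itv/= andbT; case: ltP => [x0|_].
      under eq_fun do rewrite mul1r.
      by apply/cvg_ex; exists (err t x); apply: error_series_cvg => //; rewrite gt_eqF.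
    under eq_fun do rewrite mul0r.
    by rewrite lim_cst//; exact: cvg_cst.
move=> x x0; rewrite in_itv/= (enorm_gt0 x0); under eq_fun do rewrite mul1r.
by apply/esym/cvg_lim => //; exact: error_series_cvg.
Qed.

Let mode_size l t : \bar R := (\sum_(m < d l) sphere_Lnorm p (pfun (q m)) *
  ((t `^ (gam + n%:R))%:E *
   'N[leb]_p%:E[EFin \o (fun x => rem l (u0lm m) (enorm x) t)]))%E.

Let tc t : (0 <= (t `^ (gam + n%:R))%:E)%E. Proof. by rewrite lee_fin powR_ge0. Qed.

Let Lnorm_mode_le t l :
  ((t `^ (gam + n%:R))%:E * 'N[leb]_p%:E[EFin \o mode_rem t l] <= mode_size l t)%E.
Proof.
have mg (m : 'I_(d l)) : measurable_fun setT (fun r => rem l (u0lm m) r t).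
  by apply: measurable_rem => //; exact: nul_ge0.
apply: le_trans (lee_wpmul2l (tc t) (Lnorm_sum_le leb p1 _ _)) _.
  move=> m; apply: measurable_funM.
    by apply: (measurableT_comp (measurable_pfun _)); exact: measurable_dir.
  exact: measurable_rem_enorm.
rewrite ge0_sume_distrr; last by move=> m _; exact: Lnorm_ge0.
apply: lee_sum => m _.
by rewrite (Lnorm_radial_angular N0 p (mg m) (measurable_pfun _)) muleCA.
Qed.

(** Minkowski's inequality on partial sums passes to the limit by [Lnorm_lim_le]. *)
Let Lnorm_err_le t : 1 <= t ->
  ((t `^ (gam + n%:R))%:E * 'N[leb]_p%:E[EFin \o err t] <= \sum_(0 <= l <oo) mode_size l t)%E.
Proof.
move=> t1; apply: (@le_trans _ _ ((t `^ (gam + n%:R))%:E *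
    \sum_(0 <= l <oo) 'N[leb]_p%:E[EFin \o mode_rem t l])%E).
  rewrite lee_wpmul2l//.
  apply: (@Lnorm_lim_le _ _ R leb p p1 (fun L x => \sum_(0 <= l < L) mode_rem t l x)).
  - by move=> L; apply: measurable_sum.
  - exact: measurable_err.
  - by apply: filterS (ae_enorm_neq0 N0) => x x0; exact: error_series_cvg.
  - move=> L; apply: le_trans (Lnorm_sum_le leb p1 _ _) _; first by [].
    by apply: nneseries_lim_ge => l _ _; exact: Lnorm_ge0.
rewrite -nneseriesZl; last by move=> l _; exact: Lnorm_ge0.
apply: lee_nneseries => [l _ _|l _]; last exact: Lnorm_mode_le.
by rewrite mule_ge0// Lnorm_ge0.
Qed.

Let mode_size_ge0 l t : (0 <= mode_size l t)%E.
Proof.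
by apply: sume_ge0 => m _; rewrite mule_ge0 ?sphere_Lnorm_ge0// mule_ge0// Lnorm_ge0.
Qed.

Let mode_size_le l t : 1 <= t -> (mode_size l t <= mode_bound lam p n (@q) C (@u0lm) l)%E.
Proof.
move=> t1; apply: lee_sum => m _; rewrite -muleA lee_wpmul2l ?sphere_Lnorm_ge0//.
exact: (@Lnorm_rem_le R N lam p n l hN p1 (C l) (@hC l) _ _ (hu0lm m) t1).
Qed.

Let mode_size_cvg l : mode_size l t @[t --> +oo%R] --> 0%E.
Proof.
apply: cvg0_sume => m; set S := sphere_Lnorm _ _.
have Sf : S \is a fin_num by rewrite ge0_fin_numE ?sphere_Lnorm_ge0// sphere_Lnorm_pfun_lty.
rewrite -[X in _ --> X](mule0 S); apply: cvgeZl => //.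
exact: (@mode_cvg R N lam p n l hN hlam0 p1 hp (C l) (@hC l) _ (hu0lm m)).
Qed.

Lemma error_cvg0 :
  ((t `^ (gam + n%:R))%:E * 'N[leb]_p%:E[EFin \o err t])%E @[t --> +oo%R] --> 0%E.
Proof.
apply: (@squeeze_cvge _ _ _ _ (fun=> 0%E) _ (fun t => \sum_(0 <= l <oo) mode_size l t)%E).
- near=> t; have t1 : 1 <= t by near: t; exact: nbhs_pinfty_ge.
  by rewrite mule_ge0 ?Lnorm_ge0//= Lnorm_err_le.
- exact: cvg_cst.
- apply: nneseries_cvg0 hsum _ => //.
  + by move=> l; exact: (mode_bound_ge0 hN p1 (@q) (@hC) hu0lm).
  + by near=> t => l; apply: mode_size_le; near: t; exact: nbhs_pinfty_ge.
Unshelve. all: by end_near. Qed.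

End assembly.

Theorem theorem2p3 (R : realType) (N : nat) (lam : R)
  (hN : (3 <= N)%N)
  (hlam0 : 0 <= lam) (hlam : lam <= (N%:R - 2) ^+ 2 / 4)
  (d : nat -> nat) (Y : forall l : nat, 'I_(d l) -> N.-tuple R -> R)
  (hY : forall l : nat, harmonic_onbasis l (@Y l))
  (n : nat) (p : R) (hp1 : 1 <= p)
  (hp_lower : 2 * (N%:R - 1) / (N%:R + 2 * nu N lam + 4 * n%:R + 4) <= p)
  (hp_upper : (p%:E < p_upper N lam)%E)
  (C : nat -> R)
  (hC : forall l : nat, radial_remainder_bound N lam l n p (C l))
  (u0 : N.-tuple R -> R) (hu0 : measurable_fun [set: N.-tuple R] u0)
  (u0lm : forall l : nat, 'I_(d l) -> R -> R)
  (hexp : harmonic_expansion Y u0lm u0)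
  (hu0lm : forall (l : nat) (m : 'I_(d l)), wL1 N lam l n (@u0lm l m))
  (hsum : (\sum_(0 <= l <oo) \sum_(m < d l)
             (sphere_Lnorm p (@Y l m) * (C l)%:E * wnorm N lam l n (@u0lm l m))
           < +oo)%E)
  (hu : mild_solution_defined lam Y u0) :
  ((t `^ (gammap N lam p + n%:R))%:E *
   'N[lebesgueN R N]_p%:E[EFin \o (fun x : N.-tuple R =>
      mild_solution lam Y u0 x t - A_infty lam Y u0lm n x t)%R])%E
  @[t --> +oo%R] --> 0%E.
Proof.
have sh l (m : 'I_(d l)) : spherical_harmonic l (Y l m) by have [] := hY l.
pose q l (m : 'I_(d l)) := s2val (cid2 (sh l m)).
have hq l (m : 'I_(d l)) : homog l (q l m) by have [] := s2valP (cid2 (sh l m)).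
have Lq l (m : 'I_(d l)) : laplacian (q l m) = 0 by have [] := s2valP (cid2 (sh l m)).
have hYq l (m : 'I_(d l)) w : sphere w -> Y l m w = pfun (q l m) w.
  exact: (s2valP' (cid2 (sh l m))).
have oq l (m m' : 'I_(d l)) : sdot (q l m) (q l m') = (m == m')%:R.
  have [_ <- _] := hY l; apply: eq_Rintegral => w /set_mem w1.
  by rewrite !hYq.
have hsumq : (\sum_(0 <= l <oo) mode_bound lam p n q C u0lm l < +oo)%E.
  move: hsum; congr (_ < _)%E; apply: eq_eseriesr => l _; apply: eq_bigr => m _.
  by rewrite (eq_sphere_Lnorm p (hYq l m)).
exact: (error_cvg0 hN hlam0 hlam hp1 hp_upper hq Lq oq hC hu0lm hsumq hYq hu0 hexp hu).
Qed.
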